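(* Let $G$ be a connected colored graph on the vertex set $[n]=\{1,\ldots,n\}$ with coloring $\lambda$, where no vertex has the same color as an edge. Then the ideal $I_G$ is generated by binomials if and only if $G$ is a block graph and triangle-regular.
   Context: Graphs are finite, undirected, without loops or multiple edges. A colored graph is a graph $G$ together with a map $\lambda$ assigning a color $\lambda(i)$ to each vertex $i$ and a color $\lambda(\{i,j\})$ to each edge $\{i,j\}$. Model and ideal. $\mathcal{L}_G$ is the linear space of real symmetric $n\times n$ matrices $K=(k_{ij})$ such that: $k_{ij}=0$ whenever $i\ne j$ and $\{i,j\}$ is not an edge; $k_{ii}=k_{jj}$ whenever $\lambda(i)=\lambda(j)$; $k_{ij}=k_{i'j'}$ whenever $\{i,j\},\{i',j'\}$ are edges with $\lambda(\{i,j\})=\lambda(\{i',j'\})$. Let $M_G=\{K^{-1}\mid K\in\mathcal{L}_G\text{ positive definite}\}$. $I_G$ is the ideal of all polynomials in $\mathbb{R}[\sigma_{ij}\mid i,j\in[n]]/(\sigma_{ij}-\sigma_{ji})$ (the polynomial ring in the entries of a symmetric matrix) that vanish identically on $M_G$. A binomial is a polynomial of the form $\sigma^\alpha-\sigma^\beta$ for multi-indices $\alpha,\beta$. Block graph. A connected graph is a block graph if it is complete, or else its vertex set admits a partition into three nonempty subsets $A,B,\{c\}$ such that no edge connects a vertex of $A$ to a vertex of $B$ and the induced subgraphs on $A\cup\{c\}$ and $B\cup\{c\}$ are block graphs (recursive definition). Triangle-regular. A triangle is a set of three pairwise adjacent vertices; colored triangles (with their vertex and edge colors) are compared up to color-preserving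 isomorphism. $G$ is vertex-regular if any two vertices of the same color are incident with the same multiset of colored edges; edge-regular if any two edges of the same color are incident with the same multiset of colored vertices; edge triangle-regular if any two edges of the same color are incident with (contained in) the same multiset of colored triangles; and triangle-regular if it is vertex-regular, edge-regular and edge triangle-regular. *)

(* Defs.v *)
From HB Require Import structures.
From mathcomp Require Import all_boot all_order all_algebra.
From mathcomp Require Import reals.
From mathcomp Require Import mpoly.

Set Implicit Arguments.
Unset Strict Implicit.
Unset Printing Implicit Defensive.

Import GRing.Theory Num.Theory.

Local Open Scope ring_scope.

(* Vertices are 'I_n (so [n] is numbered from 0) and edges are two-element sets
   of vertices; the values of [ecol] outside [edges] are never used. *)
Record cgraph (n : nat) (C : eqType) := CGraph {
  edges : {set {set 'I_n}};
  edges_card2 : forall e, e \in edges -> #|e| = 2%N;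
  vcol : 'I_n -> C;
  ecol : {set 'I_n} -> C
}.

Section ColoredGraph.
Variables (n : nat) (C : eqType) (G : cgraph n C).

Definition adj : rel 'I_n := fun i j => [set i; j] \in edges G.

(* Properties of the subgraph induced on a set of vertices. *)
Definition connected_on (A : {set 'I_n}) : Prop :=
  A != set0 /\
  {in A &, forall i j, connect (fun u v => [&& u \in A, v \in A & adj u v]) i j}.

Definition complete_on (A : {set 'I_n}) : Prop :=
  {in A &, forall i j, i != j -> adj i j}.

Inductive block_on : {set 'I_n} -> Prop :=
| BlockComplete (A : {set 'I_n}) :
    connected_on A -> complete_on A -> block_on A
| BlockGlue (A B : {set 'I_n}) (c : 'I_n) :
    connected_on (c |: (A :|: B)) ->
    A != set0 -> B != set0 ->
    [disjoint A & B] -> c \notin A -> c \notin B ->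
    {in A & B, forall a b, ~~ adj a b} ->
    block_on (c |: A) -> block_on (c |: B) ->
    block_on (c |: (A :|: B)).

Definition connected_graph : Prop := connected_on [set: 'I_n].

Definition block_graph : Prop := block_on [set: 'I_n].

(* Multisets of colors are sequences up to [perm_eq]. *)
Definition vertex_regular : Prop :=
  forall i j : 'I_n, vcol G i = vcol G j ->
    perm_eq [seq ecol G e | e in [set e in edges G | i \in e]]
            [seq ecol G e | e in [set e in edges G | j \in e]].

Definition edge_regular : Prop :=
  {in edges G &, forall e e', ecol G e = ecol G e' ->
    perm_eq [seq vcol G i | i in e] [seq vcol G i | i in e']}.

Definition triangle (T : {set 'I_n}) : bool :=
  (#|T| == 3%N) && [forall i in T, forall j in T, (i != j) ==> adj i j].

Definition triangles_of (e : {set 'I_n}) : {set {set 'I_n}} :=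
  [set T | triangle T & e \subset T].

(* Color-preserving isomorphism between colored triangles; f matters on T only,
   and the edges through which the triangles are counted are not marked. *)
Definition color_iso (T T' : {set 'I_n}) : Prop :=
  exists f : 'I_n -> 'I_n,
    [/\ {in T &, injective f}, f @: T = T',
        {in T, forall i, vcol G (f i) = vcol G i} &
        {in T &, forall i j, i != j ->
           ecol G [set f i; f j] = ecol G [set i; j]}].

(* Two families of triangles form the same multiset up to isomorphism when they
   are matched by a bijection F sending each triangle to an isomorphic one. *)
Definition edge_triangle_regular : Prop :=
  {in edges G &, forall e e', ecol G e = ecol G e' ->
    exists F : {set 'I_n} -> {set 'I_n},
      [/\ {in triangles_of e &, injective F},
          F @: triangles_of e = triangles_of e' &
          {in triangles_of e, forall T, color_iso T (F T)}]}.

Definition triangle_regular : Prop :=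
  [/\ vertex_regular, edge_regular & edge_triangle_regular].

End ColoredGraph.

Section Model.
Variables (R : realType) (n : nat).

Definition posdef (K : 'M[R]_n) : Prop :=
  forall v : 'rV[R]_n, v != 0 -> 0 < (v *m K *m v^T) 0 0.

Variables (C : eqType) (G : cgraph n C).

Definition in_LG (K : 'M[R]_n) : Prop :=
  [/\ K^T = K,
      forall i j, i != j -> ~~ adj G i j -> K i j = 0,
      forall i j, vcol G i = vcol G j -> K i i = K j j &
      forall i j i' j', adj G i j -> adj G i' j' ->
        ecol G [set i; j] = ecol G [set i'; j'] -> K i j = K i' j'].

Definition in_MG (S : 'M[R]_n) : Prop :=
  exists K : 'M[R]_n, [/\ in_LG K, posdef K & S = invmx K].

End Model.

(* The ring R[sigma_ij]/(sigma_ij - sigma_ji) is presented as the polynomial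
   ring whose variables sigma_ij are indexed by the pairs with i <= j. *)
Definition sympair (n : nat) : finType :=
  {p : 'I_n * 'I_n | (p.1 <= p.2)%N}.

Notation sympoly R n := {mpoly R[#|sympair n|]}.

Section Ideals.
Variables (R : realType) (n : nat).

Definition sym_eval (S : 'M[R]_n) (p : sympoly R n) : R :=
  p.@[fun k => let ij := val (enum_val k) in S ij.1 ij.2].

Definition in_IG (C : eqType) (G : cgraph n C) (p : sympoly R n) : Prop :=
  forall S : 'M[R]_n, in_MG G S -> sym_eval S p = 0.

Definition binomial (p : sympoly R n) : Prop :=
  exists a b : 'X_{1..#|sympair n|}, p = 'X_[a] - 'X_[b].

Definition ideal_gen (B : sympoly R n -> Prop) (p : sympoly R n) : Prop :=
  exists s : seq (sympoly R n * sympoly R n),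
    (forall x, x \in s -> B x.2) /\ p = \sum_(x <- s) x.1 * x.2.

Definition generated_by_binomials (I : sympoly R n -> Prop) : Prop :=
  exists B : sympoly R n -> Prop,
    (forall p, B p -> binomial p) /\ (forall p, I p <-> ideal_gen B p).

End Ideals.

(* Main.v *)
(* Both directions compare M_G with the matrices whose entries are monomials
   along induced paths: s_ij = prod_v s_v * prod_e g_e over the vertices and
   edges of the path from i to j in a block graph, where s_v is the variance and
   g_e = s_e / (s_u s_v) for e = {u, v}.

   If G is a block graph and triangle-regular, the inverse of such a matrix with
   colour-constant s and g lies in L_G.  Inside a block B the inverse is governed
   by Y_B (diagonal 1 / s_v, off-diagonal entries g_e), and the families (Y_B)
   with entries constant on colours form a unital Jordan algebra, hence are
   closed under inversion; this uses that the block degrees of equally coloured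
   edges agree, a consequence of regularity and of the tree structure of the
   blocks.  Conversely every S in M_G is of this form: near the identity, the
   monomial matrix with the colour averages of S has an inverse K' in L_G, and
   tr ((K - K') (S - S')) = 0 forces K = K' because inversion is strictly
   decreasing; this extends to all of M_G along segments.  So I_G is the kernel
   of a monomial map, which is generated by binomials.

   If I_G is generated by binomials, M_G is closed under entrywise products up to
   the defining equations, so the adjugate of S o T lies in L_G for S, T in M_G.
   Taking T = (1 - t A)^-1 with A the adjacency matrix and expanding in t gives:
   s_ii depends on the colour of i, s_ij / (s_ii s_jj) on the colour of {i, j},
   and the sum over common neighbours k of nonadjacent i, j of
   s_ij - s_ik s_kj / s_kk vanishes.  For S = (1 - t A)^-1 the latter terms are
   nonnegative, and positive unless k separates i from j, so G is a block graph.
   Expanding S = (D - t H)^-1 to order t^3 turns the first two facts into the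
   regularity conditions. *)
Require Import Defs.
From mathcomp Require Import all_boot all_order all_algebra.
From mathcomp Require Import reals.
From mathcomp Require Import mpoly.
From mathcomp Require Import ring lra.

Set Implicit Arguments.
Unset Strict Implicit.
Unset Printing Implicit Defensive.

Import Order.TTheory GRing.Theory Num.Theory.

Local Open Scope ring_scope.

(** * Separating vertices and blocks *)

(** Triangles are compared without orientation, so if the ends of an edge have the same color, a
    matching of triangles may exchange them; edge-triangle regularity then controls block degrees
    only summed over both ends. Diagonal entries of products in the Jordan algebra need them at each
    end. The gap is closed by showing that, when the edges of one color join vertices of a single
    color, any two of them meeting at a vertex lie in the same block.

    In the other direction, second-order coefficients count edges at a vertex and triangles on an
    edge, but say nothing direct about the colors of the ends of an edge. These appear at third
    order, where walks leaving a block collapse onto its vertices and what remains is a quadratic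
    form in the vertex weights built from degrees inside the block.

    Limits and implicit functions are avoided: adjugates replace inverses, so each expansion or
    continuation is an identity between polynomials in [t] that holds for all small positive [t]. *)

Section Separation.
Variables (n : nat) (C : eqType) (G : cgraph n C).
Local Notation adj := (adj G).

Lemma adj_sym i j : adj i j = adj j i.
Proof. by rewrite /Defs.adj setUC. Qed.

Lemma adj_neq i j : adj i j -> i != j.
Proof.
move=> /(@edges_card2 _ _ G); apply: contra_eqN => /eqP ->.
by rewrite setUid cards1.
Qed.

Lemma adjxx i : adj i i = false.
Proof. by apply/negP => /adj_neq; rewrite eqxx. Qed.

Lemma edge_ends e : e \in edges G -> exists i j, e = [set i; j] /\ adj i j.
Proof.
move=> eG; have /cards2P[i [j [_ De]]] : #|e| == 2%N.
  by rewrite (edges_card2 eG).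
by exists i, j; rewrite /Defs.adj -De.
Qed.

Definition avoid (c : 'I_n) : rel 'I_n :=
  fun u v => [&& u != c, v != c & adj u v].

Definition conn_avoid c := connect (avoid c).

(** In a connected graph, the vertices met by every walk from [i] to [j]. The disjunct [v == i]
    matters only for [i = j], where reflexivity makes [conn_avoid i i i] true. *)
Definition between i j : {set 'I_n} :=
  [set v | (v == i) || ~~ conn_avoid v i j].

(* Block graphs are exactly the graphs in which the middle vertex of every
   induced path with three vertices separates the two ends. *)
Definition middle_separates : Prop :=
  forall i l j, adj i l -> adj l j -> i != j -> ~~ adj i j ->
    ~~ conn_avoid l i j.

Lemma avoid_sym c u v : avoid c u v = avoid c v u.
Proof. by rewrite /avoid adj_sym andbCA. Qed.

Lemma conn_avoid_refl c i : conn_avoid c i i.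
Proof. exact: connect0. Qed.

Lemma conn_avoid_sym c i j : conn_avoid c i j = conn_avoid c j i.
Proof. by apply: sym_connect_sym => u v; apply: avoid_sym. Qed.

Lemma conn_avoid_trans c : transitive (conn_avoid c).
Proof. exact: connect_trans. Qed.

Lemma conn_avoid1 c i j : i != c -> j != c -> adj i j -> conn_avoid c i j.
Proof. by move=> ic jc ij; apply: connect1; rewrite /avoid ic jc. Qed.

Lemma conn_avoid_self c j : conn_avoid c c j -> j = c.
Proof.
case/connectP=> [[|x p] /=]; first by move=> _ ->.
by rewrite /avoid eqxx.
Qed.

Lemma conn_avoid_neq c i j : conn_avoid c i j -> i != c -> j != c.
Proof.
by move=> h; apply: contra_neq => jc; move: h; rewrite jc conn_avoid_sym => /conn_avoid_self.
Qed.

(** A walk to [j] must meet [c]; [w] is the vertex just before its first visit. *)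
Lemma connect_conn_avoid c i j :
  connect adj i j -> i != c -> ~~ conn_avoid c i j ->
  exists2 w, conn_avoid c i w & adj w c.
Proof.
move=> /connectP[p]; elim: p i => [|x p IH] i /= => [_ -> _|].
  by rewrite conn_avoid_refl.
case/andP=> ix px Dj ic nij.
have [xc|xc] := eqVneq x c; first by exists i; rewrite -?xc // conn_avoid_refl.
have cix : conn_avoid c i x by exact: conn_avoid1.
have [|w xw wc] := IH x px Dj xc.
  by apply: contra nij; apply: conn_avoid_trans.
by exists w => //; apply: conn_avoid_trans xw.
Qed.

Lemma between_sym i j : between i j = between j i.
Proof.
apply/setP => v; rewrite !inE conn_avoid_sym.
have [vi|vi] := eqVneq v i; have [vj|vj] := eqVneq v j => //=; subst v.
- by apply/esym/negP; rewrite conn_avoid_sym => /conn_avoid_self Dj; rewrite Dj eqxx in vj.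
- by apply/negP => /conn_avoid_self Di; rewrite Di eqxx in vi.
Qed.

Lemma between_l i j : i \in between i j.
Proof. by rewrite inE eqxx. Qed.

Lemma between_r i j : j \in between i j.
Proof. by rewrite between_sym between_l. Qed.

Lemma between_xx i : between i i = [set i].
Proof. by apply/setP=> v; rewrite !inE conn_avoid_refl orbF. Qed.

Lemma between_adj i j : adj i j -> between i j = [set i; j].
Proof.
move=> ij; apply/setP=> v; rewrite !inE.
have [//|vi] /= := eqVneq v i.
have [->|vj] /= := eqVneq v j.
  by have := between_r i j; rewrite inE (negPf (_ : j != i)) // eq_sym adj_neq.
by rewrite conn_avoid1 // eq_sym.
Qed.

Hypothesis conn : forall i j, connect adj i j.

(** Otherwise walks from [i] that avoid [c] never meet [v]. One of them reaches a neighbor [w] of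
    [c], and its extension to [c] still avoids [v], although [v] separates [i] from [c]. *)
Lemma between_conn v i c : v \in between i c -> v != c -> conn_avoid c i v.
Proof.
rewrite inE => /orP[/eqP->|nv] vc; first by rewrite conn_avoid_refl.
have [Dic|ic] := eqVneq i c.
  by move: nv; rewrite Dic conn_avoid_refl.
apply: contraR nv => niv.
have [w iw wc] : exists2 w, conn_avoid c i w & adj w c.
  have [icv|] := boolP (conn_avoid c i c).
    by have := conn_avoid_neq icv ic; rewrite eqxx.
  exact: connect_conn_avoid.
have vi : v != i by apply: contraNneq niv => ->; rewrite conn_avoid_refl.
have nw : w != v by apply: contraNneq niv => <-.
apply: (@conn_avoid_trans _ w); last by rewrite conn_avoid1 // eq_sym.
have {wc nw} : conn_avoid c i w := iw.
case/connectP => p; elim: p i {iw ic} vi niv => [|x p IH] i vi niv /=.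
  by move=> _ ->; rewrite conn_avoid_refl.
case/andP=> hix px Dw.
have nxv : ~~ conn_avoid c x v.
  by apply: contra niv; apply: connect_trans; apply: connect1.
have vx : v != x by apply: contraNneq nxv => ->; rewrite conn_avoid_refl.
apply: (@conn_avoid_trans _ x); last exact: IH.
by case/and3P: hix => *; rewrite conn_avoid1 // eq_sym.
Qed.

Lemma between_meet c i j v : c \in between i j ->
  v \in between i c -> v \in between c j -> v = c.
Proof.
move=> cij vi vj; apply/eqP; apply: contraTT (cij) => vc; rewrite inE negb_or negbK.
have cv := between_conn vi vc.
have cv' : conn_avoid c v j.
  by rewrite conn_avoid_sym; apply: between_conn vc; rewrite between_sym.
rewrite (conn_avoid_trans cv cv') andbT.
by apply: contraNneq vc => ci; move: vi; rewrite -ci between_xx inE => /eqP ->.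
Qed.

(** A walk from [i] to [j] avoiding [v] still passes through [c], and splits there into two walks
    avoiding [v]. *)
Lemma between_cat c i j : c \in between i j ->
  between i j = between i c :|: between c j.
Proof.
move=> cij; apply/setP => v; rewrite in_setU.
have [->|vc] := eqVneq v c; first by rewrite between_r cij.
have [vi|vi] := eqVneq v i; first by rewrite vi !between_l.
have [vj|vj] := eqVneq v j; first by rewrite vj !between_r orbT.
rewrite !inE (negPf vi) (negPf vc) /=; move: cij; rewrite inE.
case/orP=> [/eqP->|cij]; first by rewrite conn_avoid_refl.
rewrite -negb_and; congr (~~ _); apply/idP/andP => [/connectP[p]|[]]; last first.
  exact: conn_avoid_trans.
move=> pth Dj.
have : ~~ path (avoid c) i p.
  by apply: contra cij => h; apply/connectP; exists p.
elim: p i {cij} vi pth Dj => [|x p IH] i vi //= /andP[ix px] Dj.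
have vx : v != x by case/and3P: ix => _; rewrite eq_sym.
rewrite negb_and => h.
have [xc|xc] := eqVneq x c.
  rewrite -xc; split; first exact: connect1.
  by apply/connectP; exists p.
have [ic|ic] := eqVneq i c.
  rewrite ic; split; first by rewrite conn_avoid_refl.
  apply/connectP; exists (x :: p) => //=; by rewrite -{1}ic ix.
have {}h : ~~ path (avoid c) x p.
  by move: h; rewrite /avoid ic xc; case/and3P: ix => _ _ ->.
have [h1 h2] := IH x vx px Dj h; split=> //.
by apply: connect_trans h1; apply: connect1.
Qed.

Lemma between_cross c i j u w : c \in between i j ->
  u \in between i c -> w \in between c j -> adj u w -> u = c \/ w = c.
Proof.
move=> cij ui wj uw; have [->|uc] := eqVneq u c; first by left.
have [->|wc] := eqVneq w c; [by right | exfalso].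
have iu := between_conn ui uc.
have wj' : conn_avoid c w j.
  by rewrite conn_avoid_sym; apply: between_conn wc; rewrite between_sym.
have ij : conn_avoid c i j.
  by apply: conn_avoid_trans iu (conn_avoid_trans _ wj'); apply: conn_avoid1.
move: cij; rewrite inE ij orbF => /eqP ci.
by move: ui; rewrite -ci between_xx inE => /eqP Du; rewrite Du ci eqxx in uc.
Qed.

Lemma between_conn_l c i j : c \in between i j -> c != i -> conn_avoid i c j.
Proof.
move=> cij ci; rewrite conn_avoid_sym; apply: between_conn ci.
by rewrite between_sym.
Qed.

End Separation.

(** * Blocks as cliques, and the first step of an induced path *)

Section Blocks.
Variables (n : nat) (C : eqType) (G : cgraph n C).
Local Notation adj := (adj G).
Local Notation conn_avoid := (conn_avoid G).
Local Notation between := (between G).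

(* The block containing the edge [set i; j], when G is a block graph. *)
Definition block i j : {set 'I_n} :=
  [set v | ((v == i) || adj v i) && ((v == j) || adj v j)].

Lemma block_sym i j : block i j = block j i.
Proof. by apply/setP=> v; rewrite !inE andbC. Qed.

Lemma mem_block_l i j : adj i j -> i \in block i j.
Proof. by move=> ij; rewrite inE eqxx /= ij orbT. Qed.

Lemma mem_block_r i j : adj i j -> j \in block i j.
Proof. by move=> ij; rewrite block_sym mem_block_l // adj_sym. Qed.

Hypothesis bg : middle_separates G.

(** Otherwise [x v w] is an induced path whose ends are joined through [y], avoiding [v]. Thus the
    neighbors of a vertex split into cliques, one for each block through it. *)
Lemma nbr_trans v x y w :
  adj v x -> adj v y -> adj v w -> (x == y) || adj x y -> (y == w) || adj y w ->
  (x == w) || adj x w.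
Proof.
move=> vx vy vw /orP[/eqP->//|xy] /orP[/eqP<-|yw]; first by rewrite xy orbT.
have [//|xw] /= := eqVneq x w; apply: contraT => nxw.
have /negP[] := bg (etrans (adj_sym _ _ _) vx) vw xw nxw.
have := (adj_neq vx, adj_neq vy, adj_neq vw); rewrite ![v == _]eq_sym => -[[xv yv] wv].
by apply: (@conn_avoid_trans _ _ _ _ y); rewrite conn_avoid1.
Qed.

Lemma block_adj i j u v : adj i j ->
  u \in block i j -> v \in block i j -> u != v -> adj u v.
Proof.
move=> ij; rewrite !inE => /andP[ui uj] /andP[vi vj] uv.
have [Du|nui] := eqVneq u i; first by move: vi uv; rewrite Du adj_sym => /orP[/eqP->|//]; rewrite eqxx.
have [Dv|nvi] := eqVneq v i; first by move: ui uv; rewrite Dv => /orP[/eqP->|//]; rewrite eqxx.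
rewrite (negPf nui) (negPf nvi) /= in ui vi.
rewrite eq_sym (adj_sym _ v) in vj; rewrite -[adj u v]orFb -(negPf uv).
by apply: (@nbr_trans i u j v) => //; rewrite adj_sym.
Qed.

Lemma block_sub i j u v : adj i j ->
  u \in block i j -> v \in block i j -> block i j \subset block u v.
Proof.
move=> ij ui vi; apply/subsetP=> x xi; rewrite inE.
apply/andP; split; [have [//|] := eqVneq x u | have [//|] := eqVneq x v];
  exact: block_adj ij xi _.
Qed.

Lemma block_eq i j u v : adj i j ->
  u \in block i j -> v \in block i j -> u != v -> block u v = block i j.
Proof.
move=> ij ui vi uv; have uva := block_adj ij ui vi uv.
apply/eqP; rewrite eqEsubset [X in _ && X]block_sub // andbT.
by have /subsetP s := block_sub ij ui vi; apply: block_sub => //;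
  apply: s; rewrite ?mem_block_l ?mem_block_r.
Qed.

Lemma block_nbr i j l : adj i j -> adj i l ->
  (l \in block i j) = (l == j) || adj l j.
Proof. by move=> ij il; rewrite inE (adj_sym _ l i) il orbT. Qed.

Hypothesis conn : forall i j, connect adj i j.

(** Here [c] is the second vertex of the induced path from [i] to [j]. Induct along a simple path
    with second vertex [x]: the gate [c] from [x] also serves [i] if adjacent to it; otherwise
    [i x c] is an induced path, so [x] separates [i] from [c], hence from [j]. *)
Lemma gate i j : i != j -> exists2 c, adj i c & c \in between i j.
Proof.
have /connectP[p0 pth0 lst0] := conn i j; case/shortenP: pth0 lst0 => p pth un _.
elim: p i pth un {p0} => [|x p IH] i /= pth un Dj.
  by rewrite Dj eqxx.
move: pth => /andP[ix px]; move: un => /andP[ixp unx].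
have [xj|xj] := eqVneq x j; first by exists j; rewrite ?between_r // -xj.
have [c xc cxj] := IH x px unx Dj xj.
have cx : c != x by rewrite eq_sym (adj_neq xc).
have ncxj : ~~ conn_avoid c x j by move: cxj; rewrite inE (negPf cx).
have ic : i != c.
  apply: contraNneq ncxj => Di; rewrite -Di; apply/connectP; exists p => //.
  elim: p x px ixp {unx IH Dj xj xc cxj ix cx} => //= y p IH x /andP[xy py].
  rewrite !inE !negb_or => /and3P[ix iy ip].
  by rewrite /avoid eq_sym ix eq_sym iy xy IH // inE negb_or iy.
have [ica|nica] := boolP (adj i c).
  exists c => //; rewrite inE; apply/orP; right; apply: contra ncxj.
  apply: conn_avoid_trans; rewrite conn_avoid_sym.
  by rewrite conn_avoid1 // eq_sym.
exists x => //; rewrite inE; apply/orP; right.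
apply: contra (bg ix xc ic nica) => ixj; apply: (conn_avoid_trans ixj).
by rewrite conn_avoid_sym; apply: between_conn_l.
Qed.

End Blocks.

(** * The recursive definition of block graphs versus induced paths on three vertices *)

Section BlockGraphs.
Variables (n : nat) (C : eqType) (G : cgraph n C).
Local Notation adj := (adj G).
Local Notation conn_avoid := (conn_avoid G).

Definition adj_in_avoid (A : {set 'I_n}) c : rel 'I_n :=
  fun u v => [&& u \in A, v \in A, u != c, v != c & adj u v].

(** Walks are confined to [A] because the induction runs through induced subgraphs. *)
Lemma block_on_separates (A : {set 'I_n}) : block_on G A ->
  {in A & &, forall i l j, adj i l -> adj l j -> i != j -> ~~ adj i j ->
    ~~ connect (adj_in_avoid A l) i j}.
Proof.
have side (A' B : {set 'I_n}) c : c \notin A' -> c \notin B ->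
  {in A' & B, forall a b, ~~ adj a b} ->
  {in c |: A' & &, forall i l j, adj i l -> adj l j -> i != j -> ~~ adj i j ->
    ~~ connect (adj_in_avoid (c |: A') l) i j} ->
  {in c |: A' & &, forall i l j, adj i l -> adj l j -> i != j -> ~~ adj i j ->
    ~~ connect (adj_in_avoid (c |: (A' :|: B)) l) i j}.
  move=> cA cB nAB IH i l j iA lA jA il lj ij nij.
  apply: contra (IH i l j iA lA jA il lj ij nij) => /connectP[p].
  (* Collapsing the other side [B] to [c] turns walks into walks, up to repeated vertices, because
     no edge joins [A'] to [B]. *)
  pose f v := if v \in A' then v else c.
  have fid v : v \in c |: A' -> f v = v.
    by rewrite /f !inE => /orP[/eqP->|->//]; rewrite (negPf cA).
  move=> pth Dj; rewrite -(fid i iA) -(fid j jA) Dj.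
  elim: p i pth {Dj il ij nij iA} => [|x p IHp] i //= /andP[/and5P[iA xA il' xl ix] px].
  apply: connect_trans (IHp _ px).
  have fA v : v \in c |: (A' :|: B) -> f v \in c |: A'.
    by rewrite /f; case: ifP => vA; rewrite !inE ?eqxx ?vA ?orbT.
  have [->|nf] := eqVneq (f i) (f x); first exact: connect0.
  apply: connect1; rewrite /adj_in_avoid !fA //=.
  have nA : ~~ ((i \in A') && (x \in B)).
    by apply/negP=> /andP[a b]; move: ix; rewrite (negPf (nAB _ _ a b)).
  have nA' : ~~ ((x \in A') && (i \in B)).
    by apply/negP=> /andP[a b]; move: ix; rewrite adj_sym (negPf (nAB _ _ a b)).
  move: iA xA nA nA' nf; rewrite /f !inE.
  have [ia|] := boolP (i \in A'); have [xa|] := boolP (x \in A') => //=; rewrite ?orbF ?andbT.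
  - by rewrite il' xl ix.
  - by move=> _ _ /orP[/eqP <-|->//]; rewrite il' xl ix.
  - by move=> _ /orP[/eqP <-|->//]; rewrite il' xl ix.
  by rewrite eqxx.
elim=> {A} [A _ cA|A B c _ _ _ dAB cA cB nAB _ IHA _ IHB] i l j.
  by move=> iA lA jA _ _ ij; rewrite (cA i j).
have nBA : {in B & A, forall a b, ~~ adj a b}.
  by move=> a b aB bA; rewrite adj_sym nAB.
have sA := side A B c cA cB nAB IHA.
have sB := side B A c cB cA nBA IHB; rewrite (setUC B) in sB.
have sep (A' B' : {set 'I_n}) i' j' : A' :|: B' = A :|: B -> c \notin A' -> c \notin B' ->
  {in A' & B', forall a b, ~~ adj a b} ->
  [disjoint A' & B'] -> i' \in A' -> j' \in B' ->
  ~~ connect (adj_in_avoid (c |: (A :|: B)) c) i' j'.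
  move=> <- cA' cB' nAB' dAB' iA' jB'; apply/negP => /connectP[p].
  elim: p i' iA' => [|x p IHp] i' iA' /= => [_ Dj|].
    by move: dAB' => /pred0P /(_ i') /=; rewrite iA' -Dj jB'.
  case/andP=> /and5P[_ xA ic xc ix] px; apply: IHp => //.
  move: xA; rewrite !inE (negPf xc) /= => /orP[//|xB].
  by move: ix; rewrite (negPf (nAB' _ _ iA' xB)).
have inA v : v \in A -> v \in c |: A by rewrite !inE => ->; rewrite orbT.
have inB v : v \in B -> v \in c |: B by rewrite !inE => ->; rewrite orbT.
have cross (A' B' : {set 'I_n}) i' l' j' : {in A' & B', forall a b, ~~ adj a b} ->
  i' \in A' -> j' \in B' -> adj i' l' -> adj l' j' -> l' \in c |: (A' :|: B') -> l' = c.
  move=> nAB' iA' jB' il lj; rewrite !inE => /or3P[/eqP//|lA|lB].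
    by move: lj; rewrite (negPf (nAB' _ _ lA jB')).
  by move: il; rewrite (negPf (nAB' _ _ iA' lB)).
have inc v : c \in c |: v by rewrite !inE eqxx.
move=> iV lV jV il lj ij nij.
move: (iV) (lV) (jV); rewrite !in_setU1 !in_setU => /or3P[/eqP Di|iA|iB] lV' /or3P[/eqP Dj|jA|jB].
- by rewrite Di Dj eqxx in ij.
- subst i; move: lV' => /or3P[/eqP lc|lA|lB].
  + by rewrite lc adjxx in il.
  + by apply: sA => //; (apply: inA || apply: inc).
  + by move: lj; rewrite adj_sym (negPf (nAB _ _ jA lB)).
- subst i; move: lV' => /or3P[/eqP lc|lA|lB].
  + by rewrite lc adjxx in il.
  + by move: lj; rewrite (negPf (nAB _ _ lA jB)).
  + by apply: sB => //; (apply: inB || apply: inc).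
- subst j; move: lV' => /or3P[/eqP lc|lA|lB].
  + by rewrite lc adjxx in lj.
  + by apply: sA => //; (apply: inA || apply: inc).
  + by move: il; rewrite (negPf (nAB _ _ iA lB)).
- move: lV' => /or3P[/eqP lc|lA|lB]; first by subst l; apply: sA => //; (apply: inA || apply: inc).
    by apply: sA => //; (apply: inA || apply: inc).
  by move: il; rewrite (negPf (nAB _ _ iA lB)).
- by have lc := cross A B i l j nAB iA jB il lj lV; rewrite lc; apply: (sep A B).
- subst j; move: lV' => /or3P[/eqP lc|lA|lB].
  + by rewrite lc adjxx in lj.
  + by move: il; rewrite adj_sym (negPf (nAB _ _ lA iB)).
  + by apply: sB => //; (apply: inB || apply: inc).
- have lc : l = c by apply: (cross B A i l j nBA); rewrite // setUC // [B :|: A]setUC setUC.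
  by rewrite lc; apply: (sep B A) => //; rewrite 1?setUC // disjoint_sym.
move: lV' => /or3P[/eqP lc|lA|lB]; first by subst l; apply: sB => //; (apply: inB || apply: inc).
  by move: il; rewrite adj_sym (negPf (nAB _ _ lA iB)).
by apply: sB => //; (apply: inB || apply: inc).
Qed.

Lemma block_graph_separates : block_graph G -> middle_separates G.
Proof.
move=> bG i l j il lj ij nij.
have := block_on_separates bG (in_setT i) (in_setT l) (in_setT j) il lj ij nij.
by rewrite (@eq_connect _ _ (avoid G l)) // => u v; rewrite /adj_in_avoid !inE.
Qed.

(** A walk inside [A] from [X] to [c] can leave [X] only at [c]. *)
Lemma connected_on_closed (A X : {set 'I_n}) c : connected_on G A -> c \in A ->
  X \subset A -> c \notin X ->
  {in X & A, forall u v, v != c -> adj u v -> v \in X} ->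
  connected_on G (c |: X).
Proof.
move=> [_ cA] cAin XA cX clX; pose e u v := [&& u \in c |: X, v \in c |: X & adj u v].
have eS u v : e u v = e v u by rewrite /e adj_sym andbCA.
have toc v : v \in c |: X -> connect e v c.
  rewrite in_setU1 => /orP[/eqP->|vX]; first exact: connect0.
  have /connectP[p] := cA v c (subsetP XA v vX) cAin.
  elim: p v vX => [|x p IH] v vX /=; first by move=> _ ->; apply: connect0.
  case/andP=> /and3P[vA xA vx] px Dc.
  have [xc|xc] := eqVneq x c.
    by apply: connect1; rewrite /e -xc vx !inE eqxx vX orbT.
  have xX := clX v x vX xA xc vx.
  by apply: connect_trans (IH x xX px Dc); apply: connect1; rewrite /e !inE vX xX !orbT.
split; first by apply/set0Pn; exists c; rewrite !inE eqxx.
move=> u v uX vX; change (connect e u v); apply: connect_trans (toc u uX) _.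
by rewrite (sym_connect_sym eS) toc.
Qed.

Lemma noncomplete_induced_path (A : {set 'I_n}) : connected_on G A ->
  complete_on G A \/
  exists i l j, [/\ [&& i \in A, l \in A & j \in A], adj i l, adj l j, i != j & ~~ adj i j].
Proof.
move=> [_ cA].
have [/existsP[i /existsP[l /existsP[j /and5P[]]]]|] :=
    boolP [exists i, exists l, exists j,
     [&& [&& i \in A, l \in A & j \in A], adj i l, adj l j, i != j & ~~ adj i j]].
  by right; exists i, l, j.
move=> nex; left => i j iA jA ij.
have inS v : v \in A -> (v == i) || adj i v -> connect (fun u v => [&& u \in A, v \in A & adj u v]) v j ->
    (j == i) || adj i j.
  move=> vA vi /connectP[p]; elim: p v vA vi => [|x p IH] v vA vi /=; first by move=> _ ->.
  case/andP=> /and3P[_ xA vx] px Dj; apply: (IH x) => //.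
  case/orP: vi => [/eqP<-|iv]; first by rewrite vx orbT.
  have [//|xi] := eqVneq x i; apply: contraNT nex => /= nix.
  by apply/existsP; exists i; apply/existsP; exists v; apply/existsP; exists x;
    rewrite iA vA xA iv vx eq_sym xi nix.
by have := inS i iA _ (cA i j iA jA); rewrite eqxx eq_sym (negPf ij) => /(_ isT).
Qed.

Lemma separates_block_on (A : {set 'I_n}) : middle_separates G ->
  connected_on G A -> block_on G A.
Proof.
move=> bg; have [m] := ubnP #|A|; elim: m A => // m IH A leA conA.
have [cmp|[i [l [j [/and3P[iA lA jA] il lj ij nij]]]]] := noncomplete_induced_path conA.
  exact: BlockComplete.
(* The cut at the middle vertex [l]: [X] is the component of [i] in [A] without [l], and [Y], the
   rest, contains [j]. *)
pose X := [set v in A | (v != l) && connect (adj_in_avoid A l) i v].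
pose Y := [set v in A | (v != l) && ~~ connect (adj_in_avoid A l) i v].
have DA : A = l |: (X :|: Y).
  apply/setP=> v; rewrite !inE; have [->|_] /= := eqVneq v l; first by rewrite lA.
  by rewrite -andb_orr orbN andbT.
have iX : i \in X by rewrite inE iA (adj_neq il) /= connect0.
have jY : j \in Y.
  rewrite inE jA eq_sym (adj_neq lj) /=; apply: contra (bg i l j il lj ij nij).
  apply: connect_sub => u v /and5P[uA vA ul vl uv]; apply: connect1.
  by rewrite /avoid ul vl.
have lX : l \notin X by rewrite inE eqxx andbF.
have lY : l \notin Y by rewrite inE eqxx andbF.
have clX : {in X & A, forall u v, v != l -> adj u v -> v \in X}.
  move=> u v; rewrite !inE => /and3P[uA ul iu] vA vl uv; rewrite vA vl /=.
  by apply: connect_trans iu _; apply: connect1; rewrite /adj_in_avoid uA vA ul vl.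
have clY : {in Y & A, forall u v, v != l -> adj u v -> v \in Y}.
  move=> u v; rewrite !inE => /and3P[uA ul iu] vA vl uv; rewrite vA vl /=.
  apply: contra iu => iv; apply: connect_trans iv _; apply: connect1.
  by rewrite /adj_in_avoid uA vA ul vl adj_sym.
have dXY : [disjoint X & Y].
  by apply/pred0P=> v /=; rewrite !inE; case: (connect _ _ _); rewrite !andbF.
have XA : X \subset A by apply/subsetP=> v; rewrite inE => /andP[].
have YA : Y \subset A by apply/subsetP=> v; rewrite inE => /andP[].
have lXA : l |: X \proper A.
  apply/properP; split; first by rewrite subUset sub1set lA.
  exists j => //; rewrite !inE jA [j == l]eq_sym (negPf (adj_neq lj)) /=.
  by move: jY; rewrite !inE => /and3P[_ _ /negPf->].
have lYA : l |: Y \proper A.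
  apply/properP; split; first by rewrite subUset sub1set lA.
  by exists i => //; rewrite !inE iA (negPf (adj_neq il)) /= connect0.
rewrite {1}DA; apply: BlockGlue => //.
- by rewrite -DA.
- by apply/set0Pn; exists i.
- by apply/set0Pn; exists j.
- move=> u v uX vY; apply: contraL (vY) => uv.
  have vl : v != l by apply: contraNneq lY => <-.
  have vX := clX u v uX (subsetP YA _ vY) vl uv.
  by have /pred0P/(_ v)/= := dXY; rewrite vX /= => ->.
- apply: IH; first exact: leq_trans (proper_card lXA) leA.
  exact: (@connected_on_closed A).
- apply: IH; first exact: leq_trans (proper_card lYA) leA.
  exact: (@connected_on_closed A).
Qed.

Lemma connected_graphP : connected_graph G -> forall i j, connect adj i j.
Proof.
case=> _ cn i j; have := cn i j (in_setT i) (in_setT j).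
by rewrite (@eq_connect _ _ adj) // => u v; rewrite !inE.
Qed.

Lemma block_graphP : connected_graph G -> block_graph G <-> middle_separates G.
Proof.
move=> cG; split=> [|bg]; first exact: block_graph_separates.
exact: separates_block_on.
Qed.

End BlockGraphs.

(** * Regular colorings *)

Lemma perm_map_pair (T : finType) (K : eqType) (f : T -> K) i j :
  i != j -> perm_eq [seq f k | k in [set i; j]] [:: f i; f j].
Proof.
move=> ij; rewrite -[[:: f i; f j]]/(map f [:: i; j]); apply: perm_map.
apply: uniq_perm; rewrite ?enum_uniq //= ?inE ?ij // => k.
by rewrite mem_enum !inE.
Qed.

Lemma perm_eq2 (K : eqType) (a b c d : K) : perm_eq [:: a; b] [:: c; d] =
  ((a == c) && (b == d)) || ((a == d) && (b == c)).
Proof.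
apply/idP/idP => [|/orP[]/andP[/eqP-> /eqP->]] //; last first.
  by rewrite -[X in perm_eq _ X]/([:: c] ++ [:: d]) perm_sym perm_catC.
move=> h; have := mem_head a [:: b]; rewrite (perm_mem h) !inE.
case/orP=> /eqP ac; subst a.
  by move: h; rewrite perm_cons => /perm_mem/(_ b); rewrite !inE !eqxx => /esym ->.
have {h} : perm_eq [:: d; b] [:: d; c].
  by apply: perm_trans h _; rewrite -[X in perm_eq X]/([:: c] ++ [:: d]) perm_catC.
by rewrite perm_cons => /perm_mem/(_ b); rewrite !inE !eqxx => /esym ->; rewrite orbT.
Qed.

Lemma count_image_set (T : finType) (K : eqType) (Q : {set T}) (q : T -> K) b :
  count_mem b [seq q t | t in Q] = #|[set t in Q | q t == b]|.
Proof.
rewrite count_map cardE -size_filter; apply/perm_size/uniq_perm.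
- by rewrite filter_uniq ?enum_uniq.
- exact: enum_uniq.
by move=> t; rewrite mem_filter !mem_enum !inE andbC.
Qed.

Lemma sum_key (R : nmodType) (T : finType) (K : eqType) (P P' : {set T})
    (k k' : T -> K) (g : K -> R) :
  (forall b, #|[set t in P | k t == b]| = #|[set t in P' | k' t == b]|) ->
  \sum_(t in P) g (k t) = \sum_(t in P') g (k' t).
Proof.
move=> h; have pe : perm_eq [seq k t | t in P] [seq k' t | t in P'].
  by apply/allP => b _ /=; rewrite !count_image_set h.
have E (Q : {set T}) q : \sum_(t in Q) g (q t) = \sum_(x <- [seq q t | t in Q]) g x.
  by rewrite big_map big_enum.
by rewrite !E; apply: perm_big.
Qed.

(** * Regularity in terms of neighbors and common neighbors *)

Section Coloring.
Variables (n : nat) (C : eqType) (G : cgraph n C).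
Local Notation adj := (adj G).
Local Notation vc := (vcol G).

Definition ec i j := ecol G [set i; j].

Lemma ec_sym i j : ec i j = ec j i.
Proof. by rewrite /ec setUC. Qed.

Definition nbrs_col i a : {set 'I_n} := [set l | adj i l & ec i l == a].

Lemma count_incident i a :
  count_mem a [seq ecol G e | e in [set e in edges G | i \in e]] = #|nbrs_col i a|.
Proof.
rewrite count_image_set -(@card_in_imset _ _ (fun l => [set i; l])); last first.
  move=> l m; rewrite !inE => /andP[il _] /andP[im _] /setP/(_ l).
  by rewrite !inE eqxx orbT eq_sym (negPf (adj_neq il)) => /esym/eqP.
apply: eq_card => e; rewrite !inE; apply/idP/imsetP.
  move=> /andP[/andP[eG ie] ea]; have [u [v [De uv]]] := edge_ends eG.
  move: ie ea; rewrite {1}De !inE => /orP[/eqP Di|/eqP Di] ea.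
    by exists v; rewrite ?inE ?Di // uv /ec -De.
  by exists u; rewrite ?inE Di 1?setUC // adj_sym uv ec_sym /ec -De.
by case=> l; rewrite inE => /andP[il a_l] ->; rewrite -/(ec i l) a_l !inE eqxx /= !andbT.
Qed.

Lemma vertex_regularP : vertex_regular G <->
  forall i j a, vc i = vc j -> #|nbrs_col i a| = #|nbrs_col j a|.
Proof.
split=> [vr i j a ij|h i j ij].
  by rewrite -!count_incident; have /permP := vr i j ij; apply.
by apply/allP=> a _ /=; rewrite !count_incident (h i j).
Qed.

Lemma edge_regularP : edge_regular G <->
  forall i j i' j', adj i j -> adj i' j' -> ec i j = ec i' j' ->
   (vc i = vc i' /\ vc j = vc j') \/ (vc i = vc j' /\ vc j = vc i').
Proof.
have E i j i' j' : adj i j -> adj i' j' ->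
  perm_eq [seq vc k | k in [set i; j]] [seq vc k | k in [set i'; j']] =
  perm_eq [:: vc i; vc j] [:: vc i'; vc j'].
  move=> ij ij'; rewrite (permPl (perm_map_pair _ (adj_neq ij))).
  by rewrite (permPr (perm_map_pair _ (adj_neq ij'))).
split=> [er i j i' j' ij ij' Dc|h e e'].
  have := er _ _ ij ij' Dc; rewrite E // perm_eq2.
  by case/orP => /andP[/eqP-> /eqP->]; [left|right].
move=> /edge_ends[i [j [-> ij]]] /edge_ends[i' [j' [-> ij']]] Dc.
rewrite E // perm_eq2.
by have [[-> ->]|[-> ->]] := h _ _ _ _ ij ij' Dc; rewrite !eqxx ?orbT.
Qed.

Definition common i j : {set 'I_n} := [set l | adj i l && adj j l].

Lemma triangle_ofP i j T : adj i j ->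
  reflect (exists2 l, l \in common i j & T = l |: [set i; j])
          (T \in triangles_of G [set i; j]).
Proof.
move=> ij; apply: (iffP idP) => [|[l]].
  rewrite inE => /andP[/andP[T3 /forall_inP Tadj] sT].
  have iT : i \in T by apply: (subsetP sT); rewrite !inE eqxx.
  have jT : j \in T by apply: (subsetP sT); rewrite !inE eqxx orbT.
  have : #|T :\: [set i; j]| == 1%N.
    by rewrite cardsD (setIidPr sT) cards2 (adj_neq ij) (eqP T3).
  case/cards1P => l Dl; exists l; last by rewrite setUC -{1}(setID T [set i; j]) (setIidPr sT) Dl.
  have : l \in T :\: [set i; j] by rewrite Dl inE.
  rewrite !inE negb_or => /andP[/andP[li lj] lT].
  have /implyP-> := forall_inP (Tadj i iT) l lT; last by rewrite eq_sym.
  by have /implyP-> := forall_inP (Tadj j jT) l lT; last by rewrite eq_sym.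
rewrite inE => /andP[il jl] ->; rewrite inE subsetUr andbT; apply/andP; split.
  by rewrite cardsU1 cards2 (adj_neq ij) !inE negb_or ![l == _]eq_sym (adj_neq il) (adj_neq jl).
apply/forall_inP=> u; rewrite !inE => uT; apply/forall_inP => v; rewrite !inE => vT.
by apply/implyP; move: uT vT => /or3P[]/eqP-> /or3P[]/eqP->; rewrite ?eqxx // => _;
  rewrite // adj_sym.
Qed.

Lemma common_inj i j l m : l \in common i j -> 
  l |: [set i; j] = m |: [set i; j] -> l = m.
Proof.
rewrite inE => /andP[il jl] /setP/(_ l).
by rewrite !inE eqxx /= ![l == _]eq_sym (negPf (adj_neq il)) (negPf (adj_neq jl)) !orbF => /esym/eqP.
Qed.

(** The isomorphism may move the edge [{i, j}] to another side of the triangle. The two given edges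
    share their color and, by edge-regularity, the colors of their ends; cancelling these from the
    multisets of colors of the two triangles matches what remains, up to exchanging the ends. *)
Lemma color_iso_marked i j l i' j' l' : edge_regular G ->
  adj i j -> adj i' j' -> ec i j = ec i' j' ->
  l \in common i j -> l' \in common i' j' ->
  color_iso G (l |: [set i; j]) (l' |: [set i'; j']) ->
  vc l' = vc l /\
  ((ec i l = ec i' l' /\ ec j l = ec j' l') \/ (ec i l = ec j' l' /\ ec j l = ec i' l')).
Proof.
move=> /edge_regularP er ij ij' Dc lc lc' [f [fi fT fv fe]].
have evc := er _ _ _ _ ij ij' Dc.
move: lc; rewrite inE => /andP[il jl].
have nij := adj_neq ij; have nil := adj_neq il; have njl := adj_neq jl.
have li : l \in l |: [set i; j] by rewrite !inE eqxx.
have ii : i \in l |: [set i; j] by rewrite !inE eqxx orbT.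
have ji : j \in l |: [set i; j] by rewrite !inE eqxx !orbT.
have fin u : u \in l |: [set i; j] -> [|| f u == l', f u == i' | f u == j'].
  by move=> uT; have := imset_f f uT; rewrite fT !inE.
have vl := fv l li; have vi := fv i ii; have vj := fv j ji.
have eij := fe i j ii ji nij; have eil := fe i l ii li nil; have ejl := fe j l ji li njl.
rewrite -!/(ec _ _) in eij eil ejl.
have nfij : f i != f j by apply: contra nij => /eqP/(fi _ _ ii ji)/eqP.
have nfil : f i != f l by apply: contra nil => /eqP/(fi _ _ ii li)/eqP.
have nfjl : f j != f l by apply: contra njl => /eqP/(fi _ _ ji li)/eqP.
case/or3P: (fin l li) => /eqP fl; case/or3P: (fin i ii) => /eqP fi';
case/or3P: (fin j ji) => /eqP fj;
move: nfij nfil nfjl vl vi vj eij eil ejl;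
rewrite fl fi' fj ?eqxx // => _ _ _ vl vi vj eij eil ejl;
have s1 := ec_sym l' i'; have s2 := ec_sym l' j'; have s3 := ec_sym j' i';
(split; [by case: evc => [[]|[]]; congruence |
 first [by left; split; congruence | by right; split; congruence]]).
Qed.

Lemma triangle_matching i j i' j' : edge_regular G -> edge_triangle_regular G ->
  adj i j -> adj i' j' -> ec i j = ec i' j' ->
  exists f : 'I_n -> 'I_n,
  [/\ {in common i j &, injective f}, f @: common i j = common i' j' &
   {in common i j, forall l, vc (f l) = vc l /\
    ((ec i l = ec i' (f l) /\ ec j l = ec j' (f l)) \/
     (ec i l = ec j' (f l) /\ ec j l = ec i' (f l)))}].
Proof.
move=> er tr ij ij' Dc; have [F [Finj FT Fiso]] := tr _ _ ij ij' Dc.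
pose f l := odflt l [pick m in common i' j' | F (l |: [set i; j]) == m |: [set i'; j']].
have TT l : l \in common i j -> l |: [set i; j] \in triangles_of G [set i; j].
  by move=> lc; apply/triangle_ofP => //; exists l.
have fP l : l \in common i j -> f l \in common i' j' /\ F (l |: [set i; j]) = f l |: [set i'; j'].
  move=> lc; rewrite /f; case: pickP => [m /andP[mc /eqP ->] //|nex].
  have : F (l |: [set i; j]) \in triangles_of G [set i'; j'] by rewrite -FT imset_f ?TT.
  by case/(triangle_ofP _ ij') => m mc Dm; move: (nex m); rewrite /= mc Dm eqxx.
exists f; split.
- move=> l m lc mc fE; apply: (@common_inj i j) => //; apply: Finj; rewrite ?TT //.
  by rewrite (fP l lc).2 (fP m mc).2 fE.
- apply/setP=> m; apply/imsetP/idP => [[l lc ->]|mc]; first exact: (fP l lc).1.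
  have : m |: [set i'; j'] \in F @: triangles_of G [set i; j].
    by rewrite FT; apply/triangle_ofP => //; exists m.
  case/imsetP=> T /(triangle_ofP _ ij)[l lc ->] Dm; exists l => //.
  by apply: (@common_inj i' j') => //; rewrite Dm (fP l lc).2.
move=> l lc; have [fc Fl] := fP l lc.
by apply: color_iso_marked => //; rewrite -Fl; apply: Fiso; apply: TT.
Qed.

End Coloring.

(** * Degrees inside a block depend only on colors *)

Section BlockDegrees.
Variables (n : nat) (C : eqType) (G : cgraph n C).
Local Notation adj := (adj G).
Local Notation vc := (vcol G).
Local Notation ec := (ec G).
Local Notation block := (block G).
Local Notation common := (common G).
Local Notation conn_avoid := (conn_avoid G).

Lemma common_sym i j : common i j = common j i.
Proof. by apply/setP=> l; rewrite !inE andbC. Qed.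

Lemma block_common i j l : adj i j -> adj i l ->
  (l \in block i j) = (l == j) || (l \in common i j).
Proof.
move=> ij il; rewrite !inE (adj_sym _ l i) il orbT /= adj_sym.
by rewrite (adj_sym _ j).
Qed.

(** A walk from [a] avoiding [x] stays in a component that does not contain [w]. *)
Lemma conn_avoid_switch x w a t :
  conn_avoid x a t -> ~~ conn_avoid x w a -> conn_avoid w a t.
Proof.
case/connectP=> p; elim: p a => [|b p IH] a /=.
  by move=> _ -> _; rewrite conn_avoid_refl.
case/andP=> ab pb Dt nwa.
have nwb : ~~ conn_avoid x w b.
  apply: contra nwa => h; apply: connect_trans h _.
  by apply: connect1; rewrite avoid_sym.
apply: connect_trans (IH b pb Dt nwb); apply: connect1.
have neq v : ~~ conn_avoid x w v -> v != w.
  by apply: contraNneq => ->; rewrite conn_avoid_refl.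
by rewrite /avoid !neq //; case/and3P: ab.
Qed.

Definition block_degree i j b : nat := #|[set l in block i j | adj i l & ec i l == b]|.

Lemma block_degreeE i j b : adj i j ->
  block_degree i j b = ((ec i j == b) + \sum_(l in common i j) (ec i l == b))%N.
Proof.
move=> ij; rewrite /block_degree -sum1_card.
rewrite (eq_bigl (fun l => ((l == j) || (l \in common i j)) && (ec i l == b))); last first.
  move=> l; rewrite inE; have [il|nil] := boolP (adj i l); first by rewrite block_common.
  rewrite !inE (negPf nil) andbF orbF /=.
  by have [lj|] := eqVneq l j; first by rewrite lj ij in nil.
rewrite big_mkcondr (bigD1 j) ?eqxx //=; congr (_ + _)%N.
apply: eq_big => l; last by case: (_ == b).
have [->|_] := eqVneq l j; last by rewrite andbT.
by rewrite andbF inE adjxx andbF.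
Qed.

Lemma block_degree_full i j b : adj i j ->
  (forall l, adj i l -> ec i l = b -> l \in block i j) ->
  block_degree i j b = #|nbrs_col G i b|.
Proof.
move=> ij h; apply: eq_card => l; rewrite !inE.
have [/andP[il /eqP Db]|] := boolP (adj i l && _); last by rewrite andbF.
by have := h l il Db; rewrite inE => ->.
Qed.

Hypotheses (bg : middle_separates G) (vr : vertex_regular G).
Hypotheses (er : edge_regular G) (tr : edge_triangle_regular G).

(** Symmetry of [psi] absorbs the possible exchange of the two ends by the matching of triangles. *)
Lemma triangle_sum (V : nmodType) (psi : C -> C -> V) i j i' j' :
  (forall b d, psi b d = psi d b) ->
  adj i j -> adj i' j' -> ec i j = ec i' j' ->
  \sum_(l in common i j) psi (ec i l) (ec j l) =
  \sum_(l in common i' j') psi (ec i' l) (ec j' l).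
Proof.
move=> psiC ij ij' Dc; have [f [finj fE fcol]] := triangle_matching er tr ij ij' Dc.
rewrite -fE big_imset //=; apply: eq_bigr => l lc.
by have [_ [[-> ->]|[-> ->]]] := fcol l lc.
Qed.

Lemma block_degree_sum i j i' j' b : adj i j -> adj i' j' -> ec i j = ec i' j' ->
  (block_degree i j b + block_degree j i b =
   block_degree i' j' b + block_degree j' i' b)%N.
Proof.
move=> ij ij' Dc; rewrite !block_degreeE // 1?adj_sym //.
rewrite (common_sym j) (common_sym j') (ec_sym _ j i) (ec_sym _ j' i') Dc.
rewrite addnACA [RHS]addnACA -!big_split /=; congr (_ + _)%N.
apply: (@triangle_sum _ (fun c d => (c == b) + (d == b))%N) => //.
by move=> c d; rewrite addnC.
Qed.

(* Among the edges w u of color a such that w has another such edge outside the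
   block of w u, take one minimizing the branch of u at w.  By minimality the
   other vertices of that block have all their a-edges inside it, and then the
   constancy of block-degree sums leaves no a-edge of w outside. *)
Lemma monochrome_edges_same_block a p :
  (forall x y, adj x y -> ec x y = a -> vc x = p /\ vc y = p) ->
  forall w u z, adj w u -> adj w z -> ec w u = a -> ec w z = a ->
  (u == z) || adj u z.
Proof.
move=> Ha w u z; have [m] := ubnP #|[set t | conn_avoid w u t]|.
elim: m w u z => // m IH w u z ltm wu wz wua wza.
apply: contraT => nuz.
have wB := mem_block_l wu; have uB := mem_block_r wu.
have inside x x2 z' : x \in block w u -> x != w -> x2 \in block w u ->
    adj x x2 -> ec x x2 = a -> adj x z' -> ec x z' = a -> z' \in block w u.
  move=> xB xw x2B xx2 xx2a xz' xz'a; apply: contraT => z'B.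
  have xBe : block x x2 = block w u by exact: (block_eq bg wu xB x2B (adj_neq xx2)).
  have : (z' == x2) || adj z' x2.
    have wx : adj w x by apply: (block_adj bg wu); rewrite // eq_sym.
    have wz' : w != z' by apply: contraNneq z'B => <-.
    have nwz' : ~~ adj w z'.
      apply: contra z'B => h; rewrite -(block_eq bg wu wB xB) // 1?eq_sym //.
      by rewrite inE ![adj z' _]adj_sym h xz' !orbT.
    (* The branch of [z'] at [x] lies inside the branch of [u] at [w] and misses [x], so the
       induction hypothesis applies at [x]. *)
    apply: (IH x) => //; apply: leq_trans _ (ltnSE ltm).
    apply/proper_card/properP; split.
      apply/subsetP=> t; rewrite !inE => zt.
      have ux : conn_avoid w u x.
        have [->|ux] := eqVneq u x; first by rewrite conn_avoid_refl.
        by apply: conn_avoid1 => //; [rewrite eq_sym (adj_neq wu) | apply: (block_adj bg wu)].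
      apply: conn_avoid_trans ux _; apply: (@conn_avoid_trans _ _ _ _ z').
        by rewrite conn_avoid1 // eq_sym.
      exact: conn_avoid_switch zt (bg wx xz' wz' nwz').
    exists x; rewrite inE.
      have [->|ux] := eqVneq u x; first by rewrite conn_avoid_refl.
      by apply: conn_avoid1 => //; [rewrite eq_sym (adj_neq wu) | apply: (block_adj bg wu)].
    by apply/negP; rewrite conn_avoid_sym => /conn_avoid_self Dz; rewrite Dz adjxx in xz'.
  case/orP=> [/eqP Dz|z'x2]; first by rewrite Dz x2B in z'B.
  by rewrite -xBe inE ![adj z' _]adj_sym xz' (adj_sym _ x2) z'x2 !orbT in z'B.
have uw : adj u w by rewrite adj_sym.
have uwa : ec u w = a by rewrite ec_sym.
have unw := adj_neq uw.
have full_u : block_degree u w a = #|nbrs_col G u a|.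
  by apply: block_degree_full => // l ul ula; rewrite block_sym (inside u w).
have vwu : vc w = vc u by have [-> ->] := Ha w u wu wua.
have degE x y : vc x = vc y -> #|nbrs_col G x a| = #|nbrs_col G y a|.
  by move/vertex_regularP: vr => h; apply: h.
(* If [u] has no second [a]-edge in the block, its [a]-degree is one, hence so is that of [w], which
   contradicts the edges from [w] to [u] and [z]. *)
have [/existsP[x /and4P[xw ux uxa xB]]|] :=
  boolP [exists x, [&& x != w, adj u x, ec u x == a & x \in block w u]]; last first.
  rewrite negb_exists => /forallP nex.
  have : #|nbrs_col G u a| = 1%N.
    apply/eqP/cards1P; exists w; apply/setP=> l; rewrite !inE.
    apply/andP/eqP => [[ul /eqP ula]|->]; last by rewrite uw uwa.
    apply/eqP; apply: contraT => lw; move: (nex l).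
    by rewrite lw ul ula eqxx (inside u w).
  rewrite -(degE w u) // => /eqP/cards1P[y Dy].
  have : u \in nbrs_col G w a by rewrite inE wu wua eqxx.
  have : z \in nbrs_col G w a by rewrite inE wz wza eqxx.
  by rewrite Dy !inE => /eqP Dz /eqP Du; rewrite Dz Du eqxx in nuz.
have vux : vc u = vc x by have [-> ->] := Ha u x ux (eqP uxa).
have uxB : block u x = block w u by exact: (block_eq bg wu uB xB (adj_neq ux)).
have full_u' : block_degree u x a = #|nbrs_col G u a|.
  by apply: block_degree_full => // l ul ula; rewrite uxB (inside u w).
have full_x : block_degree x u a = #|nbrs_col G x a|.
  apply: block_degree_full => [|l xl xla]; first by rewrite adj_sym.
  by rewrite block_sym uxB (inside x u) // 1?adj_sym // ec_sym (eqP uxa).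
(* Three of the four block degrees are full [a]-degrees, all equal since the vertices have the same
   color; so the fourth, at [w], is full as well. *)
have := @block_degree_sum w u u x a wu ux (etrans wua (esym (eqP uxa))).
rewrite full_u full_u' full_x (degE x u) // => /addIn full_w.
have /eqP/setP/(_ z) : [set l in block w u | adj w l & ec w l == a] == nbrs_col G w a.
  rewrite eqEcard [#|[set l in block w u | _]|]full_w (degE w u) // leqnn andbT.
  by apply/subsetP=> l; rewrite !inE => /andP[].
rewrite !inE wz wza eqxx !andbT => /andP[_].
by rewrite eq_sym adj_sym (negPf nuz).
Qed.

Lemma edge_type a p i j : adj i j -> ec i j = a -> vc i = p -> vc j = p ->
  forall x y, adj x y -> ec x y = a -> vc x = p /\ vc y = p.
Proof.
move/edge_regularP: er => h ij ija ip jp x y xy xya.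
by have := h x y i j xy ij (etrans xya (esym ija)); rewrite ip jp => -[].
Qed.

(** Transport the triangle [{i, j, l}] to the edge [i' m]. If the ends are kept, the two edges of
    the color of [i j] at [i'] share a block. If they are exchanged, edge-regularity gives all three
    vertices the color [p], so [monochrome_edges_same_block] holds for all three edge colors, and a
    second transport, to [i' j'], links [m] to [j']. *)
Lemma block_degree_monochrome i j l p : adj i j -> vc i = p -> vc j = p ->
  l \in common i j -> forall i' j' m, adj i' j' -> ec i' j' = ec i j ->
  adj i' m -> ec i' m = ec i l -> m \in block i' j'.
Proof.
move=> ij ip jp lc i' j' m ij' ij'c im imc.
have [il jl] : adj i l /\ adj j l by move: lc; rewrite inE => /andP.
have Ha := edge_type ij erefl ip jp.
have [i'p j'p] := Ha _ _ ij' ij'c.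
have jc : j \in common i l by rewrite inE ij adj_sym.
rewrite block_nbr //.
have [f [_ fE fcol]] := triangle_matching er tr il im (esym imc).
have xc : f j \in common i' m by rewrite -fE imset_f.
have [i'x mx] : adj i' (f j) /\ adj m (f j) by move: xc; rewrite inE => /andP.
have [xp [[ex _]|[ex ex']]] := fcol j jc.
  have xj := monochrome_edges_same_block Ha i'x ij' (esym ex) ij'c.
  by apply: (nbr_trans bg im i'x ij') => //; rewrite mx orbT.
have [mp _] := Ha _ _ mx (esym ex).
have [_ lp] := edge_type im imc i'p mp il erefl.
have Hb := edge_type il erefl ip lp.
have Hb' := edge_type jl erefl jp lp.
have [g [_ gE gcol]] := triangle_matching er tr ij ij' (esym ij'c).
have yc : g l \in common i' j' by rewrite -gE imset_f.
have [i'y jy] : adj i' (g l) /\ adj j' (g l) by move: yc; rewrite inE => /andP.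
have yj : (g l == j') || adj (g l) j' by rewrite (adj_sym _ (g l)) jy orbT.
have [_ [[ey _]|[_ ey]]] := gcol l lc.
  have my := monochrome_edges_same_block Hb im i'y imc (esym ey).
  exact: (nbr_trans bg im i'y ij').
rewrite ec_sym in ex'.
have xy := monochrome_edges_same_block Hb' i'x i'y (esym ex') (esym ey).
have my : (m == g l) || adj m (g l).
  by apply: (nbr_trans bg im i'x i'y) => //; rewrite mx orbT.
exact: (nbr_trans bg im i'y ij').
Qed.

(** If the ends of the edge differ in color, edge-regularity rules out matchings that exchange them.
    If they agree, one nonzero block degree for [b] forces, at every edge of this color, all
    [b]-edges of an end into the block; so block degrees are either zero or the full [b]-degree,
    which depends on the color of the vertex. *)
Lemma block_degree_col i j i' j' b : adj i j -> adj i' j' -> ec i j = ec i' j' ->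
  vc i = vc i' -> block_degree i j b = block_degree i' j' b.
Proof.
move=> ij ij' Dc ii'; have /edge_regularP erP := er.
have jj' : vc j = vc j' by case: (erP _ _ _ _ ij ij' Dc) => -[]; congruence.
have [ijc|nij] := eqVneq (vc i) (vc j); last first.
  rewrite !block_degreeE // Dc; congr (_ + _)%N.
  have [f [finj fE fcol]] := triangle_matching er tr ij ij' Dc.
  rewrite -fE big_imset //=; apply: eq_bigr => l lc.
  have [vl [[-> _] //|[sw _]]] := fcol l lc; case/negP: nij; apply/eqP.
  have il : adj i l by move: lc; rewrite inE => /andP[].
  have jl : adj j' (f l) by move: (imset_f f lc); rewrite fE inE => /andP[].
  by case: (erP _ _ _ _ il jl sw) => -[]; congruence.
have full x y x' y' : adj x y -> ec x y = ec i j -> vc x = vc i -> vc y = vc i ->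
    (0 < block_degree x y b)%N -> adj x' y' -> ec x' y' = ec i j ->
    block_degree x' y' b = #|nbrs_col G x' b|.
  move=> xy xya xp yp /card_gt0P[l]; rewrite inE => /and3P[lB xl /eqP lb] xy' xya'.
  apply: block_degree_full => // m xm mb.
  move: lB; rewrite (block_common xy xl) => /orP[/eqP Dl|lc].
    rewrite block_nbr //; subst l.
    have Ha := edge_type xy xya xp yp.
    by apply: monochrome_edges_same_block Ha _ _ _ xm xy' _ xya'; rewrite mb -lb.
  by apply: (block_degree_monochrome xy xp yp lc); rewrite // ?xya ?lb.
have degE : #|nbrs_col G i b| = #|nbrs_col G i' b|.
  by move/vertex_regularP: vr => h; apply: h.
have [d0|d0] := posnP (block_degree i j b); last first.
  by rewrite (full i j i j) // (full i j i' j').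
have [d0'|d0'] := posnP (block_degree i' j' b); first by rewrite d0 d0'.
by rewrite (full i' j' i j) // -?(full i' j' i' j') -?degE -?ii' -?jj' // (full i' j' i' j') -?ii' -?jj'.
Qed.

End BlockDegrees.

(** * Path matrices and their inverses *)

Lemma factor_through (V : nmodType) (T : finType) (K : eqType) (P : pred T)
    (f : T -> V) (k : T -> K) :
  (forall t t', P t -> P t' -> k t = k t' -> f t = f t') ->
  exists phi : K -> V, forall t, P t -> f t = phi (k t).
Proof.
move=> h; exists (fun x => if [pick t | P t && (k t == x)] is Some t then f t else 0).
move=> t Pt; case: pickP => [t' /andP[Pt' /eqP kt']|/(_ t)]; first exact: h.
by rewrite Pt eqxx.
Qed.

(** One polynomial for all members makes inversion in all blocks a single operation on colored
    families. By Cayley-Hamilton the product of the characteristic polynomials of the invertible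
    members annihilates each of them, and its constant term is nonzero. *)
Lemma common_inverse_poly (F : fieldType) (I : finType) (n : nat)
    (Y : I -> 'M[F]_n.+1) :
  exists q : {poly F}, forall k, Y k \in unitmx -> invmx (Y k) = horner_mx (Y k) q.
Proof.
pose chi := \prod_(k | Y k \in unitmx) char_poly (Y k).
have chi0 : chi`_0 != 0.
  rewrite -horner_coef0 horner_prod; apply/prodf_neq0 => k Yk.
  rewrite horner_coef0 char_poly_det mulf_neq0 ?signr_eq0 //.
  by move: Yk; rewrite unitmxE unitfE.
pose r := \poly_(i < size chi) chi`_i.+1.
have Dchi : chi = r * 'X + (chi`_0)%:P.
  apply/polyP=> -[|i]; rewrite coefD coefMX coefC /= ?add0r // addr0 coef_poly.
  by case: ltnP => // h; rewrite nth_default // ltnW.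
exists (- (chi`_0)^-1 *: r) => k Yk.
have : horner_mx (Y k) chi = 0.
  by rewrite /chi (bigD1 k) //= rmorphM /= Cayley_Hamilton mul0r.
rewrite {1}Dchi rmorphD rmorphM /= horner_mx_X horner_mx_C => /eqP.
rewrite addr_eq0 => /eqP h; apply: (can_inj (mulmxK Yk)).
rewrite mulVmx // linearZ /= -scalemxAl [_ *m Y k]h scalerN scaleNr opprK.
by rewrite scale_scalar_mx mulVf.
Qed.

(** * The Jordan algebra of colored families of block matrices *)

Section BlockInverse.
Variables (R : realFieldType) (n : nat) (C : eqType) (G : cgraph n.+1 C).
Local Notation adj := (adj G).
Local Notation vc := (vcol G).
Local Notation ec := (ec G).
Local Notation block := (block G).
Local Notation common := (common G).

Hypotheses (bg : middle_separates G) (vr : vertex_regular G).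
Hypotheses (er : edge_regular G) (tr : edge_triangle_regular G).

(* Each edge lies in a unique block, so the entry at an edge is a function of
   its color, whereas a diagonal entry may depend on the block through the
   vertex, identified by the color of any of its edges at the vertex. *)
Record colored (M : {set 'I_n.+1} -> 'M[R]_n.+1) : Prop := Colored {
  col_sym : forall B, (M B)^T = M B;
  col_out : forall (B : {set 'I_n.+1}) u v, u \in B -> v \notin B -> M B u v = 0;
  col_off : exists phi, forall i j, adj i j -> M (block i j) i j = phi (ec i j);
  col_diag : exists delta, forall i j, adj i j ->
    M (block i j) i i = delta (vc i, ec i j) }.

Lemma colored_scalar c : colored (fun=> c%:M).
Proof.
split=> [B|B u v uB vB||]; first by rewrite tr_scalar_mx.
- by rewrite mxE; case: eqVneq uB vB => // ->  ->.
- by exists (fun=> 0) => i j ij; rewrite mxE (negPf (adj_neq ij)).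
by exists (fun=> c) => i j ij; rewrite mxE eqxx.
Qed.

Lemma colored_add M M' : colored M -> colored M' -> colored (fun B => M B + M' B).
Proof.
move=> [s o [p hp] [d hd]] [s' o' [p' hp'] [d' hd']]; split=> [B|B u v uB vB||].
- by rewrite linearD /= s s'.
- by rewrite mxE o // o' // addr0.
- by exists (fun c => p c + p' c) => i j ij; rewrite mxE hp ?hp'.
by exists (fun c => d c + d' c) => i j ij; rewrite mxE hd ?hd'.
Qed.

Lemma sum_block (F : 'I_n.+1 -> R) i j : adj i j ->
  (forall l, l \notin block i j -> F l = 0) ->
  \sum_l F l = F i + F j + \sum_(l in common i j) F l.
Proof.
move=> ij F0; rewrite (bigD1 i) //= (bigD1 j) /=; last by rewrite eq_sym (adj_neq ij).
rewrite addrA; congr (_ + _); rewrite [RHS]big_mkcond [LHS]big_mkcond /=.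
apply: eq_bigr => l _; case: ifP => [/andP[li lj]|/negbT].
  case: ifP => // /negbT; rewrite inE => lc; apply: F0.
  by rewrite inE (negPf li) (negPf lj) /= !(adj_sym _ l).
by rewrite negb_and !negbK inE => /orP[]/eqP->; rewrite adjxx ?andbF.
Qed.

(* The product of commuting symmetric matrices is half their anticommutator,
   whose entry at an edge is symmetric in the two ends; individual products
   along the two sides of a triangle need not be color-invariant. *)
Lemma colored_mul M M' : colored M -> colored M' ->
  (forall B, M B *m M' B = M' B *m M B) -> colored (fun B => M B *m M' B).
Proof.
move=> [s o [p hp] [d hd]] [s' o' [p' hp'] [d' hd']] cMM.
have outr (B : {set 'I_n.+1}) u v : u \notin B -> v \in B -> M B u v = 0.
  by move=> uB vB; rewrite -s mxE o.
have outr' (B : {set 'I_n.+1}) u v : u \notin B -> v \in B -> M' B u v = 0.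
  by move=> uB vB; rewrite -s' mxE o'.
have hpb i j l : adj i j -> adj i l -> l \in block i j -> M (block i j) i l = p (ec i l).
  move=> ij il lB; rewrite -hp //; congr (M _ _ _).
  by rewrite -(block_eq bg ij (mem_block_l ij) lB (adj_neq il)).
have hpb' i j l : adj i j -> adj i l -> l \in block i j -> M' (block i j) i l = p' (ec i l).
  move=> ij il lB; rewrite -hp' //; congr (M' _ _ _).
  by rewrite -(block_eq bg ij (mem_block_l ij) lB (adj_neq il)).
split=> [B|B u v uB vB||].
- by rewrite trmx_mul s s' cMM.
- rewrite mxE big1 // => l _; have [lB|lB] := boolP (l \in B).
    by rewrite o' // mulr0.
  by rewrite o // mul0r.
- suff [phi h] : exists phi, forall t : 'I_n.+1 * 'I_n.+1, adj t.1 t.2 ->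
      (M (block t.1 t.2) *m M' (block t.1 t.2)) t.1 t.2 = phi (ec t.1 t.2).
    by exists phi => i j ij; apply: (h (i, j)).
  apply: factor_through => -[i j] [i' j'] /= ij ij' Dc.
  pose psi b c := p b * p' c + p c * p' b.
  have two x y : adj x y -> (M (block x y) *m M' (block x y)) x y *+ 2 =
     (d (vc x, ec x y) + d (vc y, ec x y)) * p' (ec x y) +
     (d' (vc x, ec x y) + d' (vc y, ec x y)) * p (ec x y) +
     \sum_(l in common x y) psi (ec x l) (ec y l).
    move=> xy; have yx : adj y x by rewrite adj_sym.
    rewrite mulr2n {2}cMM !mxE -big_split /= (sum_block xy) => [|l lB]; last first.
      by rewrite (o _ _ _ (mem_block_l xy) lB) (o' _ _ _ (mem_block_l xy) lB) !mul0r addr0.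
    have dy : M (block x y) y y = d (vc y, ec x y) by rewrite block_sym hd // ec_sym.
    have dy' : M' (block x y) y y = d' (vc y, ec x y) by rewrite block_sym hd' // ec_sym.
    rewrite dy dy' (hd x y xy) (hd' x y xy) (hp x y xy) (hp' x y xy).
    congr (_ + _); first by ring.
    apply: eq_bigr => l lc; have [xl yl] : adj x l /\ adj y l by move: lc; rewrite inE => /andP.
    have lB : l \in block x y by rewrite block_common ?lc ?orbT.
    have lB' : l \in block y x by rewrite block_sym.
    have ly : M (block x y) l y = p (ec y l) by rewrite -(s (block x y)) mxE block_sym hpb.
    have ly' : M' (block x y) l y = p' (ec y l) by rewrite -(s' (block x y)) mxE block_sym hpb'.
    by rewrite ly ly' hpb // hpb' // /psi; ring.
  have /edge_regularP erP := er.
  apply: (@mulIf _ 2%:R); rewrite ?pnatr_eq0 // !mulr_natr !two //.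
  rewrite -Dc (triangle_sum er tr _ ij ij' Dc); last by move=> b c; rewrite /psi addrC.
  by case: (erP _ _ _ _ ij ij' Dc) => -[-> ->] //; rewrite [d _ + _]addrC [d' _ + _]addrC.
suff [phi h] : exists phi, forall t : 'I_n.+1 * 'I_n.+1, adj t.1 t.2 ->
    (M (block t.1 t.2) *m M' (block t.1 t.2)) t.1 t.1 = phi (vc t.1, ec t.1 t.2).
  by exists phi => i j ij; apply: (h (i, j)).
apply: factor_through => -[i j] [i' j'] /= ij ij' [vE Dc].
have E x y : adj x y -> (M (block x y) *m M' (block x y)) x x =
   d (vc x, ec x y) * d' (vc x, ec x y) +
   \sum_(l in [set l in block x y | adj x l]) p (ec x l) * p' (ec x l).
  move=> xy; rewrite mxE (bigD1 x) //= hd // hd' //; congr (_ + _).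
  rewrite [LHS]big_mkcond [RHS]big_mkcond /=; apply: eq_bigr => l _; rewrite inE.
  have [lB|lB] := boolP (l \in block x y); last by rewrite (o _ _ _ (mem_block_l xy) lB) mul0r; case: ifP.
  have [->|lx] := eqVneq l x; first by rewrite adjxx.
  have xl : adj x l by apply: (block_adj bg xy); rewrite ?mem_block_l // eq_sym.
  by rewrite xl /= hpb // -(s' (block x y)) mxE hpb'.
rewrite !E // vE Dc; congr (_ + _).
(* A diagonal entry sees only one end of the edge, so block degrees are needed at each end
   separately. *)
apply: (@sum_key _ _ _ _ _ (ec i) (ec i') (fun c => p c * p' c)) => b.
have := @block_degree_col _ _ G bg vr er tr i j i' j' b ij ij' Dc vE; rewrite /block_degree => h.
by rewrite -[LHS](eq_card (A := [set l in block i j | adj i l & ec i l == b])) ?h;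
  [apply: eq_card|] => l; rewrite !inE andbA.
Qed.

Lemma colored_ext M M' : M =1 M' -> colored M -> colored M'.
Proof.
move=> E [s o [p hp] [d hd]]; split=> [B|B u v uB vB||]; rewrite -?E ?s //.
- by rewrite o.
- by exists p => i j ij; rewrite -E hp.
by exists d => i j ij; rewrite -E hd.
Qed.

Lemma colored_horner Y q : colored Y -> colored (fun B => horner_mx (Y B) q).
Proof.
move=> cY; elim/poly_ind: q => [|q c IH].
  by apply: colored_ext (colored_scalar 0) => B; rewrite rmorph0 raddf0.
have cm : forall B, horner_mx (Y B) q *m Y B = Y B *m horner_mx (Y B) q.
  by move=> B; apply/esym/comm_mx_horner.
apply: colored_ext (colored_add (colored_mul IH cY cm) (colored_scalar c)) => B.
by rewrite rmorphD rmorphM /= horner_mx_X horner_mx_C.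
Qed.

End BlockInverse.

(** * Monomial matrices along induced paths *)

Section PathMatrix.
Variables (R : comPzRingType) (n : nat) (C : eqType) (G : cgraph n C) (z : C -> R).
Local Notation adj := (adj G).
Local Notation vc := (vcol G).
Local Notation ec := (ec G).
Local Notation between := (between G).

(* The vertices of the induced path from i to j in a block graph are those of
   [between i j].  The variables z encode a covariance matrix by its diagonal
   z (vc i) and its normalized edge entries z (ec i j) = s_ij / (s_ii s_jj). *)
Definition path_mx : 'M[R]_n := \matrix_(i, j)
  ((\prod_(v in between i j) z (vc v)) *
   (\prod_(e in edges G | e \subset between i j) z (ecol G e))).

Lemma path_mx_sym : path_mx^T = path_mx.
Proof. by apply/matrixP=> i j; rewrite !mxE between_sym. Qed.

Lemma path_mx_diag i : path_mx i i = z (vc i).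
Proof.
rewrite mxE between_xx big_set1 big_pred0 ?mulr1 // => e.
apply/negP=> /andP[/edge_ends[u [v [-> uv]]]].
rewrite subUset !sub1set !inE => /andP[/eqP Du /eqP Dv].
by rewrite Du Dv adjxx in uv.
Qed.

Lemma path_mx_edge i j : adj i j -> path_mx i j = z (vc i) * z (vc j) * z (ec i j).
Proof.
move=> ij; rewrite mxE between_adj // big_setU1 ?inE ?(adj_neq ij) //= big_set1.
congr (_ * _); rewrite (big_pred1 [set i; j]) // => e /=.
apply/andP/eqP => [[/edge_ends[u [v [-> uv]]]]|->]; last by rewrite subxx.
rewrite subUset !sub1set !inE => /andP[/orP[]/eqP Du /orP[]/eqP Dv]; subst u v;
  by rewrite ?adjxx // setUC in uv *.
Qed.

Hypothesis conn : forall i j, connect adj i j.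

(** The two halves share the vertex [c] and no edge, and every edge inside [between i j] lies in one
    of them. *)
Lemma path_mx_cat c i j : c \in between i j ->
  path_mx i j * z (vc c) = path_mx i c * path_mx c j.
Proof.
move=> cij; rewrite !mxE (between_cat cij).
set U := between i c; set W := between c j.
have UW v : v \in U -> v \in W -> v = c by apply: between_meet.
have cU : c \in U by apply: between_r.
have cW : c \in W by apply: between_l.
rewrite mulrAC; have -> (F : 'I_n -> R) :
    (\prod_(v in U :|: W) F v) * F c = (\prod_(v in U) F v) * \prod_(v in W) F v.
  have E (P : pred 'I_n) : \prod_(v | P v) F v = \prod_v (if P v then F v else 1).
    exact: big_mkcond.
  rewrite -[F c](big_pred1_eq *%R c F) !E -!big_split /=.
  apply: eq_bigr => v _; rewrite inE /=.
  have [->|vc] := eqVneq v c; first by rewrite cU cW.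
  have [vU|vU] := boolP (v \in U); have [vW|vW] := boolP (v \in W); rewrite /= ?mulr1 ?mul1r //.
  by rewrite (UW v vU vW) eqxx in vc.
rewrite mulrACA; congr (_ * _).
have E (P : pred {set 'I_n}) : \prod_(e | P e) z (ecol G e) =
    \prod_e (if P e then z (ecol G e) else 1) by exact: big_mkcond.
rewrite !E -big_split /=; apply: eq_bigr => e _ /=.
have [eG|] := boolP (e \in edges G); last by rewrite mulr1.
have [u [v [-> uv]]] := edge_ends eG; rewrite !subUset !sub1set !in_setU.
have cross x y : x \in U -> y \in W -> adj x y -> x = c \/ y = c by apply: between_cross.
have UWadj : ~~ [&& u \in U, v \in U, u \in W & v \in W].
  apply/and4P=> -[uU vU uW vW]; move: uv.
  by rewrite (UW u uU uW) (UW v vU vW) adjxx.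
have h1 : u \in U -> v \in W -> (v \in U) || (u \in W).
  by move=> uU vW; have [] := cross u v uU vW uv => ->; rewrite ?cU ?cW ?orbT.
have h2 : v \in U -> u \in W -> (u \in U) || (v \in W).
  move=> vU uW; have [] := cross v u vU uW; first by rewrite adj_sym.
    by move=> ->; rewrite cW orbT.
  by move=> ->; rewrite cU.
move: UWadj h1 h2; case: (u \in U); case: (v \in U); case: (u \in W); case: (v \in W);
  rewrite /= ?mulr1 ?mul1r // => n1 h1 h2;
  first [by [] | exact: n1 | by have := h1 isT isT | by have := h2 isT isT].
Qed.

End PathMatrix.

(** * The inverse of a path matrix *)

Section PathInverse.
Variables (R : realType) (n : nat) (C : eqType) (G : cgraph n.+1 C) (z : C -> R).
Local Notation adj := (adj G).
Local Notation vc := (vcol G).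
Local Notation ec := (ec G).
Local Notation block := (block G).
Local Notation common := (common G).
Local Notation between := (between G).
Local Notation conn_avoid := (conn_avoid G).

Hypotheses (bg : middle_separates G) (vr : vertex_regular G).
Hypotheses (er : edge_regular G) (tr : edge_triangle_regular G).
Hypothesis conn : forall i j, connect adj i j.

(** The matrix of a block, extended by the identity so that all blocks give matrices of the same
    size. *)
Definition block_mx (B : {set 'I_n.+1}) : 'M[R]_n.+1 := \matrix_(u, v)
  if (u \in B) && (v \in B) then if u == v then (z (vc u))^-1 else z (ec u v)
  else (u == v)%:R.

Lemma block_mx_colored : colored G block_mx.
Proof.
split=> [B|B u v uB vB||].
- by apply/matrixP=> u v; rewrite !mxE andbC [v == u]eq_sym ec_sym; case: eqVneq => // ->.
- by rewrite mxE uB (negPf vB) /=; case: eqVneq uB vB => // -> ->.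
- exists z => i j ij.
  by rewrite mxE mem_block_l // mem_block_r //= (negPf (adj_neq ij)).
exists (fun c => (z c.1)^-1) => i j ij.
by rewrite mxE mem_block_l //= eqxx.
Qed.

Lemma path_inverse :
  (forall i, z (vc i) != 0) ->
  (forall i j, adj i j -> block_mx (block i j) \in unitmx) ->
  exists K : 'M[R]_n.+1, in_LG G K /\ K *m path_mx G z = 1%:M.
Proof.
move=> z0 Yu; have [q hq] := common_inverse_poly block_mx.
pose W B := horner_mx (block_mx B) q.
have cW : colored G W := colored_horner bg vr er tr q block_mx_colored.
have [Ws Wo [phi Wphi] _] := cW.
have WY i j : adj i j -> W (block i j) *m block_mx (block i j) = 1%:M.
  by move=> ij; rewrite /W -hq ?Yu // mulVmx ?Yu.
have Wl i j l : adj i j -> adj i l -> l \in block i j -> W (block i j) i l = W (block i l) i l.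
  move=> ij il lB; congr (W _ _ _).
  by rewrite -(block_eq bg ij (mem_block_l ij) lB (adj_neq il)).
pose s i := z (vc i); pose g i j := z (ec i j).
(* The off-diagonal entries are rescaled block inverses; the diagonal ones are then forced by the
   diagonal of [K S = 1]. *)
pose K : 'M[R]_n.+1 := \matrix_(i, l)
  if i == l then (s i)^-1 * (1 - \sum_(m in [set m | adj i m]) W (block i m) i m * g i m)
  else if adj i l then (s i)^-1 * (s l)^-1 * W (block i l) i l else 0.
have Kadj i l : adj i l -> K i l = (s i)^-1 * (s l)^-1 * W (block i l) i l.
  by move=> il; rewrite mxE (negPf (adj_neq il)) il.
exists K; split.
  split.
  - apply/matrixP=> i j; rewrite !mxE eq_sym; case: eqVneq => [->//|_].
    rewrite adj_sym; case: ifP => // ij; rewrite (mulrC (s j)^-1); congr (_ * _).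
    by rewrite block_sym -[in LHS](Ws (block i j)) mxE.
  - by move=> i j ij nij; rewrite mxE (negPf ij) (negPf nij).
  - move=> i j vij; rewrite !mxE !eqxx /s vij; congr (_ * (_ - _)).
    have E x : \sum_(m in [set m | adj x m]) W (block x m) x m * g x m =
        \sum_(m in [set m | adj x m]) phi (ec x m) * z (ec x m).
      by apply: eq_bigr => m; rewrite inE => xm; rewrite Wphi.
    rewrite !E; apply: (@sum_key _ _ _ _ _ (ec i) (ec j) (fun c => phi c * z c)) => b.
    have /vertex_regularP h := vr; have := h i j b vij.
    have F x : #|[set t in [set m | adj x m] | ec x t == b]| = #|nbrs_col G x b|.
      by apply: eq_card => m; rewrite !inE.
    by rewrite !F.
  move=> i j i' j' ij ij' Dc; rewrite !Kadj // !Wphi //.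
  have {}Dc : ec i j = ec i' j' := Dc; rewrite Dc; congr (_ * _).
  have /edge_regularP h := er.
  by rewrite /s; case: (h i j i' j' ij ij' Dc) => -[-> ->] //; rewrite mulrC.
set S := path_mx G z.
have Scat c i j : c \in between i j -> S i j * s c = S i c * S c j.
  exact: path_mx_cat.
have Sadj i l : adj i l -> S i l = s i * s l * g i l by exact: path_mx_edge.
have Ssym i j : S i j = S j i by have /matrixP/(_ j i) := path_mx_sym G z; rewrite mxE.
apply/matrixP=> i j; rewrite mxE (bigD1 i) //= [in RHS]mxE.
have Knbr (F : 'I_n.+1 -> R) : \sum_(l | l != i) K i l * F l =
    \sum_(l | adj i l) (s i)^-1 * (s l)^-1 * W (block i l) i l * F l.
  rewrite [LHS]big_mkcond [RHS]big_mkcond; apply: eq_bigr => l _.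
  rewrite mxE eq_sym; case: eqVneq => [<-|il /=]; first by rewrite adjxx.
  by case: ifP => //; rewrite mul0r.
rewrite {}Knbr {1}/K mxE eqxx big_set.
have tl l : (s l)^-1 * s l = 1 by rewrite mulVf // z0.
have [<-|ij] := eqVneq i j.
  rewrite {1}[S i i]path_mx_diag -/(s i) mulr1n.
  have -> : \sum_(l | adj i l) (s i)^-1 * (s l)^-1 * W (block i l) i l * S l i =
      \sum_(l | adj i l) W (block i l) i l * g i l.
    apply: eq_bigr => l il; rewrite Ssym Sadj //.
    transitivity (((s i)^-1 * s i) * ((s l)^-1 * s l) * (W (block i l) i l * g i l)); first by ring.
    by rewrite !tl !mul1r.
  by rewrite mulrAC tl mul1r subrK.
rewrite mulr0n; have [c ic cij] := gate bg conn ij.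
have ci : c != i by rewrite eq_sym (adj_neq ic).
have ij_avoid : conn_avoid i c j by apply: between_conn_l.
have nic : ~~ conn_avoid c i j.
  by move: cij; rewrite inE (negPf ci).
(* From outside the block, the path to [j] returns through [i]. *)
have Sout l : adj i l -> l \notin block i c -> S l j = s l * g i l * S i j.
  move=> il lB; apply: (mulIf (z0 i)); rewrite -/(s i) (Scat i l j).
    by rewrite Ssym Sadj //; ring.
  rewrite inE; apply/orP; right; apply: contra (bg _ ic (_ : l != c) _).
  - by move=> lj; apply: (conn_avoid_trans lj); rewrite conn_avoid_sym.
  - by rewrite adj_sym.
  - by apply: contraNneq lB => ->; apply: mem_block_r.
  by apply: contra lB => lc; rewrite block_nbr // lc orbT.
have Sin l : l \in common i c -> S l j = s l * g c l * S c j.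
  rewrite inE => /andP[il cl]; apply: (mulIf (z0 c)); rewrite -/(s c) (Scat c l j).
    by rewrite Ssym Sadj //; ring.
  rewrite inE; apply/orP; right; apply: contra nic; apply: conn_avoid_trans.
  by rewrite conn_avoid1 // 1?eq_sym // 1?(adj_neq cl) // (adj_neq ic).
have Sij : S i j = s i * g i c * S c j.
  by apply: (mulIf (z0 c)); rewrite -/(s c) (Scat c i j) // Sadj //; ring.
have split_nbr (F : 'I_n.+1 -> R) : \sum_(l | adj i l) F l =
    \sum_(l | adj i l && (l \notin block i c)) F l + (F c + \sum_(l in common i c) F l).
  rewrite (bigID (mem (block i c))) /= addrC; congr (_ + _).
  rewrite (bigD1 c) /= ?ic ?mem_block_r //; congr (_ + _); apply: eq_bigl => l.
  have [il|nil] := boolP (adj i l); last by rewrite [RHS]inE (negPf nil).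
  rewrite block_common //=; case: eqVneq => [->|]; rewrite ?andbT //=.
  by rewrite inE adjxx andbF.
have Wc l : l \in common i c -> W (block i l) i l = W (block i c) i l.
  move=> lc; have il : adj i l by move: lc; rewrite inE => /andP[].
  by rewrite (Wl i c l) // block_common ?lc ?orbT.
have in_common l : l \in common i c -> [/\ adj i l, adj c l & l \in block i c].
  move=> lc; have [il cl] : adj i l /\ adj c l by move: lc; rewrite inE => /andP.
  by rewrite block_common ?lc ?orbT.
pose w := W (block i c).
have WYe v : \sum_l w i l * block_mx (block i c) l v = (i == v)%:R.
  by have /matrixP/(_ i v) := WY i c ic; rewrite mxE [in RHS]mxE.
have WYi : w i i * (s i)^-1 + w i c * g i c + \sum_(l in common i c) w i l * g i l = 1.
  have := WYe i; rewrite eqxx (sum_block ic) => [|l lB]; last by rewrite Wo ?mul0r ?mem_block_l.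
  move=> E; transitivity (true%:R : R) => //; rewrite -E.
  rewrite !mxE mem_block_l // mem_block_r // eqxx (negPf ci) /= (ec_sym _ c).
  congr (_ + _); apply: eq_bigr => l /in_common[il cl lB].
  by rewrite mxE lB mem_block_l //= eq_sym (negPf (adj_neq il)) (ec_sym _ l).
have WYc : w i i * g i c + w i c * (s c)^-1 + \sum_(l in common i c) w i l * g c l = 0.
  have := WYe c; rewrite (negPf (adj_neq ic)) (sum_block ic) => [|l lB]; last by rewrite Wo ?mul0r ?mem_block_l.
  move=> E; transitivity (false%:R : R) => //; rewrite -E.
  rewrite !mxE mem_block_l // mem_block_r // eqxx (negPf (adj_neq ic)) /=.
  congr (_ + _); apply: eq_bigr => l /in_common[il cl lB].
  by rewrite mxE lB mem_block_r //= eq_sym (negPf (adj_neq cl)) (ec_sym _ l).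
rewrite !split_nbr.
have -> : \sum_(l | adj i l && (l \notin block i c))
    (s i)^-1 * (s l)^-1 * W (block i l) i l * S l j =
  (s i)^-1 * S i j * \sum_(l | adj i l && (l \notin block i c)) W (block i l) i l * g i l.
  rewrite mulr_sumr; apply: eq_bigr => l /andP[il lB]; rewrite Sout //.
  transitivity (((s l)^-1 * s l) * ((s i)^-1 * S i j * (W (block i l) i l * g i l))); first by ring.
  by rewrite tl mul1r.
have -> : \sum_(l in common i c) (s i)^-1 * (s l)^-1 * W (block i l) i l * S l j =
  (s i)^-1 * S c j * \sum_(l in common i c) w i l * g c l.
  rewrite mulr_sumr; apply: eq_bigr => l lc; rewrite Sin // Wc //.
  transitivity (((s l)^-1 * s l) * ((s i)^-1 * S c j * (w i l * g c l))); first by rewrite /w; ring.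
  by rewrite tl mul1r.
have -> : \sum_(l in common i c) W (block i l) i l * g i l =
   \sum_(l in common i c) w i l * g i l.
  by apply: eq_bigr => l lc; rewrite Wc.
rewrite -/w Sij.
set X := \sum_(l | _) _; move: WYi WYc.
set Y := \sum_(l in _) _ * g i _; set Z := \sum_(l in _) _ => WYi WYc.
have -> : Y = 1 - w i i * (s i)^-1 - w i c * g i c by rewrite -WYi; ring.
have -> : Z = - (w i i * g i c + w i c * (s c)^-1) by apply/eqP; rewrite -addr_eq0 addrC WYc.
have := z0 i; rewrite -/(s i) => si; have := z0 c; rewrite -/(s c) => sc.
by field; rewrite si sc.
Qed.

End PathInverse.

(** * Positive definite matrices *)

Section PosDef.
Variables (R : realType) (n : nat).
Implicit Types A K : 'M[R]_n.

Lemma quadratic_formE A (v : 'rV[R]_n) :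
  (v *m A *m v^T) 0 0 = \sum_i \sum_j v 0 i * A i j * v 0 j.
Proof.
rewrite mxE exchange_big /=; apply: eq_bigr => j _.
by rewrite mxE mulr_suml; apply: eq_bigr => i _; rewrite mxE.
Qed.

(** By [2 x y <= x^2 + y^2], entrywise errors of size [eta] change the form by at most [eta n] times
    the squared norm. *)
Lemma posdef_near_diag A (d : 'I_n -> R) (m eta : R) :
  (forall i, m <= d i) ->
  (forall i j, `|A i j - d i *+ (i == j)| <= eta) -> eta * n%:R < m ->
  posdef A.
Proof.
move=> md dA lt v v0; rewrite quadratic_formE.
pose q := \sum_i v 0 i ^+ 2.
have q0 : 0 < q.
  rewrite lt0r sumr_ge0 ?andbT => [|i _]; last exact: sqr_ge0.
  apply: contraNneq v0 => /eqP; rewrite psumr_eq0 => [/allP h|i _]; last exact: sqr_ge0.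
  apply/eqP/rowP=> i; rewrite mxE; apply/eqP.
  by have := h i (mem_index_enum i); rewrite sqrf_eq0.
have -> : \sum_i \sum_j v 0 i * A i j * v 0 j =
    \sum_i d i * v 0 i ^+ 2 + \sum_i \sum_j v 0 i * (A i j - d i *+ (i == j)) * v 0 j.
  rewrite -big_split; apply: eq_bigr => i _ /=.
  rewrite (bigD1 i) //= [in RHS](bigD1 i) //= eqxx mulr1n addrA; congr (_ + _); first by ring.
  by apply: eq_bigr => j ji; rewrite eq_sym (negPf ji) mulr0n subr0.
have h1 : m * q <= \sum_i d i * v 0 i ^+ 2.
  by rewrite mulr_sumr; apply: ler_sum => i _; rewrite ler_wpM2r ?sqr_ge0.
have h2 : `|\sum_i \sum_j v 0 i * (A i j - d i *+ (i == j)) * v 0 j| <= eta * n%:R * q.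
  apply: le_trans (ler_norm_sum _ _ _) _.
  have E : eta * n%:R * q = \sum_(i < n) \sum_(j < n) eta * ((v 0 i ^+ 2 + v 0 j ^+ 2) / 2%:R).
    have -> : \sum_(i < n) \sum_(j < n) eta * ((v 0 i ^+ 2 + v 0 j ^+ 2) / 2%:R) =
        eta / 2%:R * \sum_(i < n) \sum_(j < n) (v 0 i ^+ 2 + v 0 j ^+ 2).
      rewrite mulr_sumr; apply: eq_bigr => i _; rewrite mulr_sumr.
      by apply: eq_bigr => j _; field.
    have -> : \sum_(i < n) \sum_(j < n) (v 0 i ^+ 2 + v 0 j ^+ 2) = n%:R * q + n%:R * q.
      under eq_bigr do rewrite big_split /= sumr_const card_ord -mulr_natl -/q.
      by rewrite big_split /= -mulr_sumr sumr_const card_ord -[q *+ n]mulr_natl.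
    by field.
  rewrite E; apply: ler_sum => i _; apply: le_trans (ler_norm_sum _ _ _) _.
  apply: ler_sum => j _; rewrite !normrM mulrAC mulrC.
  have e0 : 0 <= eta by apply: le_trans (dA i j).
  have := dA i j; have := normr_ge0 (A i j - d i *+ (i == j)).
  rewrite -(real_normK (num_real (v 0 i))) -(real_normK (num_real (v 0 j))).
  move: `|A i j - _| `|v 0 i| `|v 0 j| (normr_ge0 (v 0 i)) (normr_ge0 (v 0 j)) => a x y x0 y0 a0 ae.
  have xy : x * y <= (x ^+ 2 + y ^+ 2) / 2%:R by have := sqr_ge0 (x - y); nra.
  apply: le_trans (_ : eta * (x * y) <= _); first by rewrite ler_wpM2r ?mulr_ge0.
  by rewrite ler_wpM2l.
have := ler_norml (\sum_i \sum_j v 0 i * (A i j - d i *+ (i == j)) * v 0 j) (eta * n%:R * q).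
rewrite h2 => /esym/andP[h3 _].
by have : 0 < (m - eta * n%:R) * q; [rewrite mulr_gt0 ?subr_gt0 | lra].
Qed.

Lemma posdef_unit A : posdef A -> A \in unitmx.
Proof.
move=> pA; rewrite unitmxE unitfE; apply/det0P => -[v v0 vA].
by have := pA v v0; rewrite vA mul0mx mxE ltxx.
Qed.

Lemma posdef_congr A B : B \in unitmx -> posdef A -> posdef (B *m A *m B^T).
Proof.
move=> Bu pA v v0; have := pA (v *m B); rewrite trmx_mul !mulmxA; apply.
by apply: contra v0 => /eqP h; rewrite -(mulmxK Bu v) h mul0mx.
Qed.

Lemma posdef_invmx A : A^T = A -> posdef A -> posdef (invmx A).
Proof.
move=> As pA; have Au := posdef_unit pA.
have := @posdef_congr A (invmx A) _ pA; rewrite unitmx_inv => /(_ Au).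
by rewrite trmx_inv As mulVmx // mul1mx.
Qed.

Lemma posdef_diag_gt0 A i : posdef A -> 0 < A i i.
Proof.
move=> pA; have := pA (delta_mx 0 i); rewrite -rowE trmx_delta -colE !mxE; apply.
by apply/eqP=> /rowP/(_ i)/eqP; rewrite !mxE !eqxx oner_eq0.
Qed.

End PosDef.

Section PathPositive.
Variables (R : realType) (n : nat) (C : eqType) (G : cgraph n.+1 C) (z : C -> R).
Local Notation adj := (adj G).
Local Notation vc := (vcol G).
Local Notation ec := (ec G).
Local Notation block := (block G).
Local Notation between := (between G).
Hypotheses (bg : middle_separates G) (vr : vertex_regular G).
Hypotheses (er : edge_regular G) (tr : edge_triangle_regular G).
Hypothesis conn : forall i j, connect adj i j.

Variables (a eta : R).
Hypotheses (a1 : 1 <= a) (eta0 : 0 <= eta) (eta1 : eta <= 1).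
Hypothesis zv : forall i, 0 < z (vc i) <= a.
Hypothesis ze : forall i j, adj i j -> `|z (ec i j)| <= eta.

(** The first edge [i c] of the path supplies the factor [eta]; other edge factors are at most [1],
    and the inner vertex factors at most [a] each. *)
Lemma path_mx_offdiag i j : i != j ->
  `|path_mx G z i j| <= z (vc i) * z (vc j) * (eta * a ^+ n.+1).
Proof.
move=> ij; have [c ic cij] := gate bg conn ij; rewrite mxE normrM.
have zi := zv i; have zj := zv j.
have a0 : 0 <= a by lra.
have h1 : `|\prod_(v in between i j) z (vc v)| <= z (vc i) * z (vc j) * a ^+ n.+1.
  rewrite (bigD1 i) ?between_l //= (bigD1 j) /=; last by rewrite between_r eq_sym.
  rewrite mulrA normrM ger0_norm; last by rewrite mulr_ge0; lra.
  rewrite ler_wpM2l //; first by rewrite mulr_ge0; lra.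
  rewrite normr_prod; apply: le_trans (_ : \prod_(v in between i j | (v != i) && (v != j)) a <= _).
    rewrite [X in X <= _](eq_bigl (fun v => [&& v \in between i j, v != i & v != j])); last first.
      by move=> v; rewrite -andbA.
    by apply: ler_prod => v _; rewrite normr_ge0 /= ger0_norm; have := zv v; lra.
  rewrite prodr_const; apply: ler_weXn2l => //.
  by rewrite -[X in (_ <= X)%N](card_ord n.+1) max_card.
have h2 : `|\prod_(e in edges G | e \subset between i j) z (ecol G e)| <= eta.
  rewrite (bigD1 [set i; c]) /=; last first.
    by rewrite -[[set i; c] \in _]/(adj i c) ic subUset !sub1set between_l cij.
  rewrite normrM -[X in _ <= X]mulr1 ler_pM ?normr_ge0 ?ze // normr_prod.
  apply: prodr_ile1 => e /andP[/andP[/edge_ends[u [v [-> uv]]] _] _].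
  by rewrite normr_ge0 (le_trans (ze uv)).
have := ler_pM (normr_ge0 _) (normr_ge0 _) h1 h2; move/le_trans; apply.
by rewrite -!mulrA (mulrC eta).
Qed.

Hypothesis small : eta * a ^+ n.+1 * n.+1%:R < a^-1.

Lemma path_mx_in_MG : in_MG G (path_mx G z).
Proof.
set S := path_mx G z.
have z0 i : z (vc i) != 0 by apply: lt0r_neq0; case/andP: (zv i).
have a0 : 0 < a by exact: lt_le_trans ltr01 a1.
have ai : a^-1 <= 1 by rewrite invf_le1.
have zi i : a^-1 <= (z (vc i))^-1.
  by have /andP[h1 h2] := zv i; rewrite lef_pV2 ?posrE.
have [K [LK KS]] : exists K : 'M[R]_n.+1, in_LG G K /\ K *m S = 1%:M.
  apply: path_inverse => // i j ij; apply: posdef_unit.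
  have ea : eta <= eta * a ^+ n.+1 by rewrite ler_peMr // exprn_ege1.
  apply: (@posdef_near_diag _ _ _
    (fun u => if u \in block i j then (z (vc u))^-1 else 1) a^-1 (eta * a ^+ n.+1)) => //.
    by move=> u; case: ifP.
  move=> u v; rewrite mxE; have [<-|uv] := eqVneq u v.
    by rewrite andbb; case: ifP; rewrite subrr normr0 (le_trans eta0).
  rewrite mulr0n subr0; case: ifP => [/andP[uB vB]|_]; last by rewrite normr0 (le_trans eta0).
  by apply: le_trans ea; apply: ze; apply: (block_adj bg ij).
pose D : 'M[R]_n.+1 := diag_mx (\row_i z (vc i)).
have Du : D \in unitmx.
  rewrite unitmxE unitfE det_diag; apply/prodf_neq0 => i _.
  by rewrite mxE z0.
have pS : posdef S.
  (* Dividing by the variances on both sides leaves diagonal entries [1 / s >= 1 / a] and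
     off-diagonal entries at most [eta a^(n+1)], which is where [small] applies. *)
  pose N : 'M[R]_n.+1 := \matrix_(i, j) ((z (vc i))^-1 * S i j * (z (vc j))^-1).
  have -> : S = D *m N *m D^T.
    apply/matrixP=> i j; rewrite tr_diag_mx mul_mx_diag mxE mul_diag_mx mxE !mxE.
    by have := z0 i; have := z0 j => zj0 zi0; field; rewrite zi0 zj0.
  apply: posdef_congr => //.
  apply: (@posdef_near_diag _ _ _ (fun u => (z (vc u))^-1) a^-1 (eta * a ^+ n.+1)) => //.
  move=> i j; rewrite mxE; have [<-|ij] := eqVneq i j.
    rewrite path_mx_diag mulVf // mul1r subrr normr0.
    by rewrite mulr_ge0 ?exprn_ge0 ?(ltW a0).
  rewrite mulr0n subr0 !normrM !normfV.
  have := path_mx_offdiag ij; rewrite -/S.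
  have [zi0 _] := andP (zv i); have [zj0 _] := andP (zv j).
  rewrite (gtr0_norm zi0) (gtr0_norm zj0) ler_pdivrMr // ler_pdivrMl //.
  by congr (_ <= _); ring.
have Su := posdef_unit pS.
have DK : K = invmx S by rewrite -[LHS]mulmx1 -(mulmxV Su) mulmxA KS mul1mx.
exists K; split=> //; last by rewrite DK invmxK.
by rewrite DK; apply: posdef_invmx => //; apply: path_mx_sym.
Qed.

End PathPositive.

(** * The ideal of a regular block graph *)

Lemma prod_by_color (R : comPzRingType) (K : eqType) (T : finType) (P : pred T)
    (k : T -> K) (z : K -> R) (cs : seq K) :
  uniq cs -> (forall t, P t -> k t \in cs) ->
  \prod_(t | P t) z (k t) = \prod_(c <- cs) z c ^+ #|[set t | P t && (k t == c)]|.
Proof.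
move=> ucs kcs.
transitivity (\prod_(c <- cs) \prod_(t | P t && (k t == c)) z c); last first.
  by apply: eq_bigr => c _; rewrite -prodr_const; apply: eq_bigl => t; rewrite inE.
rewrite (exchange_big_dep P) /= => [|c t _ /andP[] //]; apply: eq_bigr => t Pt.
rewrite -big_filter (bigD1_seq (k t)) /= ?mem_filter ?eqxx ?kcs ?filter_uniq ?Pt //.
by rewrite big_filter_cond big1 ?mulr1 // => c /andP[/eqP->]; rewrite eqxx.
Qed.

(** This plays the part of analytic continuation: polynomial identities need only be checked for
    small positive [t]. *)
Lemma poly_eq0_near0 (R : realFieldType) (p : {poly R}) (e : R) :
  0 < e -> (forall t, 0 < t -> t < e -> p.[t] = 0) -> p = 0.
Proof.
(* The shift [k.+2] keeps all the roots strictly below [e]. *)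
move=> e0 h; apply: (@roots_geq_poly_eq0 _ _ [seq e / k.+2%:R | k <- iota 0 (size p)]).
- apply/allP => _ /mapP[k _ ->]; apply/eqP/h; first by rewrite divr_gt0 ?ltr0n.
  by rewrite ltr_pdivrMr ?ltr0n // ltr_pMr // ltr1n.
- rewrite map_inj_uniq ?iota_uniq // => k l /(mulfI (lt0r_neq0 e0))/invr_inj/eqP.
  by rewrite eqr_nat => /eqP[].
by rewrite size_map size_iota.
Qed.

Lemma digits_inj (b N : nat) (x y : 'I_N -> nat) :
  (forall k, x k < b)%N -> (forall k, y k < b)%N ->
  (\sum_(k < N) b ^ k * x k = \sum_(k < N) b ^ k * y k)%N -> x =1 y.
Proof.
elim: N x y => [|N IH] x y xb yb; first by move=> _ [].
rewrite !big_ord_recl /= expn0 !mul1n.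
have E (w : 'I_N.+1 -> nat) : (\sum_(i < N) b ^ bump 0 i * w (lift ord0 i) =
    b * \sum_(i < N) b ^ i * w (lift ord0 i))%N.
  by rewrite big_distrr /=; apply: eq_bigr => i _; rewrite /bump add1n expnS mulnA.
rewrite !E => D; have b0 : (0 < b)%N by apply: leq_trans (xb ord0).
have D0 : x ord0 = y ord0.
  have := congr1 (modn^~ b) D; rewrite /= ![(_ + b * _)%N]addnC ![(b * _)%N]mulnC.
  by rewrite !modnMDl !modn_small.
move: D; rewrite D0 => /addnI/eqP; rewrite eqn_pmul2l // => /eqP D k.
have [j ->|-> //] := unliftP ord0 k.
by apply: (IH (fun j => x (lift ord0 j)) (fun j => y (lift ord0 j))).
Qed.

(** * The monomial map and its kernel *)

Section Toric.
Variables (n : nat) (C : eqType) (G : cgraph n C).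
Local Notation vc := (vcol G).
Local Notation between := (between G).

Definition colors : seq C :=
  undup ([seq vc i | i : 'I_n] ++ [seq ecol G e | e in edges G]).

Definition path_exponent c i j : nat :=
  (#|[set v | (v \in between i j) && (vc v == c)]| +
   #|[set e | (e \in edges G) && (e \subset between i j) && (ecol G e == c)]|)%N.

Lemma path_mx_monomial (R : comPzRingType) (z : C -> R) i j :
  path_mx G z i j = \prod_(c <- colors) z c ^+ path_exponent c i j.
Proof.
have uc : uniq colors by exact: undup_uniq.
rewrite mxE (@prod_by_color _ _ _ _ _ z colors) // => [|v _]; last first.
  by rewrite mem_undup mem_cat image_f.
rewrite (@prod_by_color _ _ _ _ _ z colors) // => [|e /andP[eG _]]; last first.
  by rewrite mem_undup mem_cat image_f ?orbT.
by rewrite -big_split; apply: eq_bigr => c _; rewrite /path_exponent exprD.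
Qed.

Definition sigma_index (k : 'I_#|sympair n|) : 'I_n * 'I_n := val (enum_val k).

Definition color_exponent (m : 'X_{1..#|sympair n|}) c : nat :=
  (\sum_k path_exponent c (sigma_index k).1 (sigma_index k).2 * m k)%N.

Lemma sym_eval_monomial (R : realType) (z : C -> R) m :
  sym_eval (path_mx G z) 'X_[m] = \prod_(c <- colors) z c ^+ color_exponent m c.
Proof.
rewrite /sym_eval mevalX.
transitivity (\prod_k path_mx G z (sigma_index k).1 (sigma_index k).2 ^+ m k); first by [].
under eq_bigr do rewrite path_mx_monomial -prodrXl.
rewrite exchange_big; apply: eq_bigr => c _ /=.
by rewrite -prodrXr; apply: eq_bigr => k _; rewrite exprM.
Qed.

End Toric.

Section BinomialGeneration.
Variables (R : realType) (n : nat) (C : eqType) (G : cgraph n C).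

(* Kronecker substitution: z c = t ^ (b ^ index c colors) sends monomials of
   bounded degree with different colour exponents to different powers of t. *)
Lemma toric_generated (I : sympoly R n -> Prop) (t0 : R) :
  0 < t0 ->
  (forall p (w : C -> nat), (forall c, 0 < w c)%N -> I p ->
     forall t, 0 < t -> t < t0 -> sym_eval (path_mx G (fun c => t ^+ w c)) p = 0) ->
  (forall a b, (forall c, c \in colors G -> color_exponent G a c = color_exponent G b c) ->
     I ('X_[a] - 'X_[b])) ->
  (forall p, I p -> ideal_gen (fun q => Defs.binomial q /\ I q) p).
Proof.
move=> t00 eval0 binI p Ip.
pose cs := colors G.
(* A base larger than every color exponent occurring in [p], so that weights determine exponents as
   digits. *)
pose b := (\sum_(m <- msupp p) \sum_(c <- cs) color_exponent G m c).+1.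
pose w c := (b ^ index c cs)%N.
pose Om m := (\sum_(c <- cs) w c * color_exponent G m c)%N.
have ltb m c : m \in msupp p -> c \in cs -> (color_exponent G m c < b)%N.
  move=> mp cc; rewrite ltnS (big_rem m) //= (big_rem c) //= -addnA.
  exact: leq_addr.
have Om_inj m m' : m \in msupp p -> m' \in msupp p -> Om m = Om m' ->
    forall c, c \in cs -> color_exponent G m c = color_exponent G m' c.
  move=> mp mp'; have E x : Om x = (\sum_(k < size cs) b ^ k *
      color_exponent G x (tnth (in_tuple cs) k))%N.
    rewrite /Om (big_tnth _ _ cs); apply: eq_bigr => k _; rewrite /w.
    by rewrite (tnth_nth (tnth (in_tuple cs) k)) index_uniq // undup_uniq.
  rewrite !E => /digits_inj h c cc.
  have kc : (index c cs < size cs)%N by rewrite index_mem.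
  have tc k : tnth (in_tuple cs) k \in cs by exact: (mem_tnth k (in_tuple cs)).
  have := h (fun k => ltb _ _ mp (tc k)) (fun k => ltb _ _ mp' (tc k)) (Ordinal kc).
  by rewrite /= (tnth_nth c) /= nth_index.
pose Q : {poly R} := \sum_(m <- msupp p) p@_m *: 'X^(Om m).
have Q0 : Q = 0.
  apply: (poly_eq0_near0 t00) => t tgt0 tlt.
  rewrite /Q horner_sum -[RHS](eval0 p w _ Ip t tgt0 tlt); last by move=> c; rewrite expn_gt0.
  rewrite /sym_eval mevalE; apply: eq_bigr => m _; rewrite hornerZ hornerXn; congr (_ * _).
  rewrite -mevalX -/(sym_eval _ _) sym_eval_monomial -prodrXr; apply: eq_bigr => c _; by rewrite exprM.
(* A chosen monomial of [p] of weight [N]; the default is reached only for weights that do not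
   occur. *)
pose r N := nth 0%MM (msupp p) (find (fun m => Om m == N) (msupp p)).
have rP m : m \in msupp p -> r (Om m) \in msupp p /\ Om (r (Om m)) = Om m.
  move=> mp; have hs : has (fun m' => Om m' == Om m) (msupp p) by apply/hasP; exists m.
  split; last exact/eqP/(nth_find 0%MM hs).
  by rewrite mem_nth // -has_find.
(* The coefficient of [Q] at [N] is the sum of the coefficients of [p] of weight [N]. As these sums
   vanish, replacing every monomial by its representative kills [p]. *)
have sum0 : \sum_(m <- msupp p) p@_m *: 'X_[R, r (Om m)] = 0 :> sympoly R n.
  pose B := (\sum_(m <- msupp p) Om m).+1.
  have OmB m : m \in msupp p -> (Om m < B)%N.
    by move=> mp; rewrite ltnS (big_rem m) //= leq_addr.
  transitivity (\sum_(N < B) Q`_N *: 'X_[R, r N] : sympoly R n); last first.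
    by apply: big1 => N _; rewrite Q0 coef0 scale0r.
  under [RHS]eq_bigr => N _.
    rewrite coef_sum scaler_suml; over.
  rewrite exchange_big /=; apply: eq_big_seq => m mp.
  rewrite (bigD1 (Ordinal (OmB m mp))) //= coefZ coefXn eqxx mulr1 big1 ?addr0 // => N NO.
  rewrite coefZ coefXn; case: eqP => [D|]; last by rewrite mulr0 scale0r.
  by case/eqP: NO; apply/val_inj.
exists [seq (p@_m *: 1, 'X_[m] - 'X_[r (Om m)]) | m <- msupp p]; split.
  move=> x /mapP[m mp ->] /=; split; first by exists m, (r (Om m)).
  by apply: binI; apply: Om_inj => //; have [h1 h2] := rP m mp.
rewrite big_map /=; under eq_bigr do rewrite -scalerAl mul1r scalerBr.
by rewrite sumrB sum0 subr0 -mpolyE.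
Qed.

End BinomialGeneration.

Lemma mulmx_entry (R : pzSemiRingType) (n : nat) (A B : 'M[R]_n) (x : R) i j :
  A *m B = x%:M -> \sum_k A i k * B k j = x *+ (i == j).
Proof. by move/matrixP/(_ i j); rewrite !mxE. Qed.

(** * Covariance matrices as path matrices *)

Section InverseCovariance.
Variables (R : realType) (n : nat) (C : eqType) (G : cgraph n C).
Local Notation adj := (adj G).
Local Notation vc := (vcol G).
Local Notation ec := (ec G).
Local Notation between := (between G).
Local Notation conn_avoid := (conn_avoid G).

(** The column [y] solves the system given by [K] away from [c]. Restricted to the component of [i]
    without [c], it still has [K Y] supported at [c], so [Y] is a multiple of column [c] of [S];
    since it vanishes at [c], where [S c c] is nonzero, it vanishes altogether. *)
Lemma separation_identity (K S : 'M[R]_n) c i j :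
  (forall i j, i != j -> ~~ adj i j -> K i j = 0) ->
  K *m S = 1%:M -> S c c != 0 -> c \in between i j ->
  S i j * S c c = S i c * S c j.
Proof.
move=> K0 KS Sc; rewrite inE => /orP[/eqP->|nij]; first by rewrite mulrC.
have [->|ic] := eqVneq i c; first by rewrite mulrC.
pose y u := S u j * S c c - S u c * S c j.
pose Y : 'cV[R]_n := \col_u if conn_avoid c i u then y u else 0.
have yc : y c = 0 by rewrite /y mulrC subrr.
have Uc u : conn_avoid c i u -> u != c by move=> h; apply: conn_avoid_neq h ic.
have KY v : v != c -> (K *m Y) v 0 = 0.
  move=> vnc; rewrite mxE; have [iv|niv] := boolP (conn_avoid c i v).
    transitivity (\sum_u K v u * y u).
      apply: eq_bigr => u _; rewrite mxE; case: ifP => // /negbT niu.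
      have [->|uc] := eqVneq u c; first by rewrite yc.
      rewrite K0 ?mul0r //; first by apply: contraNneq niu => <-.
      apply: contra niu => vu; apply: conn_avoid_trans iv _.
      exact: conn_avoid1.
    under eq_bigr do rewrite mulrBr !mulrA; rewrite sumrB -!mulr_suml.
    rewrite !(mulmx_entry _ _ KS) (negPf vnc) mulr0n mul0r subr0.
    by rewrite (_ : v == j = false) ?mulr0n ?mul0r //; apply: contraNF nij => /eqP <-.
  apply: big1 => u _; rewrite mxE; case: ifP => [iu|_]; last by rewrite mulr0.
  rewrite K0 ?mul0r //; first by apply: contraNneq niv => ->.
  apply: contra niv => vu; apply: (conn_avoid_trans iu).
  by apply: conn_avoid1 => //; [exact: Uc | rewrite adj_sym].
have SK : S *m K = 1%:M by apply: mulmx1C.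
have YE : Y = S *m (K *m Y) by rewrite mulmxA SK mul1mx.
have E u : Y u 0 = S u c * (K *m Y) c 0.
  rewrite {1}YE mxE (bigD1 c) //= big1 ?addr0 // => v vnc.
  by rewrite KY // mulr0.
have : Y c 0 = 0 by rewrite mxE; case: ifP.
rewrite E => /eqP; rewrite mulf_eq0 (negPf Sc) /= => /eqP k0.
have := E i; rewrite k0 mulr0 mxE conn_avoid_refl /y => /eqP.
by rewrite subr_eq0 => /eqP.
Qed.

Hypothesis bg : middle_separates G.
Hypothesis conn : forall i j, connect adj i j.
Hypothesis colors_disjoint : forall (i : 'I_n) (e : {set 'I_n}),
  e \in edges G -> vc i <> ecol G e.

(** A single [z] can carry variances and normalized edge entries because vertex and edge colors are
    disjoint. The remaining entries follow by induction on the size of [between i j], removing the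
    first edge of the path. *)
Lemma path_mxP (S : 'M[R]_n) : S^T = S -> (forall i, S i i != 0) ->
  (forall i j c, c \in between i j -> S i j * S c c = S i c * S c j) ->
  (forall i j, vc i = vc j -> S i i = S j j) ->
  (forall i j i' j', adj i j -> adj i' j' -> ec i j = ec i' j' ->
     S i j / (S i i * S j j) = S i' j' / (S i' i' * S j' j')) ->
  exists2 z : C -> R, S = path_mx G z &
    (forall i, z (vc i) = S i i) /\
    (forall i j, adj i j -> z (ec i j) = S i j / (S i i * S j j)).
Proof.
move=> Ss S0 Scat Sv Se.
pose T := ('I_n + 'I_n * 'I_n)%type.
have [z hz] : exists z : C -> R, forall t : T,
    (if t is inr (i, j) then adj i j else true) ->
    (match t with inl i => S i i | inr (i, j) => S i j / (S i i * S j j) end) =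
    z (match t with inl i => vc i | inr (i, j) => ec i j end).
  apply: factor_through => -[i|[i j]] [i'|[i' j']] //.
  - by move=> _ _; apply: Sv.
  - by move=> _ ij /(colors_disjoint ij).
  - by move=> ij _ /esym /(colors_disjoint ij).
  exact: Se.
have zv i : z (vc i) = S i i by rewrite -(hz (inl i)).
have ze i j : adj i j -> z (ec i j) = S i j / (S i i * S j j).
  by move=> ij; rewrite -(hz (inr (i, j))).
exists z => //; apply/matrixP => i j.
have [m] := ubnP #|between i j|; elim: m i => // m IH i ltm.
have [->|ij] := eqVneq i j; first by rewrite path_mx_diag.
have [c ic cij] := gate bg conn ij.
apply: (mulIf (S0 c)); rewrite (Scat _ _ c) // -[S c c]zv path_mx_cat // path_mx_edge //.
rewrite !zv ze // IH; first by field; rewrite !S0.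
apply: leq_trans _ (ltnSE ltm); apply: proper_card; apply/properP; split.
  by rewrite (between_cat cij) subsetUr.
exists i; rewrite ?between_l //; apply/negP => icj.
have := between_meet conn cij (between_l _ _ _) icj.
by move=> Di; rewrite Di adjxx in ic.
Qed.

End InverseCovariance.

(** * Color averages and uniqueness near the identity *)

Section ColorAverages.
Variables (R : realFieldType) (T : finType) (K : eqType) (P : pred T).
Variables (k : T -> K) (f : T -> R).

Definition average x : R :=
  (\sum_(t | P t && (k t == x)) f t) / #|[set t | P t && (k t == x)]|%:R.

Lemma average_orthogonal (xi : K -> R) :
  \sum_(t | P t) xi (k t) * (f t - average (k t)) = 0.
Proof.
under eq_bigr do rewrite mulrBr; rewrite sumrB; apply/eqP; rewrite subr_eq0; apply/eqP.
pose N x : R := #|[set t | P t && (k t == x)]|%:R.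
transitivity (\sum_(t | P t) \sum_(t' | P t' && (k t' == k t)) xi (k t) * f t' / N (k t)); last first.
  by apply: eq_bigr => t _; rewrite /average mulr_suml mulr_sumr; apply: eq_bigr => t' _; rewrite mulrA.
rewrite (exchange_big_dep P) /= => [|t t' _ /andP[] //]; apply: eq_bigr => t' Pt'.
rewrite (eq_bigr (fun=> xi (k t') * f t' / N (k t'))); last first.
  by move=> t /andP[_ /andP[_ /eqP ->]].
rewrite (eq_bigl (mem [set t | P t && (k t == k t')])); last first.
  by move=> t; rewrite !inE Pt' [k t' == _]eq_sym.
rewrite sumr_const -mulr_natr mulfVK // pnatr_eq0 cards_eq0.
by apply/set0Pn; exists t'; rewrite inE Pt' eqxx.
Qed.

Lemma average_near (c e : R) t : (forall t, P t -> `|f t - c| <= e) -> P t ->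
  `|average (k t) - c| <= e.
Proof.
move=> fc Pt; rewrite /average; set N := #|_|.
have N0 : 0 < N%:R :> R.
  by rewrite ltr0n; apply/card_gt0P; exists t; rewrite inE Pt eqxx.
have E F : \sum_(t0 | P t0 && (k t0 == k t)) F t0 =
    \sum_(t0 in [set t0 | P t0 && (k t0 == k t)]) F t0 :> R.
  by apply: eq_bigl => u; rewrite inE.
have -> : (\sum_(t0 | P t0 && (k t0 == k t)) f t0) / N%:R - c =
    (\sum_(t0 | P t0 && (k t0 == k t)) (f t0 - c)) / N%:R.
  by rewrite sumrB !E sumr_const -/N -mulr_natr; field; rewrite lt0r_neq0.
rewrite normrM normfV (gtr0_norm N0) ler_pdivrMr // (le_trans (ler_norm_sum _ _ _)) //.
apply: le_trans (_ : \sum_(t0 | P t0 && (k t0 == k t)) e <= _).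
  by apply: ler_sum => u /andP[Pu _]; apply: fc.
by rewrite E sumr_const -/N mulr_natr.
Qed.

End ColorAverages.

(** The largest entry [mu] of [S] satisfies [mu <= 1 + mu / 2], hence [mu <= 2]; this bound is fed
    back into [S - 1 = (1 - K) S]. *)
Lemma inverse_near1 (R : realFieldType) (n : nat) (K S : 'M[R]_n.+1) (e : R) :
  K *m S = 1%:M -> (forall i j, `|K i j - (i == j)%:R| <= e) ->
  e * n.+1%:R <= 2%:R^-1 ->
  forall i j, `|S i j - (i == j)%:R| <= 2%:R * n.+1%:R * e.
Proof.
move=> KS Ke eN.
have SE i j : S i j - (i == j)%:R = \sum_k ((i == k)%:R - K i k) * S k j.
  under eq_bigr do rewrite mulrBl; rewrite sumrB (mulmx_entry i j KS); congr (_ - _).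
  rewrite (bigD1 i) //= eqxx mul1r big1 ?addr0 // => k ki.
  by rewrite eq_sym (negPf ki) mul0r.
case: (Order.TotalTheory.arg_maxP (fun p : 'I_n.+1 * 'I_n.+1 => `|S p.1 p.2|)
  (erefl true : xpredT (ord0, ord0))) => -[a b] _ /= mx.
set mu := `|S a b| in mx.
have bound i j : `|S i j - (i == j)%:R| <= e * n.+1%:R * mu.
  rewrite SE; apply: le_trans (ler_norm_sum _ _ _) _.
  apply: le_trans (_ : \sum_(k < n.+1) e * mu <= _).
    apply: ler_sum => k _; rewrite normrM distrC ler_pM ?normr_ge0 //.
    exact: (mx (k, j) isT).
  by rewrite sumr_const card_ord -[e * mu *+ _]mulr_natr mulrAC.
have mu0 : 0 <= mu by apply: normr_ge0.
have mu2 : mu <= 2%:R.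
  have : mu <= 1 + e * n.+1%:R * mu.
    rewrite {1}/mu; have -> : S a b = (a == b)%:R + (S a b - (a == b)%:R) by rewrite addrC subrK.
    apply: le_trans (ler_normD _ _) _; rewrite lerD ?bound //.
    by case: (a == b); rewrite ?normr1 ?normr0.
  have : e * n.+1%:R * mu <= 2%:R^-1 * mu by rewrite ler_wpM2r.
  by lra.
move=> i j; apply: le_trans (bound i j) _.
have e0 : 0 <= e by apply: le_trans (Ke i j).
by rewrite mulrC -mulrA (mulrC e) ler_wpM2r // mulr_ge0.
Qed.

(** At [S = T = 1] the trace is the sum of squares [q] of the entries of [X]; each of the [n^4]
    terms moves by at most [3 e q]. *)
Lemma trace_form_definite (R : realFieldType) (n : nat) (X S T : 'M[R]_n) (e : R) :
  X^T = X -> \tr (X *m S *m X *m T) = 0 -> e <= 1 ->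
  (forall i j, `|S i j - (i == j)%:R| <= e) ->
  (forall i j, `|T i j - (i == j)%:R| <= e) ->
  3%:R * e * n%:R ^+ 4 < 1 -> X = 0.
Proof.
move=> Xs tr0 e1 Se Te small.
pose q := \sum_i \sum_j X i j ^+ 2.
have sq0 i j : 0 <= X i j ^+ 2 by apply: sqr_ge0.
have q0 : 0 <= q by apply: sumr_ge0 => i _; apply: sumr_ge0.
have le_q i j : X i j ^+ 2 <= q.
  rewrite /q (bigD1 i) //= (bigD1 j) //= -addrA lerDl addr_ge0 ?sumr_ge0 //.
  by move=> k _; apply: sumr_ge0.
have Xsym i j : X j i = X i j by rewrite -[in LHS]Xs mxE.
have trE : \tr (X *m S *m X *m T) =
    \sum_i \sum_j \sum_k \sum_l X i j * X k l * (S j k * T l i).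
  apply: eq_bigr => i _; rewrite mxE.
  under eq_bigr => l _.
    rewrite mxE mulr_suml.
    under eq_bigr => k _ do rewrite mxE !mulr_suml.
    over.
  rewrite exchange_big /=; under eq_bigr do rewrite exchange_big /=.
  rewrite exchange_big /=; apply: eq_bigr => j _; apply: eq_bigr => k _.
  by apply: eq_bigr => l _; ring.
have qE : q = \sum_i \sum_j \sum_k \sum_l X i j * X k l * ((j == k)%:R * (l == i)%:R).
  apply: eq_bigr => i _; apply: eq_bigr => j _.
  rewrite (bigD1 j) //= [X in _ + X]big1 ?addr0 => [|k kj]; last first.
    by apply: big1 => l _; rewrite eq_sym (negPf kj) mul0r mulr0.
  rewrite (bigD1 i) //= big1 ?addr0 => [|l li]; last by rewrite (negPf li) !mulr0.
  by rewrite !eqxx !mulr1 Xsym expr2.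
have qd : q = \sum_i \sum_j \sum_k \sum_l
    X i j * X k l * ((j == k)%:R * (l == i)%:R - S j k * T l i).
  rewrite -[LHS]subr0 -[X in _ - X]tr0 trE {1}qE.
  rewrite -sumrB; apply: eq_bigr => i _; rewrite -sumrB; apply: eq_bigr => j _.
  rewrite -sumrB; apply: eq_bigr => k _; rewrite -sumrB; apply: eq_bigr => l _.
  by rewrite mulrBr.
have bound i j k l :
    `|X i j * X k l * ((j == k)%:R * (l == i)%:R - S j k * T l i)| <= q * (3%:R * e).
  rewrite normrM ler_pM ?normr_ge0 //.
    rewrite normrM; have := le_q i j; have := le_q k l.
    rewrite -(real_normK (num_real (X i j))) -(real_normK (num_real (X k l))).
    by have := sqr_ge0 (`|X i j| - `|X k l|); nra.
  have -> : (j == k)%:R * (l == i)%:R - S j k * T l i =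
    - ((S j k - (j == k)%:R) * (T l i - (l == i)%:R) +
       ((j == k)%:R * (T l i - (l == i)%:R) + (l == i)%:R * (S j k - (j == k)%:R))) by ring.
  rewrite normrN; have := Se j k; have := Te l i.
  move: (S j k - _) (T l i - _) => E F Fe Ee.
  have e0 : 0 <= e by apply: le_trans Fe.
  have b1 (b : bool) : `|b%:R : R| <= 1 by case: b; rewrite ?normr1 ?normr0.
  apply: le_trans (ler_normD _ _) _.
  have -> : 3%:R * e = e + (e + e) by ring.
  rewrite lerD //.
    by rewrite normrM -[X in _ <= X]mulr1 ler_pM ?normr_ge0 // (le_trans Fe).
  apply: le_trans (ler_normD _ _) _.
  by rewrite lerD // normrM -[X in _ <= X]mul1r ler_pM ?normr_ge0.
have : q <= q * (3%:R * e * n%:R ^+ 4).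
  rewrite {1}qd; apply: le_trans (ler_norm _) _.
  apply: le_trans (_ : \sum_(i < n) \sum_(j < n) \sum_(k < n) \sum_(l < n) q * (3%:R * e) <= _).
    do 4! (apply: le_trans (ler_norm_sum _ _ _) _; apply: ler_sum => ? _).
    exact: bound.
  by rewrite !sumr_const !card_ord -!mulrnA -[q * (3%:R * e) *+ _]mulr_natr !natrM le_eqVlt; apply/orP; left; apply/eqP; ring.
have [qz _|qn] := eqVneq q 0.
  apply/matrixP=> i j; rewrite mxE; apply/eqP; rewrite -sqrf_eq0 eq_le sq0 andbT -qz.
  exact: le_q.
by rewrite ler_pMr ?lt0r ?qn // leNgt small.
Qed.

Section NearIdentity.
Variables (R : realType) (n : nat) (C : eqType) (G : cgraph n.+1 C).
Local Notation adj := (adj G).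
Local Notation vc := (vcol G).
Local Notation ec := (ec G).
Hypotheses (bg : middle_separates G) (vr : vertex_regular G).
Hypotheses (er : edge_regular G) (tr : edge_triangle_regular G).
Hypothesis conn : forall i j, connect adj i j.
Hypothesis colors_disjoint : forall (i : 'I_n.+1) (e : {set 'I_n.+1}),
  e \in edges G -> vc i <> ecol G e.

Lemma in_LG_sub (K K' : 'M[R]_n.+1) : in_LG G K -> in_LG G K' -> in_LG G (K - K').
Proof.
move=> [s o d e] [s' o' d' e']; split.
- by rewrite linearB /= s s'.
- by move=> i j ij nij; rewrite !mxE o ?o' ?subrr.
- by move=> i j vij; rewrite !mxE (d i j) ?(d' i j).
by move=> i j i' j' ij ij' Dc; rewrite !mxE (e _ _ i' j') ?(e' _ _ i' j').
Qed.

Lemma in_LG_sub_orthogonal (X D : 'M[R]_n.+1) : in_LG G X ->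
  (forall xi : C -> R, \sum_i xi (vc i) * D i i = 0) ->
  (forall xi : C -> R,
     \sum_(p : 'I_n.+1 * 'I_n.+1 | adj p.1 p.2) xi (ec p.1 p.2) * D p.1 p.2 = 0) ->
  \tr (X *m D^T) = 0.
Proof.
move=> [_ Xo Xd Xe] hd he.
have [xi hxi] : exists xi : C -> R, forall i, true -> X i i = xi (vc i).
  by apply: factor_through => i j _ _; apply: Xd.
have [xi' hxi'] : exists xi' : C -> R, forall p : 'I_n.+1 * 'I_n.+1,
    adj p.1 p.2 -> X p.1 p.2 = xi' (ec p.1 p.2).
  by apply: factor_through => p q; apply: Xe.
transitivity (\sum_(p : 'I_n.+1 * 'I_n.+1) X p.1 p.2 * D p.1 p.2).
  rewrite -(pair_bigA _ (fun i j => X i j * D i j)) /=; apply: eq_bigr => i _.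
  by rewrite mxE; apply: eq_bigr => j _; rewrite mxE.
rewrite (bigID (fun p => adj p.1 p.2)) /=.
rewrite (eq_bigr (fun p => xi' (ec p.1 p.2) * D p.1 p.2)) ?he ?add0r => [|p /hxi' -> //].
rewrite -[RHS](hd xi) -[LHS](pair_big_dep xpredT (fun i j => ~~ adj i j) (fun i j => X i j * D i j)) /=.
apply: eq_bigr => i _; rewrite (bigD1 i) ?adjxx //= -hxi // big1 ?addr0 // => j /andP[nij ji].
by rewrite Xo ?mul0r // eq_sym.
Qed.

Lemma near_identity_path : exists2 e : R, 0 < e &
  forall K : 'M[R]_n.+1, in_LG G K -> (forall i j, `|K i j - (i == j)%:R| <= e) ->
    exists z : C -> R, K *m path_mx G z = 1%:M.
Proof.
(* e1 is small enough for the path matrix of the color averages to be positive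
   definite and for trace_form_definite to apply. *)
set N : R := n.+1%:R; pose e1 : R := (100%:R * 2%:R ^+ n.+1 * N ^+ 4)^-1.
have N1 : 1 <= N by rewrite ler1n.
have N4 : N <= N ^+ 4 by rewrite -[X in X <= _]expr1 ler_weXn2l.
have t1 : 1 <= 2%:R ^+ n.+1 :> R by rewrite exprn_ege1 // ler1n.
set t : R := 2%:R ^+ n.+1 in e1 t1.
(* Here [t] bounds the vertex factors along a path, the averages being at most [2], and [N ^ 4]
   counts the terms of the trace form; [100] leaves room for the factor [48] that arises at the
   end. *)
have e1E : e1 * (t * N ^+ 4) = 100%:R^-1.
  by rewrite /e1; field; rewrite ?lt0r_neq0 //; lra.
have e10 : 0 < e1 by rewrite invr_gt0 !mulr_gt0 ?exprn_gt0 //; lra.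
have tN : t <= t * N ^+ 4 by rewrite ler_peMr //; lra.
have e1t : e1 * t <= 100%:R^-1 by rewrite -e1E ler_wpM2l // ltW.
have e1tN : e1 * t * N <= 100%:R^-1.
  by rewrite -e1E -mulrA ler_wpM2l ?(ltW e10) // ler_wpM2l //; lra.
have e11 : e1 <= 100%:R^-1 by apply: le_trans e1t; rewrite ler_peMr // ltW.
(* Inversion multiplies the error by [2 N], which leaves [S] within [e1] of the identity. *)
exists (e1 / (2%:R * N)) => [|K LK Ke]; first by rewrite divr_gt0 // mulr_gt0 //; lra.
have [Ks Ko Kd Kc] := LK.
have Ku : K \in unitmx.
  apply: posdef_unit; apply: (@posdef_near_diag _ _ _ (fun=> 1) 1 (e1 / (2%:R * N))) => //.
  have -> : e1 / (2%:R * N) * N = e1 / 2%:R by field; lra.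
  by lra.
pose S := invmx K; have KS : K *m S = 1%:M by rewrite mulmxV.
have Se i j : `|S i j - (i == j)%:R| <= e1.
  have -> : e1 = 2%:R * N * (e1 / (2%:R * N)) by field; lra.
  apply: inverse_near1 KS Ke _ i j.
  have -> : e1 / (2%:R * N) * N = e1 / 2%:R by field; lra.
  by lra.
pose av := average xpredT vc (fun i => S i i).
pose ad := fun p : 'I_n.+1 * 'I_n.+1 => adj p.1 p.2.
pose kc := fun p : 'I_n.+1 * 'I_n.+1 => ec p.1 p.2.
pose ae := average ad kc (fun p => S p.1 p.2).
have ave i : `|av (vc i) - 1| <= e1.
  by apply: average_near => // j _; have := Se j j; rewrite eqxx.
have aee i j : adj i j -> `|ae (ec i j)| <= e1.
  move=> ij; rewrite -[ae _]subr0; apply: (@average_near _ _ _ ad kc _ 0 e1 (i, j)) => // -[k l] kl.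
  by have := Se k l; rewrite (negPf (adj_neq kl)).
pose T := ('I_n.+1 + 'I_n.+1 * 'I_n.+1)%type.
have [z hz] : exists z : C -> R, forall t : T,
    (if t is inr (i, j) then adj i j else true) ->
    (match t with inl i => av (vc i)
     | inr (i, j) => ae (ec i j) / (av (vc i) * av (vc j)) end) =
    z (match t with inl i => vc i | inr (i, j) => ec i j end).
  apply: factor_through => -[i|[i j]] [i'|[i' j']] //.
  - by move=> _ _ ->.
  - by move=> _ ij /(colors_disjoint ij).
  - by move=> ij _ /esym /(colors_disjoint ij).
  move=> ij ij' Dc; have /edge_regularP h := er.
  by rewrite Dc; case: (h _ _ _ _ ij ij' Dc) => -[-> ->] //; rewrite [_ * av _]mulrC.
have zv i : z (vc i) = av (vc i) by rewrite -(hz (inl i)).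
have ze i j : adj i j -> z (ec i j) = ae (ec i j) / (av (vc i) * av (vc j)).
  by move=> ij; rewrite -(hz (inr (i, j))).
have av_lo i : 2%:R^-1 <= av (vc i) <= 2%:R.
  by have := ave i; rewrite ler_norml => /andP[]; lra.
have zeb i j : adj i j -> `|z (ec i j)| <= 4%:R * e1.
  move=> ij; rewrite ze // normrM normfV.
  have := av_lo i; have := av_lo j; have := aee i j ij.
  move: (av (vc i)) (av (vc j)) `|ae _| => x y w we /andP[y1 _] /andP[x1 _].
  have xy : 4%:R^-1 <= x * y by nra.
  rewrite ger0_norm ?ler_pdivrMr; [nra | lra | lra].
have zvb i : 0 < z (vc i) <= 2%:R by rewrite zv; have := av_lo i; lra.
have [K' [LK' pK' SK']] : in_MG G (path_mx G z).
  apply: (@path_mx_in_MG _ _ _ _ _ bg vr er tr conn 2%:R (4%:R * e1)) => //; try lra.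
  by rewrite -/t -/N; lra.
have Te i j : `|path_mx G z i j - (i == j)%:R| <= 16%:R * (e1 * t).
  have [<-|ij] := eqVneq i j.
    by rewrite path_mx_diag zv; apply: le_trans (ave i) _; nra.
  rewrite subr0; apply: le_trans (_ : _ <= z (vc i) * z (vc j) * (4%:R * e1 * 2%:R ^+ n.+1)) _.
    by apply: path_mx_offdiag => //; lra.
  rewrite -/t; have := zvb i; have := zvb j.
  move: (z (vc i)) (z (vc j)) => x y /andP[y0 y2] /andP[x0 x2].
  have xy : x * y <= 4%:R by nra.
  have -> : 16%:R * (e1 * t) = 4%:R * (4%:R * e1 * t) by ring.
  by rewrite ler_wpM2r //; nra.
exists z; have K'T : K' *m path_mx G z = 1%:M by rewrite SK' mulmxV // posdef_unit.
suff XE : K - K' = 0 by rewrite (subr0_eq XE).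
have TK' : path_mx G z *m K' = 1%:M by apply: mulmx1C.
have SK : S *m K = 1%:M by apply: mulmx1C.
have [Xs _ _ _] := in_LG_sub LK LK'.
apply: (@trace_form_definite _ _ _ S (path_mx G z) (16%:R * (e1 * t))) => //; last 1 first.
- rewrite -/N; have -> : 3%:R * (16%:R * (e1 * t)) * N ^+ 4 = 48%:R * (e1 * (t * N ^+ 4)) by ring.
  by rewrite e1E; lra.
(* With [T] the path matrix, [S (K - K') T = T - S]. The diagonal and edge entries of [T] are the
   color averages of those of [S], so [S - T] is orthogonal to [L_G]. *)
- have -> : (K - K') *m S *m (K - K') *m path_mx G z = - ((K - K') *m (S - path_mx G z)).
    rewrite -!mulmxA -mulmxN; congr (_ *m _).
    rewrite mulmxBl mulmxBr K'T mulmx1 mulmxA SK mul1mx.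
    by rewrite opprB.
  have Ds : (S - path_mx G z)^T = S - path_mx G z.
    by rewrite linearB /= path_mx_sym /S trmx_inv Ks.
  rewrite linearN /= -Ds in_LG_sub_orthogonal ?oppr0 //; first exact: in_LG_sub.
    move=> xi; rewrite -[RHS](average_orthogonal xpredT vc (fun i => S i i) xi).
    by apply: eq_bigr => i _; rewrite 2!mxE path_mx_diag zv.
  move=> xi; rewrite -[RHS](average_orthogonal ad kc (fun p => S p.1 p.2) xi).
  apply: eq_bigr => -[i j] ij; rewrite 2!mxE path_mx_edge // ze // !zv; congr (_ * (_ - _)).
  have := av_lo i; have := av_lo j => jl il; rewrite -/(ae _) /kc /=; field.
  by apply/andP; split; apply/lt0r_neq0; lra.
- by lra.
- by move=> i j; apply: le_trans (Se i j) _; nra.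
Qed.

End NearIdentity.

Lemma adj_inverse (R : comPzRingType) (n : nat) (K S : 'M[R]_n) :
  K *m S = 1%:M -> \adj K = \det K *: S.
Proof.
move=> KS; rewrite -[LHS]mulmx1 -KS mulmxA mul_adj_mx.
by rewrite mul_scalar_mx.
Qed.

(** Adjugate entries are polynomial in [t], so an equality near [t = 0] reaches [t = 1]. *)
Lemma adj_segment_eq (R : realFieldType) (n : nat) (K : 'M[R]_n) (e : R) i j k l :
  0 < e ->
  (forall t, 0 < t -> t < e ->
    let Kt := 1%:M + t *: (K - 1%:M) in \adj Kt i j = \adj Kt k l) ->
  \adj K i j = \adj K k l.
Proof.
move=> e0 h; pose P : 'M[{poly R}]_n :=
  \matrix_(a, b) ((a == b)%:R%:P + 'X * (K a b - (a == b)%:R)%:P).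
have PE t : map_mx (horner_eval t) P = 1%:M + t *: (K - 1%:M).
  by apply/matrixP=> a b; rewrite !mxE /horner_eval !hornerE.
have aE t a b : (\adj P a b).[t] = \adj (1%:M + t *: (K - 1%:M)) a b.
  by rewrite -PE -map_mx_adj [in RHS]mxE.
have D0 : \adj P i j - \adj P k l = 0.
  apply: (poly_eq0_near0 e0) => t t0 te; rewrite hornerD hornerN !aE.
  by rewrite (h t t0 te) subrr.
apply/eqP; rewrite -subr_eq0; have := congr1 (horner_eval 1) D0.
rewrite /horner_eval hornerD hornerN !aE horner0 => h1; apply/eqP; rewrite -[RHS]h1.
by rewrite scale1r [1%:M + _]addrC subrK.
Qed.

Section Toricity.
Variables (R : realType) (n : nat) (C : eqType) (G : cgraph n.+1 C).
Local Notation adj := (adj G).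
Local Notation vc := (vcol G).
Local Notation ec := (ec G).
Hypotheses (bg : middle_separates G) (vr : vertex_regular G).
Hypotheses (er : edge_regular G) (tr : edge_triangle_regular G).
Hypothesis conn : forall i j, connect adj i j.
Hypothesis colors_disjoint : forall (i : 'I_n.+1) (e : {set 'I_n.+1}),
  e \in edges G -> vc i <> ecol G e.

Lemma in_LG_segment (K : 'M[R]_n.+1) t :
  in_LG G K -> in_LG G (1%:M + t *: (K - 1%:M)).
Proof.
move=> [s o d e]; split.
- by rewrite linearD linearZ linearB /= s tr_scalar_mx.
- by move=> i j ij nij; rewrite !mxE o // (negPf ij) subrr mulr0 addr0.
- by move=> i j vij; rewrite !mxE (d i j) // !eqxx.
move=> i j i' j' ij ij' Dc; rewrite !mxE (e _ _ i' j') //.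
by rewrite (negPf (adj_neq ij)) (negPf (adj_neq ij')).
Qed.

(** Only the equalities between entries of equal color are carried along the segment from the
    identity to [K]. Factorization at separating vertices holds for every inverse of a matrix in
    [L_G], and together these give the path form. *)
Lemma in_MG_path_mx (S : 'M[R]_n.+1) : in_MG G S -> exists z : C -> R, S = path_mx G z.
Proof.
case=> K [LK pK ->]; have Ku := posdef_unit pK.
have KS := mulmxV Ku; set S' := invmx K in KS *.
have detK : \det K != 0 by move: Ku; rewrite unitmxE unitfE.
have [e e0 near] := near_identity_path R bg vr er tr conn colors_disjoint.
have [eps eps0 small] : exists2 eps : R, 0 < eps & forall t, 0 < t -> t < eps ->
    exists z : C -> R, (1%:M + t *: (K - 1%:M)) *m path_mx G z = 1%:M.
  pose M := \sum_i \sum_j `|K i j - (i == j)%:R|.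
  have M0 : 0 <= M by apply: sumr_ge0 => i _; apply: sumr_ge0.
  exists (e / (M + 1)) => [|t t0 te]; first by rewrite divr_gt0 // ltr_wpDl.
  apply: near => [|i j]; first exact: in_LG_segment.
  have -> : (1%:M + t *: (K - 1%:M)) i j - (i == j)%:R = t * (K i j - (i == j)%:R).
    by rewrite !mxE; ring.
  rewrite normrM (gtr0_norm t0).
  have : `|K i j - (i == j)%:R| <= M.
    rewrite /M (bigD1 i) //= (bigD1 j) //= -addrA lerDl addr_ge0 ?sumr_ge0 //.
    by move=> k _; apply: sumr_ge0.
  move: te; rewrite ltr_pdivlMr ?ltr_wpDl // => te le1.
  apply: le_trans (_ : t * (M + 1) <= _); last exact: ltW.
  by rewrite ler_wpM2l ?(ltW t0) //; lra.
have SE i j : S' i j = \adj K i j / \det K.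
  by rewrite (adj_inverse KS) mxE mulrC mulKf.
have Sv i j : vc i = vc j -> S' i i = S' j j.
  move=> vij; rewrite !SE; congr (_ / _); apply: (adj_segment_eq eps0) => t t0 te Kt.
  have [z /adj_inverse ->] := small t t0 te.
  by rewrite mxE [in RHS]mxE !path_mx_diag vij.
have Se i j i' j' : adj i j -> adj i' j' -> ec i j = ec i' j' -> S' i j = S' i' j'.
  move=> ij ij' Dc; rewrite !SE; congr (_ / _); apply: (adj_segment_eq eps0) => t t0 te Kt.
  have [z /adj_inverse ->] := small t t0 te.
  rewrite mxE [in RHS]mxE; congr (_ * _); rewrite !path_mx_edge // Dc; congr (_ * _).
  have /edge_regularP h := er.
  by case: (h _ _ _ _ ij ij' Dc) => -[-> ->] //; rewrite mulrC.
have [Ks Ko _ _] := LK.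
have S's : S'^T = S' by rewrite /S' trmx_inv Ks.
have S'0 i : S' i i != 0.
  by apply/lt0r_neq0/posdef_diag_gt0/posdef_invmx.
have [||z -> _] := path_mxP bg conn colors_disjoint S's S'0 _ Sv _; last by exists z.
  by move=> i j c cij; apply: separation_identity Ko KS (S'0 c) cij.
move=> i j i' j' ij ij' Dc; rewrite (Se i j i' j') //; congr (_ / _).
have /edge_regularP h := er.
by case: (h _ _ _ _ ij ij' Dc) => -[/Sv -> /Sv ->] //; rewrite mulrC.
Qed.

Lemma toric_of_regular : generated_by_binomials (in_IG (R := R) G).
Proof.
exists (fun q => Defs.binomial q /\ in_IG (R := R) G q); split=> [p []//|p]; split; last first.
  case=> s [sI ->] S SM; rewrite /sym_eval raddf_sum /= big_seq big1 // => x /sI[_ xI].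
  by rewrite mevalM -/(sym_eval S x.2) xI ?mulr0.
(* The path matrix is used with [a = 1] and [eta = t]; smallness then reads [t (n + 1) < 1]. *)
apply: (@toric_generated R n.+1 C G _ (n.+2%:R^-1)); first by rewrite invr_gt0 ltr0n.
  move=> q w w0 qI t t0 tn; apply: qI.
  have tN : t * n.+1%:R < 1.
    have : t * n.+2%:R < 1 by rewrite -ltr_pdivlMr ?ltr0n // mul1r.
    by rewrite -[n.+2]addn1 natrD mulrDr mulr1 => ?; lra.
  have t1 : t <= 1.
    by apply: le_trans (ltW tn) _; rewrite invf_le1 ?ltr0n // ler1n.
  apply: (@path_mx_in_MG _ _ _ _ _ bg vr er tr conn 1 t) => //; first exact: ltW.
  - by move=> i; rewrite exprn_gt0 //= exprn_ile1 // ltW.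
  - move=> i j ij; rewrite ger0_norm ?exprn_ge0 ?(ltW t0) //.
    rewrite -(prednK (w0 (ec i j))) exprS ler_piMr ?(ltW t0) // exprn_ile1 //.
    exact: ltW.
  by rewrite expr1n mulr1 invr1.
move=> a b ab S /in_MG_path_mx[z ->]; rewrite /sym_eval mevalB -!/(sym_eval _ _).
rewrite !sym_eval_monomial; apply/eqP; rewrite subr_eq0; apply/eqP.
by apply: eq_big_seq => c cc; rewrite ab.
Qed.

End Toricity.

(** * Consequences of generation by binomials *)

Section CoefMatrix.
Variables (R : realFieldType) (n : nat).
Implicit Types F E : 'M[{poly R}]_n.

Definition coef_mx m F : 'M[R]_n := map_mx (fun p : {poly R} => p`_m) F.

Lemma coef_mxM m F E :
  coef_mx m (F *m E) = \sum_(a < m.+1) coef_mx a F *m coef_mx (m - a) E.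
Proof.
apply/matrixP=> i j; rewrite !mxE coef_sum summxE.
under eq_bigr do rewrite coefM.
rewrite exchange_big /=; apply: eq_bigr => a _; rewrite mxE.
by apply: eq_bigr => k _; rewrite !mxE.
Qed.

Lemma coef_mx_scalar m (p : {poly R}) : coef_mx m p%:M = (p`_m)%:M.
Proof. by apply/matrixP=> i j; rewrite !mxE; case: (i == j); rewrite ?coef0. Qed.

Definition pencil (D H : 'M[R]_n) : 'M[{poly R}]_n :=
  \matrix_(i, j) ((D i j)%:P - 'X * (H i j)%:P).

Lemma pencil_horner D H t : map_mx (horner_eval t) (pencil D H) = D - t *: H.
Proof. by apply/matrixP=> i j; rewrite !mxE /horner_eval !hornerE. Qed.

Lemma coef_pencil D H m : coef_mx m (pencil D H) =
  if m is m'.+1 then (if m' is 0%N then - H else 0) else D.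
Proof.
apply/matrixP=> i j; rewrite !mxE coefB coefXM !coefC.
by case: m => [|[|m]]; rewrite ?subr0 ?sub0r ?mxE //= oppr0.
Qed.

(** Comparing coefficients in the adjugate identity gives a recursion in the order; the determinant
    enters only through a scalar matrix. *)
Lemma coef_pencil_adj D H m :
  D *m coef_mx m.+1 (\adj (pencil D H)) =
  ((\det (pencil D H))`_m.+1)%:M + H *m coef_mx m (\adj (pencil D H)).
Proof.
have := congr1 (coef_mx m.+1) (mul_mx_adj (pencil D H)).
rewrite coef_mxM coef_mx_scalar => <-.
rewrite big_ord_recl big_ord_recl big1 => [|k _]; last first.
  by rewrite coef_pencil /= mul0mx.
by rewrite !coef_pencil /= subn0 subn1 /= addr0 mulNmx subrK.
Qed.

Lemma coef_pencil_adj0 D H :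
  D *m coef_mx 0 (\adj (pencil D H)) = ((\det (pencil D H))`_0)%:M.
Proof.
have := congr1 (coef_mx 0) (mul_mx_adj (pencil D H)).
by rewrite coef_mxM coef_mx_scalar big_ord1 coef_pencil subn0.
Qed.

Lemma det_coef0 F : (\det F)`_0 = \det (coef_mx 0 F).
Proof.
rewrite -[LHS]horner_coef0 -/(horner_eval 0 (\det F)) -det_map_mx; congr (\det _).
by apply/matrixP=> i j; rewrite !mxE; apply: horner_coef0.
Qed.

End CoefMatrix.

Section SmallPencil.
Variables (R : realType) (n : nat).

Lemma pencil_posdef (d : 'I_n -> R) (H : 'M[R]_n) : (forall i, 0 < d i) ->
  exists2 e : R, 0 < e & forall t, 0 < t -> t < e ->
    posdef (diag_mx (\row_i d i) - t *: H).
Proof.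
(* The constant [m] is a positive lower bound for all [d i], also when [n = 0]. *)
move=> d0; pose M := \sum_i \sum_j `|H i j|; pose m := (1 + \sum_i (d i)^-1)^-1.
have M0 : 0 <= M by apply: sumr_ge0 => i _; apply: sumr_ge0.
have di i : 0 <= (d i)^-1 by rewrite invr_ge0 ltW.
have s0 : 0 <= \sum_i (d i)^-1 by apply: sumr_ge0.
have m0 : 0 < m by rewrite invr_gt0; lra.
have md i : m <= d i.
  rewrite -[d i]invrK lef_pV2 ?posrE ?invr_gt0 //; last by lra.
  by rewrite (bigD1 i) //= addrCA lerDl addr_ge0 // sumr_ge0.
exists (m / ((M + 1) * (n%:R + 1))).
  by rewrite divr_gt0 // mulr_gt0 ?ltr_wpDl ?ler0n.
move=> t t0 te; apply: (@posdef_near_diag _ _ _ d m (t * M)) => // [i j|].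
  rewrite !mxE; have -> : d i *+ (i == j) - t * H i j - d i *+ (i == j) = - (t * H i j) by ring.
  rewrite normrN normrM (gtr0_norm t0) ler_wpM2l ?(ltW t0) //.
  rewrite /M (bigD1 i) //= (bigD1 j) //= -addrA lerDl addr_ge0 ?sumr_ge0 //.
  by move=> k _; apply: sumr_ge0.
move: te; rewrite ltr_pdivlMr ?mulr_gt0 ?ltr_wpDl ?ler0n // => te.
apply: le_lt_trans te; rewrite -mulrA ler_wpM2l ?(ltW t0) //.
by rewrite ler_pM ?ler0n //; lra.
Qed.

End SmallPencil.

(** * Entrywise products of covariance matrices *)

Section Hadamard.
Variables (R : realType) (n : nat) (C : eqType) (G : cgraph n C).
Local Notation adj := (adj G).
Local Notation vc := (vcol G).
Local Notation ec := (ec G).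

Definition hadamard (Q : pzRingType) (S T : 'M[Q]_n) : 'M[Q]_n :=
  \matrix_(i, j) (S i j * T i j).

(* The variable s_ij, whichever of (i, j) and (j, i) indexes it. *)
Definition cov_var i j : sympoly R n :=
  if insub (i, j) : option (sympair n) is Some p then 'X_(enum_rank p)
  else if insub (j, i) : option (sympair n) is Some p then 'X_(enum_rank p) else 0.

Definition cov_mx : 'M[sympoly R n]_n := \matrix_(i, j) cov_var i j.

Lemma sym_eval_var (S : 'M[R]_n) (p : sympair n) :
  sym_eval S 'X_(enum_rank p) = S (val p).1 (val p).2.
Proof. by rewrite /sym_eval mevalXU /= enum_rankK. Qed.

Lemma sym_eval_adj (S : 'M[R]_n) i j : S^T = S -> sym_eval S (\adj cov_mx i j) = \adj S i j.
Proof.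
move=> Ss; set v := (fun k : 'I_#|sympair n| => let ij := val (enum_val k) in S ij.1 ij.2).
have E : map_mx (meval v) cov_mx = S.
  apply/matrixP=> k l; rewrite !mxE -/(sym_eval S _) /cov_var.
  case: insubP => [p _ pE|nkl]; first by rewrite sym_eval_var pE.
  case: insubP => [p _ pE|nlk]; last first.
    by move: nkl nlk; rewrite /= -!ltnNge => /ltnW h1; rewrite ltnNge h1.
  by rewrite sym_eval_var pE /= -[in LHS]Ss mxE.
by rewrite -[in RHS]E -map_mx_adj [in RHS]mxE.
Qed.

Lemma in_LG_scale (K : 'M[R]_n) a : in_LG G K -> in_LG G (a *: K).
Proof.
move=> [s o d e]; split.
- by rewrite linearZ /= s.
- by move=> i j ij nij; rewrite mxE o ?mulr0.
- by move=> i j vij; rewrite !mxE (d i j).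
by move=> i j i' j' ij ij' Dc; rewrite !mxE (e _ _ i' j').
Qed.

(** The linear equations of [L_G], imposed on the adjugate of the generic symmetric matrix, are
    elements of [I_G]. *)
Lemma in_LG_adj (S : 'M[R]_n) : S^T = S ->
  (forall p, in_IG (R := R) G p -> sym_eval S p = 0) -> in_LG G (\adj S).
Proof.
move=> Ss SI.
have adjK (T : 'M[R]_n) : in_MG G T -> T^T = T /\ in_LG G (\adj T).
  move=> [K [LK /posdef_unit Ku ->]]; split; first by case: LK => Ks _ _ _; rewrite trmx_inv Ks.
  by rewrite (adj_inverse (mulVmx Ku)); apply: in_LG_scale.
split.
- by rewrite trmx_adj Ss.
- move=> i j ij nij; rewrite -sym_eval_adj //; apply: SI => T /adjK[Ts [_ o _ _]].
  by rewrite sym_eval_adj // o.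
- move=> i j vij; rewrite -!sym_eval_adj //; apply/eqP; rewrite -subr_eq0 /sym_eval -mevalB.
  apply/eqP; apply: SI => T /adjK[Ts [_ _ d _]].
  by rewrite /sym_eval mevalB -!/(sym_eval _ _) !sym_eval_adj // (d i j) // subrr.
move=> i j i' j' ij ij' Dc; rewrite -!sym_eval_adj //; apply/eqP; rewrite -subr_eq0 /sym_eval -mevalB.
apply/eqP; apply: SI => T /adjK[Ts [_ _ _ e]].
by rewrite /sym_eval mevalB -!/(sym_eval _ _) !sym_eval_adj // (e i j i' j') // subrr.
Qed.

Hypothesis gen : generated_by_binomials (in_IG (R := R) G).

(* Binomial equations are multiplicative, so the variety they define is closed
   under entrywise products. *)
Lemma hadamard_in_IG (S T : 'M[R]_n) p : in_MG G S -> in_MG G T ->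
  in_IG (R := R) G p -> sym_eval (hadamard S T) p = 0.
Proof.
move=> SM TM; have [B [Bbin BI]] := gen; move=> /BI[s [sB ->]].
rewrite /sym_eval raddf_sum /= big_seq big1 // => x /sB Bx.
rewrite mevalM; have IB : in_IG (R := R) G x.2.
  apply/BI; exists [:: (1, x.2)]; split; last by rewrite big_seq1 mul1r.
  by move=> y; rewrite inE => /eqP ->.
have [a [b Dx]] := Bbin _ Bx.
have E m : sym_eval (hadamard S T) 'X_[m] = sym_eval S 'X_[m] * sym_eval T 'X_[m].
  rewrite /sym_eval !mevalX -big_split; apply: eq_bigr => i _ /=.
  by rewrite mxE exprMn.
have EB (U : 'M[R]_n) : sym_eval U x.2 = sym_eval U 'X_[a] - sym_eval U 'X_[b].
  by rewrite Dx /sym_eval mevalB.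
have /eqP := IB _ SM; have /eqP := IB _ TM.
rewrite -!/(sym_eval _ _) !EB !subr_eq0 !E => /eqP -> /eqP ->.
by rewrite subrr mulr0.
Qed.

Lemma hadamard_adj (S T : 'M[R]_n) : in_MG G S -> in_MG G T ->
  in_LG G (\adj (hadamard S T)).
Proof.
move=> SM TM; apply: in_LG_adj; last by move=> p; apply: hadamard_in_IG.
have sy (U : 'M[R]_n) : in_MG G U -> U^T = U.
  by move=> [K [[Ks _ _ _] _ ->]]; rewrite trmx_inv Ks.
by apply/matrixP=> i j; rewrite !mxE -{1}(sy _ SM) -{1}(sy _ TM) !mxE.
Qed.

(** The equations of [L_G] are linear, so they pass from values at small [t] to coefficients. *)
Lemma poly_in_LG (F : 'M[{poly R}]_n) (e : R) : 0 < e ->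
  (forall t, 0 < t -> t < e -> in_LG G (map_mx (horner_eval t) F)) ->
  forall m, in_LG G (coef_mx m F).
Proof.
move=> e0 h m.
have eqF i j k l : (forall t, 0 < t -> t < e -> (F i j).[t] = (F k l).[t]) ->
    coef_mx m F i j = coef_mx m F k l.
  move=> E; rewrite !mxE; suff -> : F i j = F k l by [].
  apply/eqP; rewrite -subr_eq0; apply/eqP.
  apply: (poly_eq0_near0 e0) => t t0 te; by rewrite hornerD hornerN E ?subrr.
split.
- apply/matrixP=> i j; rewrite mxE; apply: eqF => t t0 te.
  have [/matrixP/(_ i j) E _ _ _] := h t t0 te; by rewrite !mxE in E.
- move=> i j ij nij; rewrite mxE (_ : F i j = 0) ?coef0 //.
  apply: (poly_eq0_near0 e0) => t t0 te; have [_ o _ _] := h t t0 te.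
  by have := o i j ij nij; rewrite mxE.
- move=> i j vij; apply: eqF => t t0 te; have [_ _ d _] := h t t0 te.
  by have := d i j vij; rewrite !mxE.
move=> i j i' j' ij ij' Dc; apply: eqF => t t0 te; have [_ _ _ c] := h t t0 te.
by have := c i j i' j' ij ij' Dc; rewrite !mxE.
Qed.

End Hadamard.

Section HadamardExpansion.
Variables (R : realType) (n : nat) (C : eqType) (G : cgraph n C).
Local Notation adj := (adj G).
Local Notation vc := (vcol G).
Local Notation ec := (ec G).

Definition vcol_mx (d : C -> R) : 'M[R]_n := diag_mx (\row_i d (vc i)).

Definition ecol_mx (h : C -> R) : 'M[R]_n :=
  \matrix_(i, j) if adj i j then h (ec i j) else 0.

Lemma ecol_mx_sym h i j : ecol_mx h i j = ecol_mx h j i.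
Proof. by rewrite !mxE adj_sym ec_sym. Qed.

Lemma ecol_mx_diag h i : ecol_mx h i i = 0.
Proof. by rewrite mxE adjxx. Qed.

Lemma pencil_in_LG d h t : in_LG G (vcol_mx d - t *: ecol_mx h).
Proof.
split.
- apply/matrixP=> i j; rewrite !mxE adj_sym ec_sym eq_sym.
  by case: eqVneq => // ->.
- by move=> i j ij nij; rewrite !mxE (negPf ij) (negPf nij) mulr0 subr0.
- by move=> i j vij; rewrite !mxE !eqxx !adjxx vij.
move=> i j i' j' ij ij' Dc; rewrite !mxE ij ij' (negPf (adj_neq ij)) (negPf (adj_neq ij')).
by congr (_ - t * h _).
Qed.

Lemma pencil_in_MG d h : (forall i, 0 < d (vc i)) ->
  exists2 e : R, 0 < e & forall t, 0 < t -> t < e ->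
    exists2 S : 'M[R]_n, in_MG G S &
      map_mx (horner_eval t) (\adj (pencil (vcol_mx d) (ecol_mx h))) =
      \det (vcol_mx d - t *: ecol_mx h) *: S.
Proof.
move=> d0; have [e e0 pd] := pencil_posdef (ecol_mx h) d0.
exists e => // t t0 te; have pK := pd t t0 te.
exists (invmx (vcol_mx d - t *: ecol_mx h)).
  by exists (vcol_mx d - t *: ecol_mx h); split=> //; apply: pencil_in_LG.
rewrite map_mx_adj -(adj_inverse (mulmxV (posdef_unit pK))); congr (\adj _).
exact: pencil_horner.
Qed.

Hypothesis gen : generated_by_binomials (in_IG (R := R) G).

Section OneCovariance.
Variable S : 'M[R]_n.
Hypothesis SM : in_MG G S.

(** At small positive [t], [B] is a multiple of [T = (1 - t A)^-1], hence [P] is the same multiple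
    of the entrywise product of [S] and [T], and [Q] takes values in [L_G]. Adjugates keep
    everything polynomial in [t]. *)
Let A := ecol_mx (fun=> 1).
Let B := \adj (pencil (vcol_mx (fun=> 1)) A).
Let P := hadamard (map_mx polyC S) B.
Let Q := \adj P.

Let Q_in_LG m : in_LG G (coef_mx m Q).
Proof.
have [e e0 h] := @pencil_in_MG (fun=> 1) (fun=> 1) (fun=> ltr01).
apply: (poly_in_LG e0) => t t0 te; have [T TM TE] := h t t0 te.
rewrite map_mx_adj; set c := \det _ in TE.
have -> : map_mx (horner_eval t) P = c *: hadamard S T.
  apply/matrixP=> i j; rewrite [LHS]mxE /P [hadamard _ _ i j]mxE [map_mx polyC S i j]mxE.
  rewrite [RHS]mxE [hadamard S T i j]mxE /horner_eval /= hornerM hornerC.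
  have /matrixP/(_ i j) := TE; rewrite [LHS]mxE [RHS]mxE /horner_eval => ->.
  by rewrite mulrCA.
by rewrite adjZ; apply: in_LG_scale; apply: hadamard_adj.
Qed.

Let coefP m i j : coef_mx m P i j = S i j * coef_mx m B i j.
Proof. by rewrite !mxE coefCM. Qed.

Let D1 : vcol_mx (fun=> 1) = 1%:M.
Proof. by apply/matrixP=> i j; rewrite !mxE. Qed.

Let Sdiag i : 0 < S i i.
Proof.
have [K [[Ks _ _ _] pK ->]] := SM.
exact/posdef_diag_gt0/posdef_invmx.
Qed.

Let f m := (\det P)`_m.
Let b m := (\det (pencil (vcol_mx (fun=> 1)) A))`_m.

Let B0 : coef_mx 0 B = 1%:M.
Proof.
have := coef_pencil_adj0 (vcol_mx (fun=> 1)) A.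
by rewrite -/B det_coef0 coef_pencil D1 mul1mx det1.
Qed.

Let B1 : coef_mx 1 B = (b 1)%:M + A.
Proof.
have := coef_pencil_adj (vcol_mx (fun=> 1)) A 0.
by rewrite -/B -/(b 1) B0 D1 mul1mx mulmx1.
Qed.

Let B2 : coef_mx 2 B = (b 2)%:M + (b 1) *: A + A *m A.
Proof.
have := coef_pencil_adj (vcol_mx (fun=> 1)) A 1.
by rewrite -/B -/(b 2) B1 D1 mul1mx mulmxDr mul_mx_scalar addrA.
Qed.

Let B1E i j : i != j -> coef_mx 1 B i j = A i j.
Proof. by move=> ij; rewrite B1 mxE [_%:M i j]mxE (negPf ij) add0r. Qed.

Let B2E i j : i != j -> A i j = 0 -> coef_mx 2 B i j = \sum_k A i k * A k j.
Proof.
move=> ij Aij; rewrite B2 mxE [(_ + _ *: A) i j]mxE [(_ *: A) i j]mxE [_%:M i j]mxE.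
by rewrite (negPf ij) Aij mulr0 !add0r mxE.
Qed.

Let P0 i j : coef_mx 0 P i j = S i i *+ (i == j).
Proof.
by rewrite coefP B0 mxE; case: eqVneq => [->|_]; rewrite ?mulr1 ?mulr0.
Qed.

Let f0 : f 0 != 0.
Proof.
rewrite /f det_coef0 (_ : coef_mx 0 P = diag_mx (\row_i S i i)).
  by rewrite det_diag; apply/prodf_neq0 => i _; rewrite mxE lt0r_neq0.
by apply/matrixP=> i j; rewrite P0 !mxE.
Qed.

Let PQ m i j : \sum_(a < m.+1) (coef_mx a P *m coef_mx (m - a) Q) i j = f m *+ (i == j).
Proof.
rewrite -summxE -(coef_mxM m P Q) mul_mx_adj coef_mx_scalar.
by rewrite mxE.
Qed.

Let P0M (M : 'M[R]_n) i j : (coef_mx 0 P *m M) i j = S i i * M i j.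
Proof.
rewrite mxE (bigD1 i) //= P0 eqxx mulr1n big1 ?addr0 // => k ki.
by rewrite P0 eq_sym (negPf ki) mulr0n mul0r.
Qed.

Let Q0 i j : coef_mx 0 Q i j = f 0 / S i i *+ (i == j).
Proof.
have := PQ 0 i j; rewrite big_ord1 P0M subnn => h.
have s0 := lt0r_neq0 (Sdiag i); apply: (mulfI s0); rewrite h.
by case: (i == j); rewrite ?mulr0 // !mulr1n; field.
Qed.

Let Q1 i j : i != j -> coef_mx 1 Q i j = - f 0 * (S i j * A i j) / (S i i * S j j).
Proof.
move=> ij; have := PQ 1 i j; rewrite !big_ord_recl big_ord0 addr0 P0M (negPf ij) /= subn0 subnn.
rewrite [(coef_mx 1 P *m _) i j]mxE (bigD1 j) //= big1 ?addr0 => [|k kj]; last first.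
  by rewrite Q0 (negPf kj) mulr0n mulr0.
rewrite Q0 eqxx mulr1n coefP B1E // => h.
have s0 := lt0r_neq0 (Sdiag i); apply: (mulfI s0).
move/eqP: h; rewrite addr_eq0 => /eqP ->.
by have := lt0r_neq0 (Sdiag j) => t0; field; rewrite s0 t0.
Qed.

Lemma cov_diag_color i j : vc i = vc j -> S i i = S j j.
Proof.
move=> vij; have [_ _ h _] := Q_in_LG 0; have := h i j vij.
rewrite !Q0 !eqxx !mulr1n => /(mulfI f0)/invr_inj.
by [].
Qed.

Lemma cov_edge_color i j i' j' : adj i j -> adj i' j' -> ec i j = ec i' j' ->
  S i j / (S i i * S j j) = S i' j' / (S i' i' * S j' j').
Proof.
move=> ij ij' Dc; have [_ _ _ h] := Q_in_LG 1; have := h i j i' j' ij ij' Dc.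
rewrite !Q1 ?(adj_neq ij) ?(adj_neq ij') // /A !mxE ij ij' !mulr1.
rewrite -!mulrA => /(mulfI _); apply.
by rewrite oppr_eq0.
Qed.

(** This is the second coefficient of [P Q = det P] at a nonedge. There [Q_2] vanishes, and the
    diagonal entries of [P_1] and [Q_1], which involve determinants, meet the zero entries of [Q_1]
    and [P_1] at [i, j]. *)
Lemma cov_nonedge i j : i != j -> ~~ adj i j ->
  \sum_k A i k * A k j * (S i j - S i k * S k j / S k k) = 0.
Proof.
move=> ij nij; have := PQ 2 i j.
rewrite !big_ord_recl big_ord0 addr0 P0M (negPf ij) /= subn0 subnn subn1 /=.
have [_ h _ _] := Q_in_LG 2; rewrite (h i j ij nij) mulr0 add0r.
have [_ h1 _ _] := Q_in_LG 1; have {}h1 := h1 i j ij nij.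
have Aij : A i j = 0 by rewrite mxE (negPf nij).
have -> : (coef_mx 1 P *m coef_mx 1 Q) i j =
    - (f 0 / S j j) * \sum_k A i k * A k j * (S i k * S k j / S k k).
  rewrite mxE mulr_sumr; apply: eq_bigr => k _.
  have [->|ki] := eqVneq k i; first by rewrite h1 Aij !(mulr0, mul0r).
  have [->|kj] := eqVneq k j.
    by rewrite coefP B1E // Aij !(mulr0, mul0r).
  rewrite Q1 // coefP B1E 1?eq_sym //.
  have := lt0r_neq0 (Sdiag j); have := lt0r_neq0 (Sdiag k) => sk sj.
  by field; rewrite sk sj.
have -> : (coef_mx 2 P *m coef_mx 0 Q) i j = (f 0 / S j j) * \sum_k A i k * A k j * S i j.
  rewrite mxE (bigD1 j) //= big1 ?addr0 => [|k kj]; last first.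
    by rewrite Q0 (negPf kj) mulr0n mulr0.
  rewrite Q0 eqxx mulr1n coefP B2E // -mulr_suml.
  by rewrite mulrC; congr (_ * _); rewrite mulrC.
move=> h2; have c0 : f 0 / S j j != 0 by rewrite mulf_neq0 ?invr_eq0 ?(lt0r_neq0 (Sdiag j)).
apply: (mulfI c0); rewrite mulr0 -[RHS]h2 mulNr -mulrN -mulrDr; congr (_ * _).
by rewrite -sumrN -big_split; apply: eq_bigr => k _ /=; rewrite mulrBr addrC.
Qed.

End OneCovariance.

End HadamardExpansion.

(* y is the column of (1 - t A)^-1 restricted to walks avoiding l. *)
Lemma walk_system_ge0 (R : realFieldType) (n : nat) (A : 'M[R]_n) (t : R) (l j : 'I_n)
    (y : 'I_n -> R) : 0 < t -> t * n%:R < 1 ->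
  (forall u w, 0 <= A u w <= 1) -> y l = 0 ->
  (forall u, u != l -> y u = (u == j)%:R + t * \sum_w A u w * y w) ->
  forall u, 0 <= y u.
Proof.
move=> t0 tn A01 yl yE u.
case: (Order.TotalTheory.arg_minP y (erefl true : xpredT l)) => m _ ymin.
suff ym : 0 <= y m by apply: le_trans (ymin u isT).
rewrite leNgt; apply/negP => ym.
have ml : m != l by apply: contraTneq ym => ->; rewrite yl ltxx.
(* Minimum principle: a negative minimum would satisfy [y m >= t n (y m) > y m]. *)
have : t * n%:R * y m <= y m.
  rewrite {2}(yE m ml) ler_wpDl ?ler0n // -mulrA ler_wpM2l ?(ltW t0) //.
  rewrite mulr_natl -[X in y m *+ X](card_ord n) -sumr_const; apply: ler_sum => w _.
  have /andP[a0 a1] := A01 m w; have yw := ymin w isT.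
  have : A m w * y m <= A m w * y w by rewrite ler_wpM2l.
  by nra.
by nra.
Qed.

(** * Middle vertices of induced paths separate their ends *)

Section SeparationFromBinomials.
Variables (R : realType) (n : nat) (C : eqType) (G : cgraph n C).
Local Notation adj := (adj G).
Hypothesis gen : generated_by_binomials (in_IG (R := R) G).

Lemma binomial_middle_separates : middle_separates G.
Proof.
move=> i l j il lj ij nij.
have [e e0 pd] := @pencil_posdef R n (fun=> 1) (ecol_mx G (fun=> 1)) (fun=> ltr01).
(* Small enough for [1 - t A] to be positive definite and for the minimum principle, which asks for
   [t n < 1]. *)
pose t : R := Num.min (e / 2%:R) (n%:R + 1)^-1.
have n0 : 0 < n%:R + 1 :> R by rewrite ltr_wpDl.
have t0 : 0 < t by rewrite lt_min divr_gt0 //= invr_gt0.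
have te : t < e by rewrite gt_min ltr_pdivrMr // mulr_natr mulr2n ltrDl e0.
have tn : t * n%:R < 1.
  have : t <= (n%:R + 1)^-1 by rewrite ge_min lexx orbT.
  by rewrite -[_^-1]mul1r ler_pdivlMr // => ?; lra.
set A := ecol_mx G (fun=> 1) in pd.
have pK := pd t t0 te; have := pencil_in_LG G (fun=> 1) (fun=> 1) t.
rewrite /vcol_mx -/A => LK; set K := _ - t *: A in pK LK.
pose S := invmx K; have KS : K *m S = 1%:M by rewrite mulmxV // posdef_unit.
have SM : in_MG G S by exists K.
have Ks : K^T = K by case: LK.
have S0 u : S u u != 0 by apply/lt0r_neq0/posdef_diag_gt0/posdef_invmx.
have A01 u w : 0 <= A u w <= 1 by rewrite mxE; case: ifP; rewrite ?lexx ?ler01.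
have SE u v : S u v = (u == v)%:R + t * \sum_w A u w * S w v.
  have KE w : K u w = 1 *+ (u == w) - t * A u w by rewrite /K /A !mxE.
  have := mulmx_entry u v KS; under eq_bigr do rewrite KE mulrBl.
  rewrite sumrB (bigD1 u) //= eqxx mulr1n mul1r big1 ?addr0 => [|w wu]; last first.
    by rewrite eq_sym (negPf wu) mulr0n mul0r.
  under eq_bigr do rewrite -mulrA.
  by rewrite -mulr_sumr => <-; rewrite subrK.
(* Conditioning on [k] leaves the generating function of walks from [u] to [j] that avoid [k]:
   nonnegative, and positive once such a walk exists. *)
pose y k u := S u j - S u k * S k j / S k k.
have yk k : y k k = 0 by rewrite /y mulrAC divff // mul1r subrr.
have yE k u : u != k -> y k u = (u == j)%:R + t * \sum_w A u w * y k w.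
  move=> uk; rewrite /y {1}(SE u j) {1}(SE u k) (negPf uk) mulr0n add0r.
  under [in RHS]eq_bigr do rewrite mulrBr 2!mulrA.
  by rewrite sumrB -!mulr_suml; ring.
have y0 k u : 0 <= y k u by apply: (walk_system_ge0 t0 tn A01 (yk k) (yE k)).
have := cov_nonedge gen SM ij nij; rewrite -/A => /eqP.
rewrite psumr_eq0 => [/allP h|k _]; last first.
  rewrite mulr_ge0 ?y0 // mulr_ge0 //; [have := A01 i k | have := A01 k j];
  by case/andP.
have := h l (mem_index_enum l); rewrite /A [ecol_mx _ _ i l]mxE [ecol_mx _ _ l j]mxE il lj !mul1r.
move=> /eqP yi; apply/negP => cij.
have jl : j != l by rewrite eq_sym (adj_neq lj).
suff : 0 < y l i by rewrite /y yi ltxx.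
move: cij; rewrite conn_avoid_sym => cij.
have pos u : conn_avoid G l u j -> u != l -> 0 < y l u.
  case/connectP=> p; elim: p u => [|w p IH] u /=.
    move=> _ <- _; rewrite yE // eqxx ltr_pwDl // mulr_ge0 ?(ltW t0) // sumr_ge0 // => w _.
    by rewrite mulr_ge0 ?y0 //; case/andP: (A01 j w).
  case/andP=> /and3P[ul wl uw] pw Dj _; rewrite yE //.
  rewrite ltr_wpDl ?ler0n // mulr_gt0 // (bigD1 w) //= ltr_pwDl //.
    by rewrite mulr_gt0 ?IH // mxE uw.
  by rewrite sumr_ge0 // => v _; rewrite mulr_ge0 ?y0 //; case/andP: (A01 u v).
by apply: pos; rewrite 1?conn_avoid_sym // (adj_neq il).
Qed.

End SeparationFromBinomials.

(** * Covariances expanded to third order *)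

Section CoefCongruence.
Variable R : idomainType.
Implicit Types p q : {poly R}.

Definition coef_eq k p q := forall m, (m < k)%N -> p`_m = q`_m.

Lemma coef_eqM k p p' q q' : coef_eq k p p' -> coef_eq k q q' ->
  coef_eq k (p * q) (p' * q').
Proof.
move=> hp hq m mk; rewrite !coefM; apply: eq_bigr => i _.
have im : (i <= m)%N by rewrite -ltnS.
by rewrite hp ?hq //; [apply: leq_ltn_trans (leq_subr _ _) mk | apply: leq_ltn_trans mk].
Qed.

(** Modulo [X^k], a polynomial with nonzero constant term can be cancelled. *)
Lemma coef_eq_cancel k p q : p`_0 != 0 -> coef_eq k (p * q) 0 -> coef_eq k q 0.
Proof.
move=> p0 h m; have [N] := ubnP m; elim: N m => // N IH m mN mk.
have := h m mk; rewrite coefM big_ord_recl subn0 coef0 big1 ?addr0 => [|i _].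
  by move/eqP; rewrite mulf_eq0 (negPf p0) /= => /eqP ->.
rewrite [q`_ _]IH ?coef0 ?mulr0 //=; rewrite /bump /= add1n subnS.
  by have := ltn_ord i => ?; apply: leq_trans (ltnSE mN); rewrite prednK ?subn_gt0 ?leq_subr.
by apply: leq_ltn_trans mk; rewrite (leq_trans (leq_pred _)) // leq_subr.
Qed.

End CoefCongruence.

Section CovarianceExpansion.
Variables (R : realType) (n : nat) (C : eqType) (G : cgraph n C).
Local Notation adj := (adj G).
Local Notation vc := (vcol G).
Local Notation ec := (ec G).
Hypothesis gen : generated_by_binomials (in_IG (R := R) G).

Variables (th h : C -> R).
Hypothesis th0 : forall i, 0 < th (vc i).

Local Notation H := (ecol_mx G h).
Local Notation Th := (vcol_mx G th).

Lemma vcol_mxM (d : C -> R) (M : 'M[R]_n) i j : (vcol_mx G d *m M) i j = d (vc i) * M i j.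
Proof. by rewrite mul_diag_mx !mxE. Qed.

Lemma mulmx_vcol (d : C -> R) (M : 'M[R]_n) i j : (M *m vcol_mx G d) i j = M i j * d (vc j).
Proof. by rewrite mul_mx_diag !mxE. Qed.

Let d c := (th c)^-1.
Let d0 i : 0 < d (vc i). Proof. by rewrite invr_gt0. Qed.
Let B := \adj (pencil (vcol_mx G d) H).
Let kappa := \det (pencil (vcol_mx G d) H).

(** The coefficient of [t^m] in [(D - t H)^-1], where [D] is the inverse of [Th]. *)
Fixpoint walk_mx m : 'M[R]_n := if m is m'.+1 then Th *m H *m walk_mx m' else Th.

Let ThD : Th *m vcol_mx G d = 1%:M.
Proof.
apply/matrixP=> i j; rewrite mulmx_vcol !mxE; case: eqVneq => [->|]; last by rewrite mul0r.
by rewrite !mulr1n divff // lt0r_neq0.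
Qed.

Let BE m : coef_mx m B = \sum_(a < m.+1) kappa`_a *: walk_mx (m - a).
Proof.
elim: m => [|m IH].
  rewrite big_ord1 subnn /= -[LHS]mul1mx -ThD -mulmxA coef_pencil_adj0.
  by rewrite mul_mx_scalar.
rewrite big_ord_recr /= subnn -[LHS]mul1mx -ThD -mulmxA coef_pencil_adj.
rewrite mulmxDr mul_mx_scalar addrC; congr (_ + _).
rewrite IH mulmxA mulmx_sumr; apply: eq_bigr => a _.
by rewrite -scalemxAr subSn // -ltnS.
Qed.

(** Only coefficients up to [t^3] are used; up to that order [B] equals [kappa] times this
    truncation. *)
Let E i j : {poly R} := \poly_(m < 4) walk_mx m i j.

Let BcongE i j : coef_eq 4 (B i j) (kappa * E i j).
Proof.
move=> m m4; have /matrixP/(_ i j) := BE m; rewrite [LHS]mxE => ->.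
rewrite summxE coefM; apply: eq_bigr => a _; rewrite [LHS]mxE coef_poly.
by rewrite (leq_ltn_trans _ m4) // leq_subr.
Qed.

Let kappa0 : kappa`_0 != 0.
Proof.
rewrite /kappa det_coef0 coef_pencil det_diag; apply/prodf_neq0 => i _.
by rewrite mxE lt0r_neq0.
Qed.

Let coefE i j m : (m < 4)%N -> (E i j)`_m = walk_mx m i j.
Proof. by move=> m4; rewrite coef_poly m4. Qed.

Lemma walk1 i j : walk_mx 1 i j = th (vc i) * H i j * th (vc j).
Proof. by rewrite /= mulmx_vcol vcol_mxM. Qed.

Lemma walk2 i j : walk_mx 2 i j = th (vc i) * (H *m Th *m H) i j * th (vc j).
Proof. by rewrite /= -mulmxA vcol_mxM !mulmxA mulmx_vcol mulrA. Qed.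

Lemma walk3 i j : walk_mx 3 i j =
  th (vc i) * (H *m Th *m H *m Th *m H) i j * th (vc j).
Proof. by rewrite /= -mulmxA vcol_mxM !mulmxA mulmx_vcol mulrA. Qed.

Lemma walk_diag_color i j : vc i = vc j ->
  (H *m Th *m H) i i = (H *m Th *m H) j j.
Proof.
move=> vij; have [e e0 hS] := pencil_in_MG h d0.
have BB : B i i - B j j = 0.
  apply: (poly_eq0_near0 e0) => t t1 te; have [S SM SE] := hS t t1 te.
  have BS k l : (B k l).[t] = \det (vcol_mx G d - t *: H) * S k l.
    by have /matrixP/(_ k l) := SE; rewrite mxE [RHS]mxE.
  by rewrite hornerD hornerN !BS (cov_diag_color gen SM vij) subrr.
have : coef_eq 4 (kappa * (E i i - E j j)) 0.
  move=> m m4; rewrite mulrBr coefB -!BcongE // -coefB BB //.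
move/(coef_eq_cancel kappa0)/(_ 2 isT); rewrite coefB !coefE // coef0 !walk2 vij => /eqP.
rewrite subr_eq0 => /eqP /(mulIf _); rewrite lt0r_neq0 // => /(_ isT) /(mulfI _).
by rewrite lt0r_neq0 // => /(_ isT).
Qed.

(** Orders two and three of [s_ij / (s_ii s_jj)], with denominators cleared. The term subtracted at
    order three comes from the second-order parts of the two variances. *)
Lemma walk_edge_color i j i' j' : adj i j -> adj i' j' -> ec i j = ec i' j' ->
  (H *m Th *m H) i j = (H *m Th *m H) i' j' /\
  (H *m Th *m H *m Th *m H) i j -
    h (ec i j) * (th (vc i) * (H *m Th *m H) i i + th (vc j) * (H *m Th *m H) j j) =
  (H *m Th *m H *m Th *m H) i' j' -
    h (ec i' j') * (th (vc i') * (H *m Th *m H) i' i' + th (vc j') * (H *m Th *m H) j' j').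
Proof.
move=> ij ij' Dc; have [e e0 hS] := pencil_in_MG h d0.
have BB : B i j * (B i' i' * B j' j') - B i' j' * (B i i * B j j) = 0.
  apply: (poly_eq0_near0 e0) => t t1 te; have [S SM SE] := hS t t1 te.
  have BS k l : (B k l).[t] = \det (vcol_mx G d - t *: H) * S k l.
    by have /matrixP/(_ k l) := SE; rewrite mxE [RHS]mxE.
  have S0 k : S k k != 0.
    have [K [[Ks _ _ _] pK ->]] := SM.
    by apply/lt0r_neq0/posdef_diag_gt0/posdef_invmx.
  have := cov_edge_color gen SM ij ij' Dc.
  rewrite hornerD hornerN !hornerM !BS; set c := \det _ => Sc.
  have -> : S i j = S i' j' / (S i' i' * S j' j') * (S i i * S j j).
    by rewrite -Sc mulfVK // mulf_neq0.
  by field; rewrite !S0.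
have : coef_eq 4 (kappa * (kappa * kappa) *
    (E i j * (E i' i' * E j' j') - E i' j' * (E i i * E j j))) 0.
  move=> m m4.
  have R1 (x y z x' y' z' : 'I_n) :
      coef_eq 4 (B x x' * (B y y' * B z z')) (kappa * E x x' * (kappa * E y y' * (kappa * E z z'))).
    by do 2![apply: coef_eqM => //].
  have -> : kappa * (kappa * kappa) *
      (E i j * (E i' i' * E j' j') - E i' j' * (E i i * E j j)) =
      kappa * E i j * (kappa * E i' i' * (kappa * E j' j')) -
      kappa * E i' j' * (kappa * E i i * (kappa * E j j)) by ring.
  by rewrite coefB -!R1 // -coefB BB.
have k3 : (kappa * (kappa * kappa))`_0 != 0.
  by rewrite !coef0M !mulf_neq0.
move/(coef_eq_cancel k3) => hq.
have E0 k l : walk_mx 0 k l = th (vc k) *+ (k == l) by rewrite !mxE.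
have E1 k : walk_mx 1 k k = 0 by rewrite walk1 ecol_mx_diag mulr0 mul0r.
have nij := negPf (adj_neq ij); have nij' := negPf (adj_neq ij').
have t1 := lt0r_neq0 (th0 i); have t2 := lt0r_neq0 (th0 j).
have t3 := lt0r_neq0 (th0 i'); have t4 := lt0r_neq0 (th0 j').
have Hij : H i j = h (ec i j) by rewrite mxE ij.
have Hij' : H i' j' = h (ec i j) by rewrite mxE ij' Dc.
have c2 : (H *m Th *m H) i j = (H *m Th *m H) i' j'.
  have := hq 2 isT; rewrite coefB !coefM !big_ord_recl !big_ord0 /= !coefM.
  rewrite !big_ord_recl !big_ord0 /= /bump /= ?subn0 ?subnn ?add1n ?subSS ?subn0 !coefE //.
  rewrite coef0 !E0 !E1 !walk2 !eqxx nij nij' !mulr1n !mulr0n.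
  set X := (_ *m H) i j; set X' := (_ *m H) i' j'.
  move=> eq0.
  have : th (vc i) * th (vc j) * th (vc i') * th (vc j') * (X - X') = 0.
    rewrite -[RHS]eq0; ring.
  by move/eqP; rewrite !mulf_eq0 (negPf t1) (negPf t2) (negPf t3) (negPf t4) /= subr_eq0 => /eqP.
split=> //.
have := hq 3 isT; rewrite coefB !coefM !big_ord_recl !big_ord0 /= !coefM.
rewrite !big_ord_recl !big_ord0 /= /bump /= ?subn0 ?subnn ?add1n ?subSS ?subn0 !coefE //.
rewrite coef0 !E0 !E1 !walk2 !walk3 !walk1 !eqxx nij nij' !mulr1n !mulr0n Hij Hij' -Dc.
pose W2 := H *m Th *m H; pose W3 := H *m Th *m H *m Th *m H; rewrite -/W3 -/W2.
set X := W3 i j; set X' := W3 i' j'.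
set Y1 := W2 i i; set Y2 := W2 j j; set Y3 := W2 i' i'; set Y4 := W2 j' j'.
set Z := W2 i j; set Z' := W2 i' j'.
set x := th (vc i); set y := th (vc j); set x' := th (vc i'); set y' := th (vc j').
move=> eq0; apply/eqP; rewrite -subr_eq0; apply/eqP.
have : x * y * x' * y' * (X - h (ec i j) * (x * Y1 + y * Y2) - (X' - h (ec i j) * (x' * Y3 + y' * Y4))) = 0.
  rewrite -[RHS]eq0; ring.
by move/eqP; rewrite !mulf_eq0 (negPf t1) (negPf t2) (negPf t3) (negPf t4) /= => /eqP.
Qed.

End CovarianceExpansion.

(** * Regularity from the expansion coefficients *)

Section BinomialRegularity.
Variables (R : realType) (n : nat) (C : eqType) (G : cgraph n C).
Local Notation adj := (adj G).
Local Notation vc := (vcol G).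
Local Notation ec := (ec G).
Local Notation block := (block G).
Local Notation common := (common G).
Hypothesis gen : generated_by_binomials (in_IG (R := R) G).

Local Notation H h := (ecol_mx (R := R) G h).

Lemma walk2E (th h : C -> R) i j :
  (H h *m vcol_mx G th *m H h) i j = \sum_l H h i l * th (vc l) * H h l j.
Proof. by rewrite mxE; apply: eq_bigr => l _; rewrite mulmx_vcol. Qed.

Definition color_ind (a c : C) : R := (c == a)%:R.

(** With [h] the indicator of [a] and unit weights, closed walks of length two count the [a]-edges
    at a vertex. *)
Lemma binomial_vertex_regular : vertex_regular G.
Proof.
apply/vertex_regularP => i j a vij.
have := @walk_diag_color _ _ _ G gen (fun=> 1) (color_ind a) (fun=> ltr01) i j vij.
rewrite !walk2E.
have E x : \sum_l H (color_ind a) x l * 1 * H (color_ind a) l x = #|nbrs_col G x a|%:R.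
  rewrite -sum1_card natr_sum [RHS]big_mkcond /=; apply: eq_bigr => l _.
  rewrite ecol_mx_sym [in X in _ * X]ecol_mx_sym mulr1 !mxE inE adj_sym ec_sym /color_ind.
  by case: (adj x l); case: eqP; rewrite /= ?mulr0 ?mulr1.
by rewrite !E => /eqP; rewrite eqr_nat => /eqP.
Qed.

(** Polarization in [h] of the second-order identity. *)
Lemma cross_walk_color (th h g : C -> R) i j i' j' : (forall v, 0 < th (vc v)) ->
  adj i j -> adj i' j' -> ec i j = ec i' j' ->
  \sum_l th (vc l) * (H h i l * H g l j + H g i l * H h l j) =
  \sum_l th (vc l) * (H h i' l * H g l j' + H g i' l * H h l j').
Proof.
move=> th0 ij ij' Dc.
have W f := proj1 (@walk_edge_color _ _ _ G gen th f th0 i j i' j' ij ij' Dc).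
have E x y : \sum_l th (vc l) * (H h x l * H g l y + H g x l * H h l y) =
    (H (fun c => h c + g c) *m vcol_mx G th *m H (fun c => h c + g c)) x y -
    (H h *m vcol_mx G th *m H h) x y - (H g *m vcol_mx G th *m H g) x y.
  rewrite !walk2E -!sumrB; apply: eq_bigr => l _; rewrite !mxE.
  by case: (adj x l); case: (adj l y); ring.
by rewrite !E !W.
Qed.

Hypothesis bg : middle_separates G.

(** The part of the closed two-step walks at [i] that stays in the block of [i j]: a weighted block
    degree. *)
Definition block_delta (th h : C -> R) i j : R :=
  \sum_(l in block i j) H h i l ^+ 2 * th (vc l).

Lemma sum_nbr_split (F : 'I_n -> R) i j : adj i j ->
  (forall l, ~~ adj i l -> F l = 0) ->
  \sum_l F l = \sum_(l in common i j) F l + F j +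
    (\sum_(l | adj i l && (l \notin block i j)) F l).
Proof.
move=> ij F0; rewrite (bigID (mem (block i j))) /=; congr (_ + _); last first.
  rewrite big_mkcond [RHS]big_mkcond; apply: eq_bigr => l _ /=.
  by have [il|/F0 ->] := boolP (adj i l); case: ifP.
rewrite (bigD1 j) ?mem_block_r //= addrC; congr (_ + _).
rewrite big_mkcond [RHS]big_mkcond; apply: eq_bigr => l _ /=.
have [il|nil] := boolP (adj i l); last first.
  by rewrite F0 // if_same; case: ifP.
rewrite block_common //; case: eqVneq => [->|]; rewrite ?andbF ?andbT //=.
by rewrite inE adjxx andbF.
Qed.

(** [l i j] is an induced path, so [i] separates its ends and is the only common neighbor of [l] and
    [j]. *)
Lemma outside_walk2 (th h : C -> R) i j l : adj i j -> adj i l -> l \notin block i j ->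
  (H h *m vcol_mx G th *m H h) l j = H h l i * th (vc i) * H h i j.
Proof.
move=> ij il lB; rewrite walk2E (bigD1 i) //= big1 ?addr0 // => m mi.
have [lm|nlm] := boolP (adj l m); last by rewrite mxE (negPf nlm) !mul0r.
have [mj|nmj] := boolP (adj m j); last by rewrite [H h m j]mxE (negPf nmj) !mulr0.
move: lB; rewrite block_nbr // negb_or => /andP[lj nlj].
have /negP[] := bg (etrans (adj_sym _ _ _) il) ij lj nlj.
apply: (@conn_avoid_trans _ _ _ _ m); apply: conn_avoid1 => //; rewrite eq_sym.
  exact: adj_neq il.
exact: adj_neq ij.
Qed.

Lemma block_delta_full (th h : C -> R) i j : adj i j ->
  (H h *m vcol_mx G th *m H h) i i = block_delta th h i j +
     \sum_(l | adj i l && (l \notin block i j)) H h i l ^+ 2 * th (vc l).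
Proof.
move=> ij; rewrite walk2E (bigID (mem (block i j))) /=; congr (_ + _).
  by apply: eq_bigr => l _; rewrite (ecol_mx_sym _ _ l); ring.
rewrite big_mkcond [RHS]big_mkcond; apply: eq_bigr => l _ /=.
have [il|nil] := boolP (adj i l); case: ifP => // _.
  by rewrite (ecol_mx_sym _ _ l); ring.
by rewrite mxE (negPf nil) !mul0r.
Qed.

(** On edges, the two-step matrix [W2] is a function [y] of the color. In the three-step sum, walks
    through common neighbors therefore form a cross walk of [h] and [y], already invariant, and
    walks leaving the block collapse onto its vertices; subtracting both leaves the weighted block
    degrees. *)
Lemma block_delta_color (th h : C -> R) i j i' j' : (forall v, 0 < th (vc v)) ->
  adj i j -> adj i' j' -> ec i j = ec i' j' ->
  h (ec i j) * (th (vc i) * block_delta th h i j + th (vc j) * block_delta th h j i) =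
  h (ec i j) * (th (vc i') * block_delta th h i' j' + th (vc j') * block_delta th h j' i').
Proof.
move=> th0 ij ij' Dc.
pose W2 := H h *m vcol_mx G th *m H h.
have [y hy] : exists y : C -> R, forall p : 'I_n * 'I_n,
    adj p.1 p.2 -> W2 p.1 p.2 = y (ec p.1 p.2).
  apply: factor_through => p q pa qa Dpq.
  by have [] := @walk_edge_color _ _ _ G gen th h th0 _ _ _ _ pa qa Dpq.
have W2y k l : adj k l -> W2 k l = H y k l by move=> kl; rewrite (hy (k, l)) // mxE kl.
have half k l : adj k l -> \sum_m H h k m * th (vc m) * W2 m l =
    \sum_m th (vc m) * (H h k m * H y m l) + H h k l * th (vc l) * W2 l l +
    H h k l * th (vc k) * (W2 k k - block_delta th h k l).
  move=> kl; rewrite (sum_nbr_split kl) => [|m nkm]; last by rewrite mxE (negPf nkm) !mul0r.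
  congr (_ + _ + _).
    rewrite [RHS](bigID (mem (common k l))) /= [X in _ + X]big1 ?addr0 => [|m]; last first.
      rewrite inE negb_and => /orP[nkm|nlm]; first by rewrite mxE (negPf nkm) mul0r mulr0.
      by rewrite [H y m l]mxE adj_sym (negPf nlm) !mulr0.
    apply: eq_bigr => m; rewrite inE => /andP[km lm].
    by rewrite W2y 1?adj_sym //; ring.
  rewrite /W2 (block_delta_full th h kl) addrC addKr mulr_sumr.
  apply: eq_bigr => m /andP[km mB]; rewrite (outside_walk2 _ _ kl km mB).
  by rewrite (ecol_mx_sym _ _ m); ring.
have W3 k l : adj k l ->
  ((H h *m vcol_mx G th *m H h *m vcol_mx G th *m H h) k l) *+ 2 =
  \sum_m th (vc m) * (H h k m * H y m l + H y k m * H h m l) +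
  h (ec k l) * (th (vc k) * W2 k k + th (vc l) * W2 l l) *+ 2 -
  h (ec k l) * (th (vc k) * block_delta th h k l + th (vc l) * block_delta th h l k).
  move=> kl; have lk : adj l k by rewrite adj_sym.
  have E1 : (H h *m vcol_mx G th *m H h *m vcol_mx G th *m H h) k l =
      \sum_m H h k m * th (vc m) * W2 m l.
    rewrite -!mulmxA mulmxA mxE; apply: eq_bigr => m _.
    by rewrite mulmx_vcol /W2 !mulmxA.
  have W2s a b : W2 a b = W2 b a.
    by rewrite /W2 !walk2E; apply: eq_bigr => m _; rewrite (ecol_mx_sym _ _ a) (ecol_mx_sym _ _ _ b); ring.
  have E2 : (H h *m vcol_mx G th *m H h *m vcol_mx G th *m H h) k l =
      \sum_m H h l m * th (vc m) * W2 m k.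
    rewrite mxE; apply: eq_bigr => m _; rewrite mulmx_vcol -/W2 (W2s m).
    by rewrite (ecol_mx_sym _ _ m); ring.
  rewrite mulr2n {1}E1 E2 !half // (ecol_mx_sym _ _ l k).
  have -> : H h k l = h (ec k l) by rewrite mxE kl.
  have -> : \sum_m th (vc m) * (H h k m * H y m l + H y k m * H h m l) =
      \sum_m th (vc m) * (H h k m * H y m l) + \sum_m th (vc m) * (H h l m * H y m k).
    rewrite -big_split; apply: eq_bigr => m _ /=.
    by rewrite (ecol_mx_sym _ _ l) (ecol_mx_sym _ _ m k); ring.
  by rewrite mulr2n; ring.
have [_ e3] := @walk_edge_color _ _ _ G gen th h th0 i j i' j' ij ij' Dc.
have cr := cross_walk_color h y th0 ij ij' Dc.
have := W3 i j ij; have := W3 i' j' ij'; rewrite -cr -Dc !mulr2n.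
rewrite -Dc in e3; move: e3; rewrite -/W2.
set X := (_ *m H h) i j; set X' := (_ *m H h) i' j'.
move: (\sum_m _) => S; lra.
Qed.

Definition block_form (a : C) (th : C -> R) i j : R :=
  th (vc i) * block_delta th (color_ind a) i j + th (vc j) * block_delta th (color_ind a) j i.

(* block_form is quadratic in th, so its values at three positive translates of
   th determine its value at th. *)
Lemma block_form_color (th : C -> R) i j i' j' : adj i j -> adj i' j' -> ec i j = ec i' j' ->
  block_form (ec i j) th i j = block_form (ec i j) th i' j'.
Proof.
move=> ij ij' Dc; set a := ec i j.
(* Larger than every weight in absolute value, so the translates by positive multiples of [c] are
   positive. *)
pose c := 1 + \sum_v `|th (vc v)|.
have cv v : `|th (vc v)| < c.
  by rewrite /c (bigD1 v) //= addrCA ltr_pwDr // ltr_pwDl // sumr_ge0.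
have c0 : 0 < c by rewrite /c ltr_pwDl // sumr_ge0.
have pos k v : (0 < k)%N -> 0 < th (vc v) + c *+ k.
  move=> k0; have := cv v; rewrite ltr_norml => /andP[c1 _].
  by rewrite -(prednK k0) mulrS addrA ltr_pwDl ?mulrn_wge0 ?(ltW c0) // -ltrBlDr sub0r.
have F k : (0 < k)%N -> block_form a (fun x => th x + c *+ k) i j =
    block_form a (fun x => th x + c *+ k) i' j'.
  move=> k0; have := @block_delta_color (fun x => th x + c *+ k) (color_ind a) _ _ _ _
    (fun v => pos k v k0) ij ij' Dc.
  have -> : color_ind a (ec i j) = 1 by rewrite /color_ind eqxx.
  by rewrite !mul1r.
(* The third finite difference of a quadratic polynomial vanishes. *)
have E x y : block_form a th x y = block_form a (fun x => th x + c *+ 3) x y -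
    3%:R * block_form a (fun x => th x + c *+ 2) x y +
    3%:R * block_form a (fun x => th x + c *+ 1) x y.
  have B k u v : block_delta (fun x => th x + c *+ k) (color_ind a) u v =
      block_delta th (color_ind a) u v + c *+ k * \sum_(l in block u v) H (color_ind a) u l ^+ 2.
    by rewrite mulr_sumr -big_split; apply: eq_bigr => l _ /=; rewrite mulrDr (mulrC _ (c *+ k)).
  by rewrite /block_form !B; ring.
by rewrite !E !F.
Qed.

(** Polarizing in the weights isolates the [a]-edges at [i] or [j], inside the block, whose ends
    have colors [p] and [q]. *)
Lemma block_form_polar (a p q : C) i j :
  block_form a (fun c => color_ind p c + color_ind q c) i j -
  block_form a (color_ind p) i j - block_form a (color_ind q) i j =
  (\sum_(l in block i j) H (color_ind a) i l ^+ 2 *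
     (color_ind p (vc i) * color_ind q (vc l) + color_ind q (vc i) * color_ind p (vc l))) +
  (\sum_(l in block j i) H (color_ind a) j l ^+ 2 *
     (color_ind p (vc j) * color_ind q (vc l) + color_ind q (vc j) * color_ind p (vc l))).
Proof.
rewrite /block_form /block_delta.
have E u v : \sum_(l in block u v) H (color_ind a) u l ^+ 2 *
     (color_ind p (vc u) * color_ind q (vc l) + color_ind q (vc u) * color_ind p (vc l)) =
  color_ind p (vc u) * (\sum_(l in block u v) H (color_ind a) u l ^+ 2 * color_ind q (vc l)) +
  color_ind q (vc u) * (\sum_(l in block u v) H (color_ind a) u l ^+ 2 * color_ind p (vc l)).
  by rewrite !mulr_sumr -big_split; apply: eq_bigr => l _ /=; ring.
have E' u v : \sum_(l in block u v) H (color_ind a) u l ^+ 2 *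
     (color_ind p (vc l) + color_ind q (vc l)) =
  (\sum_(l in block u v) H (color_ind a) u l ^+ 2 * color_ind p (vc l)) +
  (\sum_(l in block u v) H (color_ind a) u l ^+ 2 * color_ind q (vc l)).
  by rewrite -big_split; apply: eq_bigr => l _ /=; ring.
by rewrite !E !E'; ring.
Qed.

Lemma color_ind_ge0 p c : 0 <= color_ind p c.
Proof. exact: ler0n. Qed.

(** The edges [i j] and [i l] share their block, so the terms at [i] cancel when their block forms
    are compared. What remains is an identity for all weights; if [j] and [l] differed in color, a
    weight vanishing on a suitable one of these colors would make one side zero and the other
    positive. *)
Lemma adjacent_same_color_type a i j l : adj i j -> adj i l -> l \in block i j ->
  ec i j = a -> ec i l = a -> vc j = vc l.
Proof.
move=> ij il lB ija ila; apply/eqP; apply: contraT => jl.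
have ji : adj j i by rewrite adj_sym.
have li : adj l i by rewrite adj_sym.
have iB := mem_block_l ij.
have Bil : block i l = block i j by rewrite (block_eq bg ij iB lB (adj_neq il)).
have eqF th : th (vc j) * block_delta th (color_ind a) j i =
              th (vc l) * block_delta th (color_ind a) l i.
  have := @block_form_color th i j i l ij il (etrans ija (esym ila)); rewrite ija /block_form.
  by rewrite /block_delta Bil => /addrI.
pose th c : C -> R := fun x => (x != c)%:R.
have pos c k m : adj k m -> ec k m = a -> vc m != c -> vc k != c ->
    0 < th c (vc k) * block_delta (th c) (color_ind a) k m.
  move=> km kma mc kc; rewrite /th kc mul1r /block_delta (bigD1 m) ?mem_block_r //=.
  rewrite ltr_pwDl //; first by rewrite mxE km /color_ind kma eqxx expr1n mul1r mc ltr01.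
  by rewrite sumr_ge0 // => v _; rewrite mulr_ge0 ?sqr_ge0 ?ler0n.
have zero c k m : vc k = c -> th c (vc k) * block_delta (th c) (color_ind a) k m = 0.
  by move=> ->; rewrite /th eqxx mul0r.
have [vil|vil] := eqVneq (vc i) (vc l).
  have := pos (vc j) l i li (etrans (ec_sym _ _ _) ila).
  rewrite -eqF zero // ltxx vil eq_sym jl => h; exact: h.
have := pos (vc l) j i ji (etrans (ec_sym _ _ _) ija) vil jl.
by rewrite eqF zero // ltxx.
Qed.

(** The polarized form for the end colors of [i j] is positive there, hence at [i' j']. So some
    [a]-edge at [i'] or [j'] in the same block has these end colors, and [adjacent_same_color_type]
    passes them on to [i' j']. *)
Lemma binomial_edge_regular : edge_regular G.
Proof.
apply/edge_regularP => i j i' j' ij ij' Dc; set a := ec i j in Dc.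
set p := vc i; set q := vc j.
have Bij := block_form_polar a p q i j; have Bij' := block_form_polar a p q i' j'.
have ge0 u v : 0 <= \sum_(l in block u v) H (color_ind a) u l ^+ 2 *
     (color_ind p (vc u) * color_ind q (vc l) + color_ind q (vc u) * color_ind p (vc l)).
  apply: sumr_ge0 => l _; rewrite mulr_ge0 ?sqr_ge0 // addr_ge0 // mulr_ge0 //; exact: color_ind_ge0.
have pos : 0 < \sum_(l in block i j) H (color_ind a) i l ^+ 2 *
     (color_ind p (vc i) * color_ind q (vc l) + color_ind q (vc i) * color_ind p (vc l)).
  rewrite (bigD1 j) ?mem_block_r //= ltr_pwDl //.
    rewrite mxE ij /color_ind !eqxx expr1n !mul1r ltr_pwDl // mulr_ge0 //; exact: ler0n.
  apply: sumr_ge0 => l _; rewrite mulr_ge0 ?sqr_ge0 // addr_ge0 // mulr_ge0 //; exact: color_ind_ge0.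
have F th := @block_form_color th i j i' j' ij ij' Dc.
rewrite -/a in F; rewrite !F Bij' in Bij.
have find u v : 0 < \sum_(l in block u v) H (color_ind a) u l ^+ 2 *
     (color_ind p (vc u) * color_ind q (vc l) + color_ind q (vc u) * color_ind p (vc l)) ->
   exists l, [/\ l \in block u v, adj u l, ec u l = a &
     (vc u = p /\ vc l = q) \/ (vc u = q /\ vc l = p)].
  move=> h; have [/existsP[l /and4P[lB ul /eqP ula /orP ty]]|] := boolP [exists l,
    [&& l \in block u v, adj u l, ec u l == a &
     ((vc u == p) && (vc l == q)) || ((vc u == q) && (vc l == p))]].
    exists l; split=> //; case: ty => /andP[/eqP-> /eqP->]; [by left | by right].
  move=> /existsPn nex; move: h; rewrite big1 ?ltxx // => l lB.
  have := nex l; rewrite lB /= mxE /color_ind.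
  case: (adj u l); last by rewrite expr0n mul0r.
  case: (ec u l == a); last by rewrite expr0n mul0r.
  case: (vc u == p); case: (vc l == q); case: (vc u == q); case: (vc l == p) => //= _;
  by rewrite ?mulr0 ?mul0r ?addr0 ?mulr0.
have ji' : adj j' i' by rewrite adj_sym.
have ec' : ec i' j' = a by rewrite -Dc.
have tot : 0 < \sum_(l in block i' j') H (color_ind a) i' l ^+ 2 *
     (color_ind p (vc i') * color_ind q (vc l) + color_ind q (vc i') * color_ind p (vc l)) +
   \sum_(l in block j' i') H (color_ind a) j' l ^+ 2 *
     (color_ind p (vc j') * color_ind q (vc l) + color_ind q (vc j') * color_ind p (vc l)).
  by rewrite Bij ltr_pwDl.
have [h|h] := ltP 0 (\sum_(l in block i' j') H (color_ind a) i' l ^+ 2 *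
     (color_ind p (vc i') * color_ind q (vc l) + color_ind q (vc i') * color_ind p (vc l))).
  have [l [lB il ila ty]] := find _ _ h.
  rewrite (adjacent_same_color_type ij' il lB ec' ila).
  by case: ty => -[-> ->]; [left | right].
have h' : 0 < \sum_(l in block j' i') H (color_ind a) j' l ^+ 2 *
     (color_ind p (vc j') * color_ind q (vc l) + color_ind q (vc j') * color_ind p (vc l)).
  by apply: lt_le_trans tot _; rewrite gerDr.
have [l [lB jl jla ty]] := find _ _ h'.
rewrite (adjacent_same_color_type ji' jl lB (etrans (ec_sym _ _ _) ec') jla).
by case: ty => -[-> ->]; [right | left].
Qed.

(** The weights [1] and [1 + color_ind c] are both positive, and their difference selects common
    neighbors of color [c]. For [b = b'] the cross walks count each of these twice. *)
Lemma common_count_color i j i' j' (b b' c : C) : adj i j -> adj i' j' -> ec i j = ec i' j' ->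
  let N x y := #|[set l in common x y | (vc l == c) &&
     (((ec x l == b) && (ec y l == b')) || ((ec x l == b') && (ec y l == b)))]| in
  N i j = N i' j'.
Proof.
move=> ij ij' Dc N.
have E x y : (if b == b' then 2 else 1)%:R * (N x y)%:R =
  (\sum_l (1 + color_ind c (vc l)) * (H (color_ind b) x l * H (color_ind b') l y +
                          H (color_ind b') x l * H (color_ind b) l y)) -
  (\sum_l 1 * (H (color_ind b) x l * H (color_ind b') l y +
                          H (color_ind b') x l * H (color_ind b) l y)).
  rewrite -sumrB /N -sum1_card natr_sum mulr_sumr big_mkcond /=; apply: eq_bigr => l _.
  rewrite !mxE !inE (adj_sym _ l) (ec_sym _ l) /color_ind.
  case: (adj x l) => /=; last by rewrite !(mulr0, mul0r, addr0, subrr).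
  case: (adj y l) => /=; last by rewrite !(mulr0, mul0r, addr0, subrr).
  have [<-|bb] := eqVneq b b'.
    by case: (ec x l == b); case: (ec y l == b); case: (vc l == c) => /=; ring.
  have [xb|xb] := eqVneq (ec x l) b; have [yb|yb] := eqVneq (ec y l) b;
  rewrite ?xb ?yb ?(negPf bb) //=;
  by case: (vc l == c); case: (ec x l == b'); case: (ec y l == b') => /=; ring.
have p1 v : 0 < 1 + color_ind c (vc v) by rewrite ltr_pwDl // color_ind_ge0.
have := E i j; rewrite (@cross_walk_color (fun x => 1 + color_ind c x) _ _ _ _ _ _ p1 ij ij' Dc).
rewrite (@cross_walk_color (fun=> 1) _ _ _ _ _ _ (fun=> ltr01) ij ij' Dc) -E.
move/mulfI => h; apply/eqP; rewrite -(eqr_nat R); apply/eqP/h.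
by rewrite pnatr_eq0; case: ifP.
Qed.

End BinomialRegularity.

(** * From color counts to matchings of triangles *)

Lemma key_matching (T : finType) (K : eqType) (k k' : T -> K) (A A' : {set T}) :
  (forall x, #|[set t in A | k t == x]| = #|[set t in A' | k' t == x]|) ->
  exists f : T -> T, [/\ {in A &, injective f}, f @: A = A' &
    {in A, forall t, k' (f t) = k t}].
Proof.
have [m] := ubnP #|A|; elim: m A A' => // m IH A A' ltm cnt.
have [A0|/set0Pn[t tA]] := eqVneq A set0.
  have A'0 : A' = set0.
    apply/setP=> u; rewrite inE; apply/negP => uA'; have := cnt (k' u).
    rewrite A0 (eq_card0 (A := [set t in set0 | _])) => [|v]; last by rewrite !inE.
    by move/esym/eqP; rewrite cards_eq0 => /eqP/setP/(_ u); rewrite !inE uA' eqxx.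
  by exists id; rewrite A0 A'0 imset0; split=> // u; rewrite inE.
have : (0 < #|[set u in A' | k' u == k t]|)%N.
  by rewrite -cnt; apply/card_gt0P; exists t; rewrite inE tA eqxx.
case/card_gt0P=> t'; rewrite inE => /andP[tA' /eqP kt'].
have cnt' x : #|[set u in A :\ t | k u == x]| = #|[set u in A' :\ t' | k' u == x]|.
  have E (B : {set T}) (h : T -> K) b : b \in B ->
      #|[set u in B | h u == x]| = ((h b == x) + #|[set u in B :\ b | h u == x]|)%N.
    move=> bB; rewrite (cardsD1 b [set u in B | _]) !inE bB; congr (_ + _)%N.
    by apply: eq_card => u; rewrite !inE; case: (u == b).
  by have := cnt x; rewrite (E A k t tA) (E A' k' t' tA') kt' => /addnI.
have [|f [finj fE fk]] := IH (A :\ t) (A' :\ t') _ cnt'.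
  by move: ltm; rewrite (cardsD1 t A) tA.
have fin u : u \in A -> u != t -> f u \in A' :\ t'.
  by move=> uA ut; rewrite -fE imset_f // !inE ut.
exists (fun u => if u == t then t' else f u); split.
- move=> u v uA vA; case: (eqVneq u t) => [->|ut]; case: (eqVneq v t) => [->|vt] //.
  + by move=> D; have := fin v vA vt; rewrite -D !inE eqxx.
  + by move=> D; have := fin u uA ut; rewrite D !inE eqxx.
  by apply: finj; rewrite !inE ?ut ?vt.
- apply/setP=> u; apply/imsetP/idP => [[v vA ->]|uA'].
    by case: eqVneq => // vt; have := fin v vA vt; rewrite inE => /andP[].
  have [->|ut'] := eqVneq u t'; first by exists t; rewrite ?eqxx.
  have : u \in f @: (A :\ t) by rewrite fE !inE ut'.
  by case/imsetP=> v; rewrite !inE => /andP[vt vA] ->; exists v; rewrite // (negPf vt).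
by move=> u uA; case: eqVneq => [->//|ut]; apply: fk; rewrite !inE ut.
Qed.

Section EdgeTriangles.
Variables (n : nat) (C : eqType) (G : cgraph n C).
Local Notation adj := (adj G).
Local Notation vc := (vcol G).
Local Notation ec := (ec G).
Local Notation common := (common G).

(** By edge-regularity, the three edge colors and the color of the apex determine the colors of [i]
    and [j]. *)
Lemma color_iso_of i j l i' j' l' : edge_regular G ->
  adj i j -> adj i' j' -> l \in common i j -> l' \in common i' j' ->
  vc l' = vc l -> ec i j = ec i' j' -> ec i l = ec i' l' -> ec j l = ec j' l' ->
  color_iso G (l |: [set i; j]) (l' |: [set i'; j']).
Proof.
move=> /edge_regularP er ij ij'; rewrite !inE => /andP[il jl] /andP[il' jl'] vl eij eil ejl.
have vi : vc i' = vc i.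
  case: (er _ _ _ _ ij ij' eij) => -[h1 h2] //; case: (er _ _ _ _ il il' eil) => -[h3 h4]; congruence.
have vj : vc j' = vc j.
  case: (er _ _ _ _ ij ij' eij) => -[h1 h2] //; case: (er _ _ _ _ jl jl' ejl) => -[h3 h4]; congruence.
pose f x := if x == l then l' else if x == i then i' else j'.
have li : (i == l) = false by apply/negbTE; exact: (adj_neq il).
have lj : (j == l) = false by apply/negbTE; exact: (adj_neq jl).
have ji : (j == i) = false by rewrite eq_sym; apply/negbTE; exact: (adj_neq ij).
have fl : f l = l' by rewrite /f eqxx.
have fi : f i = i' by rewrite /f li eqxx.
have fj : f j = j' by rewrite /f lj ji.
have nli := adj_neq il'; have nlj := adj_neq jl'; have nij := adj_neq ij'.
exists f; split.
- move=> x y; rewrite !inE => /or3P[]/eqP-> /or3P[]/eqP->; rewrite ?fl ?fi ?fj // => /eqP;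
    by rewrite 1?eq_sym ?(negPf nli) ?(negPf nlj) ?(negPf nij) // eq_sym ?(negPf nli) ?(negPf nlj) ?(negPf nij).
- by rewrite !imsetU !imset_set1 fl fi fj.
- by move=> x; rewrite !inE => /or3P[]/eqP->; rewrite ?fl ?fi ?fj.
rewrite /ec in eij eil ejl *; move=> x y; rewrite !inE => /or3P[]/eqP-> /or3P[]/eqP->;
  rewrite ?eqxx // ?fl ?fi ?fj // => _; rewrite // setUC // 1?[in RHS]setUC //.
Qed.

Lemma edge_triangle_regular_of_counts : edge_regular G ->
  (forall i j i' j' (b b' c : C), adj i j -> adj i' j' -> ec i j = ec i' j' ->
    let N x y := #|[set l in common x y | (vc l == c) &&
       (((ec x l == b) && (ec y l == b')) || ((ec x l == b') && (ec y l == b)))]| in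
    N i j = N i' j') ->
  edge_triangle_regular G.
Proof.
move=> er cnt e e' /edge_ends[i [j [-> ij]]] /edge_ends[i' [j' [-> ij']]] Dc.
pose cs := [seq ecol G e | e in edges G].
have csP x y : adj x y -> ec x y \in cs by move=> xy; apply: image_f.
(* Colors carry no order, so unordered pairs are normalized by position in the list [cs]. *)
pose srt (b b' : C) := if (index b cs <= index b' cs)%N then (b, b') else (b', b).
pose key x y l := (vc l, srt (ec x l) (ec y l)).
have keyE x y c b b' : [set l in common x y | key x y l == (c, (b, b'))] =
    if (index b cs <= index b' cs)%N then
      [set l in common x y | (vc l == c) &&
       (((ec x l == b) && (ec y l == b')) || ((ec x l == b') && (ec y l == b)))]
    else set0.
  apply/setP=> l; rewrite inE; case: (boolP (l \in common x y)) => [lc|nlc]; last first.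
    by case: ifP => _; rewrite in_set ?(negPf nlc).
  have [xl yl] : adj x l /\ adj y l by move: lc; rewrite inE => /andP.
  have xcs := csP _ _ xl; have ycs := csP _ _ yl.
  rewrite /= /key xpair_eqE /srt; case: ifP => le1; case: ifP => le2; rewrite ?inE ?xl ?yl ?xpair_eqE /=.
  - case: eqP => //= _; case: (boolP (_ && _)) => //= nE; apply/esym/negP => /andP[/eqP xb /eqP yb].
    rewrite xb yb in le1 xcs ycs nE *.
    have Di : index b cs = index b' cs by apply/eqP; rewrite eqn_leq le1 le2.
    have bb : b = b' by rewrite -(nth_index b ycs) Di nth_index.
    by rewrite bb !eqxx in nE.
  - by apply/negP => /and3P[_ /eqP xb /eqP yb]; rewrite xb yb le2 in le1.
  - case: eqP => //= _; rewrite orbC andbC; case: (boolP (_ && _)) => //= nE.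
    by apply/esym/negP => /andP[/eqP xb /eqP yb]; rewrite xb yb le2 in le1.
  - apply/negP => /and3P[_ /eqP yb /eqP xb]; rewrite xb yb in le1.
    by move: (leq_total (index b cs) (index b' cs)); rewrite le1 le2.
have [f [finj fE fk]] : exists f : 'I_n -> 'I_n,
    [/\ {in common i j &, injective f}, f @: common i j = common i' j' &
    {in common i j, forall t, key i' j' (f t) = key i j t}].
  apply: key_matching => -[c [b b']]; rewrite !keyE; case: ifP => // _.
  exact: cnt.
have fc l : l \in common i j -> f l \in common i' j' by move=> lc; rewrite -fE imset_f.
pose F (T : {set 'I_n}) := f (odflt i [pick l | (l \in common i j) && (T == l |: [set i; j])]) |: [set i'; j'].
have FE l : l \in common i j -> F (l |: [set i; j]) = f l |: [set i'; j'].
  move=> lc; rewrite /F; case: pickP => [m /andP[mc /eqP Dm]|/(_ l)]; last by rewrite lc eqxx.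
  by rewrite -(common_inj lc Dm).
exists F; split.
- move=> T T' /(triangle_ofP _ ij)[l lc ->] /(triangle_ofP _ ij)[m mc ->].
  rewrite !FE // => D; congr (_ |: _); apply: finj => //.
  exact: common_inj (fc l lc) D.
- apply/setP=> T; apply/imsetP/idP => [[U /(triangle_ofP _ ij)[l lc ->] ->]|].
    by rewrite FE //; apply/triangle_ofP => //; exists (f l); rewrite ?fc.
  case/(triangle_ofP _ ij') => m; rewrite -fE => /imsetP[l lc ->] ->.
  by exists (l |: [set i; j]); rewrite ?FE //; apply/triangle_ofP => //; exists l.
move=> T /(triangle_ofP _ ij)[l lc ->]; rewrite FE //.
have := fk l lc; rewrite /key /srt => -[vl].
have sw : ec i l = ec j' (f l) -> ec j l = ec i' (f l) ->
    color_iso G (l |: [set i; j]) (f l |: [set i'; j']).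
  move=> e1 e2; rewrite [[set i'; j']]setUC; apply: color_iso_of => //.
  - by rewrite adj_sym.
  - by rewrite common_sym fc.
  by rewrite [RHS]ec_sym.
by case: ifP => _; case: ifP => _ [e1 e2]; [apply: color_iso_of; rewrite ?fc | apply: sw
  | apply: sw | apply: color_iso_of; rewrite ?fc].
Qed.

End EdgeTriangles.

Theorem theorem1p1 (R : realType) (n : nat) (C : eqType) (G : cgraph n C)
    (G_connected : connected_graph G)
    (colors_disjoint : forall (i : 'I_n) (e : {set 'I_n}),
        e \in edges G -> vcol G i <> ecol G e) :
  generated_by_binomials (in_IG (R := R) G) <->
  block_graph G /\ triangle_regular G.
Proof.
have conn := connected_graphP G_connected.
split=> [gen|[bG [vr er tr]]].
  have bg := binomial_middle_separates gen.
  have er := binomial_edge_regular gen bg.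
  split; first exact/(block_graphP G_connected).
  split=> //; first exact: binomial_vertex_regular gen.
  apply: edge_triangle_regular_of_counts er _ => i j i' j' b b' c ij ij' Dc.
  exact: (common_count_color gen b b' c ij ij' Dc).
have bg := block_graph_separates bG.
(* Connectedness excludes the empty graph, and the converse is stated in dimension [n.+1]. *)
case: n G G_connected colors_disjoint conn bG vr er tr bg => [|n] G.
  by case=> /set0Pn[[]].
by move=> _ cd conn _ vr er tr bg; apply: toric_of_regular.
Qed.
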